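(* Let $N\ge3$, let $\lambda_1,\dots,\lambda_N>0$ with $\sum_{i=1}^N\lambda_i=1$, let $S,Y\subseteq\mathbb R^n$ be compact, let $\Omega=\overline{\operatorname{conv}(S\cup Y)}$, let $U\supseteq\Omega$ be open, and let $F\in C^2(U)$ satisfy, as quadratic forms on $U$, $-\tau_FI\le D^2F\le(1-\kappa_F)I$ for some constants $\kappa_F\in(0,1]$, $\tau_F\ge0$. Let $\rho\in\mathcal P_{\mathrm{ac}}(S)\cap L^\infty(S)$ and $$c_F(x_1,\dots,x_N)=\inf_{y\in\mathbb R^n}\sum_{i=1}^N\frac{\lambda_i}2|x_i-y|^2+F\Big(\sum_{i=1}^N\lambda_ix_i\Big).$$ Let $\mu_2,\dots,\mu_N\in\mathcal P(Y)$ and $\tilde\mu_2,\dots,\tilde\mu_N\in\mathcal P(Y)$, and let $(T_2^F,\dots,T_N^F)$ and $(\tilde T_2^F,\dots,\tilde T_N^F)$ be the multi-marginal optimal transport maps for the cost $c_F$ associated with $(\rho,\mu_2,\dots,\mu_N)$ and $(\rho,\tilde\mu_2,\dots,\tilde\mu_N)$ respectively. Then there exists a constant $C>0$, depending only on $\lambda_1$, $N$, $\operatorname{diam}(S\cup Y)$, $\kappa_F$, $\tau_F$, $n$ and $\|\rho\|_{L^\infty}$, such that $$\sum_{i=2}^N\lambda_i\|T_i^F-\tilde T_i^F\|_{L^2(\rho)}\le C\Big(\sum_{i=2}^N\lambda_iW_1(\mu_i,\tilde\mu_i)\Big)^{1/4}.$$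
   Context: $\mathcal P(E)$ is the set of Borel probability measures on $E$; $\mathcal P_{\mathrm{ac}}(S)$ is the set of probability measures on $S$ absolutely continuous with respect to Lebesgue measure; $\rho\in L^\infty(S)$ means that its density is essentially bounded, with $\|\rho\|_{L^\infty}$ the essential supremum of the density. $W_1$ is the 1-Wasserstein distance for the Euclidean distance. Multi-marginal optimal transport maps for the cost $c_F$ associated with $(\rho,\mu_2,\dots,\mu_N)$: the ($\rho$-a.e. unique; existence and uniqueness follow from a theorem of Kim and Pass) minimizers of $\int_Sc_F(x_1,T_2(x_1),\dots,T_N(x_1))\,d\rho(x_1)$ among maps $T_i:S\to Y$ with $(T_i)_\#\rho=\mu_i$, $i=2,\dots,N$. *)

(* Defs.v *)
From HB Require Import structures.
From mathcomp Require Import all_boot all_order all_algebra.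
From mathcomp Require Import all_classical all_reals all_analysis.
From mathcomp Require Import measurable_realfun ess_sup_inf.
Set Implicit Arguments.
Unset Strict Implicit.
Unset Printing Implicit Defensive.
Import Order.TTheory GRing.Theory Num.Theory.
Import numFieldNormedType.Exports.
Local Open Scope classical_set_scope.
Local Open Scope ring_scope.

(* R^n is 'rV[R]_n.  Its library norm `|_| is the sup norm, so the Euclidean
   norm enorm is defined separately; the topologies coincide. *)

(* The sigma-algebra carried by 'rV[R]_n is the Borel one, so that
   probability 'rV[R]_n R is P(R^n). *)
HB.instance Definition _ (R : realType) (n : nat) :=
  Measurable.copy 'rV[R]_n (g_sigma_algebraType (@open 'rV[R]_n)).

Section LebesgueRn.
Context (R : realType).

Lemma open_measurable_rV n (U : set 'rV[R]_n) : open U -> measurable U.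
Proof. by move=> oU; apply: sub_sigma_algebra. Qed.

Lemma open_bigcup_boxes n (U : set 'rV[R]_n) : open U ->
  U = \bigcup_(c : 'rV[rat]_n * rat)
    [set v | ball (map_mx ratr c.1 : 'rV[R]_n) (ratr c.2 : R) `<=` U /\
             ball (map_mx ratr c.1 : 'rV[R]_n) (ratr c.2 : R) v].
Proof.
move=> oU; apply/seteqP; split => [v Uv|v [c _ [+]]]; last exact.
have /nbhs_ballP[e /= e0 eU] : nbhs v U by exact: open_nbhs_nbhs.
have [r r0 re] : exists2 r : rat, (0 < r)%R & ratr r < e / 2 :> R.
  have := @rat_in_itvoo R 0 (e / 2) _; rewrite divr_gt0// => /(_ isT)[q].
  by rewrite in_itv/= => /andP[q0 qe]; exists q => //; rewrite -(ltr0q R).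
have rr0 : 0 < ratr r :> R by rewrite ltr0q.
have Hq i : exists q : rat, `|v ord0 i - ratr q| < ratr r.
  have := @rat_in_itvoo R (v ord0 i - ratr r) (v ord0 i + ratr r) _.
  case; first by rewrite ltrD2l gt0_cp.
  move=> q; rewrite in_itv/= => /andP[q1 q2]; exists q.
  by rewrite ltr_distlC q1 q2.
have [q {}Hq] := choice Hq.
pose c := (\row_i q i, r).
have cE i : `|v ord0 i - ratr (c.1 ord0 i)| < ratr r by rewrite mxE.
exists c => //=; split.
- move=> w [_ bw]; apply: eU; split=> // i j; rewrite ord1.
  have := bw ord0 j; rewrite /ball/= mxE => cw.
  rewrite (_ : _ - _ = (v ord0 j - ratr (c.1 ord0 j)) +
    (ratr (c.1 ord0 j) - w ord0 j)); last by rewrite addrA subrK.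
  rewrite (le_lt_trans (ler_normD _ _))// (splitr e) ltrD//.
    exact: lt_trans (cE j) re.
  exact: lt_trans cw re.
- split=> // i j; rewrite [i]ord1 /ball/= !mxE distrC; exact: Hq.
Qed.

Lemma measurable_rowP d (T : measurableType d) n (f : T -> 'rV[R]_n) :
  (forall i, measurable_fun [set: T] (fun x => f x ord0 i)) ->
  measurable_fun [set: T] f.
Proof.
move=> mf; apply: (@measurability _ _ _ _ _ _ (@open 'rV[R]_n)) => //.
move=> _ [U oU <-]; rewrite setTI (open_bigcup_boxes oU) preimage_bigcup.
apply: countable_bigcupT_measurable => // -[q r].
have [bU|bU] := pselect (ball (map_mx ratr q : 'rV[R]_n) (ratr r : R) `<=` U);
    last first.
  by rewrite (_ : _ @^-1` _ = set0)//; apply/seteqP; split => // x [].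
have [r0|r0] := ltP 0 (ratr r : R); last first.
  rewrite (_ : _ @^-1` _ = set0)//; apply/seteqP; split => // x [_ []].
  by rewrite ltNge r0.
rewrite (_ : _ @^-1` _ =
    \bigcap_(i in [set: 'I_n]) ((fun x => f x ord0 i) @^-1`
                      ball (ratr (q ord0 i) : R) (ratr r))).
  apply: fin_bigcap_measurable => // i _; rewrite -[X in measurable X]setTI.
  by apply: mf => //; apply: open_measurable; exact: ball_open.
apply/seteqP; split => [x [_ [_ b]] i _|x b].
  by have := b ord0 i; rewrite mxE.
split=> //; split=> // i j; rewrite ord1 mxE; exact: b.
Qed.

Lemma measurable_coord n (i : 'I_n) :
  measurable_fun [set: 'rV[R]_n] (fun v => v ord0 i : R).
Proof.
apply: (measurability _ (RGenOpens.measurableE R)).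
move=> _ [_ [a [b ->]] <-]; rewrite setTI; apply: open_measurable_rV.
by apply: open_comp => // x _; exact: coord_continuous.
Qed.

Definition cons_row n (z : R * 'rV[R]_n) : 'rV[R]_n.+1 :=
  \row_i if unlift ord0 i is Some j then z.2 ord0 j else z.1.

Lemma cons_row0 n (z : R * 'rV[R]_n) : cons_row z ord0 ord0 = z.1.
Proof. by rewrite mxE unlift_none. Qed.

Lemma cons_rowS n (z : R * 'rV[R]_n) (i : 'I_n) :
  cons_row z ord0 (lift ord0 i) = z.2 ord0 i.
Proof. by rewrite mxE liftK. Qed.

Lemma measurable_cons_row n : measurable_fun [set: R * 'rV[R]_n] (@cons_row n).
Proof.
apply: measurable_rowP => i; case: (unliftP ord0 i) => [j|] ->.
  under eq_fun do rewrite cons_rowS.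
  exact: (measurableT_comp (measurable_coord j) measurable_snd).
by under eq_fun do rewrite cons_row0; exact: measurable_fst.
Qed.

Definition uncons_row n (v : 'rV[R]_n.+1) : R * 'rV[R]_n :=
  (v ord0 ord0, \row_i v ord0 (lift ord0 i)).

Lemma cons_rowK n : cancel (@cons_row n) (@uncons_row n).
Proof.
move=> [x v]; rewrite /uncons_row cons_row0; congr pair.
by apply/rowP => i; rewrite mxE cons_rowS.
Qed.

Lemma measurable_uncons_row n : measurable_fun [set: 'rV[R]_n.+1] (@uncons_row n).
Proof.
apply: measurable_fun_pair; first exact: measurable_coord.
apply: measurable_rowP => i /=; under eq_fun do rewrite mxE.
exact: measurable_coord.
Qed.

Section step.
Context n (m : {sigma_finite_measure set 'rV[R]_n -> \bar R}).

Definition lebesgue_step : set 'rV[R]_n.+1 -> \bar R :=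
  pushforward (lebesgue_measure \x m)%E (@cons_row n).

HB.instance Definition _ := Measure.copy lebesgue_step
  (measure_function_pushforward__canonical__measure_function_Measure
    (lebesgue_measure \x m)%E (@measurable_cons_row n)).

Lemma lebesgue_step_sigma_finite : sigma_finite [set: 'rV[R]_n.+1] lebesgue_step.
Proof.
have /sigma_finiteP[F [TF ndF Foo]] := sigma_finiteT (@lebesgue_measure R).
have /sigma_finiteP[G [TG ndG Goo]] := sigma_finiteT m.
exists (fun i => @uncons_row n @^-1` (F i `*` G i)).
  rewrite -preimage_bigcup (_ : \bigcup_i _ = setT) ?preimage_setT//.
  apply/seteqP; split => // -[x v] _.
  have [i _ Fx] : (\bigcup_i F i) x by rewrite -TF.
  have [j _ Gv] : (\bigcup_i G i) v by rewrite -TG.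
  exists (maxn i j) => //; split => /=.
    by apply: (subsetPset _ _ (ndF _ _ (leq_maxl i j))).
  by apply: (subsetPset _ _ (ndG _ _ (leq_maxr i j))).
move=> i; have [[mF Fi] [mG Gi]] := (Foo i, Goo i).
have mFG : measurable (F i `*` G i) by exact: measurableX.
split; first by rewrite -[X in measurable X]setTI; exact: measurable_uncons_row.
rewrite /lebesgue_step /pushforward (_ : _ @^-1` _ = F i `*` G i).
  by rewrite product_measure1E// lte_mul_pinfty// ge0_fin_numE.
by apply/seteqP; split => z; rewrite /preimage /mkset cons_rowK.
Qed.

HB.instance Definition _ := Measure_isSigmaFinite.Build _ _ _ lebesgue_step
  lebesgue_step_sigma_finite.

End step.

(* Lebesgue measure on R^n: the product of n copies of lebesgue_measure,
   built along R^(n+1) = R x R^n; see lebesgue_rV_box for its values. *)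
Fixpoint lebesgue_rV n : {sigma_finite_measure set 'rV[R]_n -> \bar R} :=
  if n is n'.+1 then lebesgue_step (lebesgue_rV n') else \d_(0 : 'rV[R]_0).

Lemma measurable_box n (a b : 'rV[R]_n) :
  measurable [set v : 'rV[R]_n | forall i, a ord0 i <= v ord0 i <= b ord0 i].
Proof.
rewrite (_ : mkset _ = \bigcap_(i in [set: 'I_n])
    ((fun v : 'rV[R]_n => v ord0 i) @^-1` `[a ord0 i, b ord0 i]%classic)).
  apply: fin_bigcap_measurable => // i _; rewrite -[X in measurable X]setTI.
  by apply: measurable_coord => //; exact: measurable_itv.
apply/seteqP; split => v /= h i; first by move=> _ /=; rewrite in_itv/=.
by have := h i I; rewrite /= in_itv.
Qed.

Lemma lebesgue_rV_box n (a b : 'rV[R]_n) :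
  (forall i, a ord0 i <= b ord0 i) ->
  lebesgue_rV n [set v : 'rV[R]_n | forall i, a ord0 i <= v ord0 i <= b ord0 i] =
  (\prod_i (b ord0 i - a ord0 i))%:E.
Proof.
elim: n a b => [|n IH] a b ab /=.
  by rewrite big_ord0 diracE mem_set// => -[].
rewrite /lebesgue_step /pushforward.
pose tl (v : 'rV[R]_n.+1) := (uncons_row v).2.
have tlE (v : 'rV[R]_n.+1) i : tl v ord0 i = v ord0 (lift ord0 i).
  by rewrite mxE.
transitivity ((lebesgue_measure \x lebesgue_rV n)%E
    ((`[a ord0 ord0, b ord0 ord0]%classic : set (measurableTypeR R)) `*`
     [set v : 'rV[R]_n | forall i, tl a ord0 i <= v ord0 i <= tl b ord0 i])).
  congr ((lebesgue_measure \x _)%E _).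
  apply/seteqP; split => -[x v] /=.
    move=> h; split=> [|i]; last by have := h (lift ord0 i); rewrite cons_rowS !tlE.
    by have := h ord0; rewrite cons_row0 in_itv.
  rewrite in_itv/= => -[hx hv] i; case: (unliftP ord0 i) => [j|] ->.
    by rewrite cons_rowS -!tlE; exact: hv.
  by rewrite cons_row0.
rewrite product_measure1E; [|exact: measurable_itv|exact: measurable_box].
rewrite IH => [|i]; last by rewrite !tlE.
rewrite [X in (X * _)%E](lebesgue_measure_itv `[a ord0 ord0, b ord0 ord0]).
rewrite /= lte_fin big_ord_recl.
under eq_bigr do rewrite !tlE.
by case: ltP => // h; rewrite mul0e (_ : b _ _ = a ord0 ord0) ?subrr ?mul0r//;
  apply/eqP; rewrite eq_le h ab.
Qed.

End LebesgueRn.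

Section Problem.
Context (R : realType) (n : nat).
Local Notation V := 'rV[R]_n.

Definition enorm (v : V) : R := Num.sqrt (\sum_i v ord0 i ^+ 2).

Definition diam (A : set V) : R := sup [set enorm (x - y) | x in A & y in A].

Definition conv_hull (A : set V) : set V := smallest (@convex_set R V) A.

Definition partial (i : 'I_n) (f : V -> R) (x : V) : R := 'D_(delta_mx 0 i) f x.

Definition hessian (f : V -> R) (x : V) : 'M[R]_n :=
  \matrix_(i, j) partial j (partial i f) x.

Definition quad_form (A : 'M[R]_n) (v : V) : R := (v *m A *m v^T) ord0 ord0.

(* C^2 on an open set U: the partial derivatives of order at most 2 exist and
   are continuous on U. *)
Definition C2_on (U : set V) (f : V -> R) : Prop :=
  [/\ forall x, U x -> {for x, continuous f},
      forall i x, U x -> derivable f x (delta_mx 0 i) /\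
        {for x, continuous (partial i f)} &
      forall i j x, U x -> derivable (partial i f) x (delta_mx 0 j) /\
        {for x, continuous (partial j (partial i f))}].

(* The essential supremum of the density of rho. *)
Definition Linfty_norm (rho : probability V R) : \bar R :=
  Lnorm (lebesgue_rV R n) +oo%E
    (Radon_Nikodym (charge_of_finite_measure rho) (lebesgue_rV R n)).

Definition coupling (mu nu : probability V R) (pi : probability (V * V)%type R) :=
  (forall A, measurable A -> pi (A `*` setT) = mu A) /\
  (forall B, measurable B -> pi (setT `*` B) = nu B).

Definition W1 (mu nu : probability V R) : \bar R :=
  ereal_inf [set (\int[pi]_z (enorm (z.1 - z.2))%:E)%E | pi in coupling mu nu].

Definition L2dist (rho : probability V R) (S : set V) (f g : V -> V) : \bar R :=
  ('N[rho]_2%:E[(EFin \o (fun x => enorm (f x - g x))) \_ S])%E.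

(* There are N.+1 marginals: index ord0 is the marginal rho, and the index
   i : 'I_N of the other data stands for lift ord0 i : 'I_N.+1. *)
Section Multimarginal.
Context (N : nat).

Definition cost (lambda : 'I_N.+1 -> R) (F : V -> R) (x : 'I_N.+1 -> V) : R :=
  inf [set \sum_i lambda i / 2 * enorm (x i - y) ^+ 2 | y in [set: V]] +
  F (\sum_i lambda i *: x i).

Definition maps_point (T : 'I_N -> V -> V) (x : V) (i : 'I_N.+1) : V :=
  if unlift ord0 i is Some j then T j x else x.

(* Maps T_i : S -> Y are functions on R^n whose values off S are irrelevant. *)
Definition transport_maps (S Y : set V) (rho : probability V R)
    (mu : 'I_N -> probability V R) (T : 'I_N -> V -> V) : Prop :=
  forall i, [/\ measurable_fun S (T i),
    forall x, S x -> Y (T i x) &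
    forall A, measurable A -> rho (S `&` T i @^-1` A) = mu i A].

Definition transport_cost (c : ('I_N.+1 -> V) -> R) (S : set V)
    (rho : probability V R) (T : 'I_N -> V -> V) : \bar R :=
  \int[rho]_(x in S) (c (maps_point T x))%:E.

Definition optimal_maps (c : ('I_N.+1 -> V) -> R) (S Y : set V)
    (rho : probability V R) (mu : 'I_N -> probability V R)
    (T : 'I_N -> V -> V) : Prop :=
  transport_maps S Y rho mu T /\
  forall T', transport_maps S Y rho mu T' ->
    (transport_cost c S rho T <= transport_cost c S rho T')%E.

End Multimarginal.
End Problem.

(* Main.v *)
Require Import Defs.
From HB Require Import structures.
From mathcomp Require Import all_boot all_order all_algebra.
From mathcomp Require Import all_classical all_reals all_analysis.
From mathcomp Require Import measurable_realfun ess_sup_inf ring lra.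
Set Implicit Arguments.
Unset Strict Implicit.
Unset Printing Implicit Defensive.
Import Order.TTheory GRing.Theory Num.Theory.
Import numFieldNormedType.Exports.
Local Open Scope classical_set_scope.
Local Open Scope ring_scope.

(** Write [G z = |z|^2 / 2 - F z - <q, z>] for a suitable vector [q], and [b] for the
    mean of a tuple of points with weights [lambda]. The infimum over [y] in the cost
    is attained at [b], so the cost is a sum of functions of one point minus [G b].
    Optimal maps therefore maximize the gain, that is the integral of [G b_T], where
    [b_T x] is the mean of [x] and of the points [T_i x]. On the hull of [S] and [Y],
    [G] is [kappa]-strongly convex; [q] is chosen so that its gradient [P] is bounded
    there by a constant [L] that depends on [tau] and on the diameter only
    ([regular_extension]).

    The problem has a dual: potentials [f, u_2, ..., u_N] with
    [f x + sum u_i y_i >= G b] everywhere. For such potentials the gap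
    [e_T x = f x + sum u_i (T_i x) - G (b_T x)] is nonnegative, and for optimal maps
    its integral can be made arbitrarily small ([optimal_certificate]). This strong
    duality for maps, up to an error, is [near_duality]: on a fine finite grid it is
    linear programming duality ([simplex_duality]), and a plan on the grid is realised
    by maps because [rho] has no atoms ([transport_exists], [plan_realised_by_maps]).
    Since the potentials are Lipschitz, the gap of the optimal maps [T'] for other
    marginals has an integral of the order of the sum [w] of the Wasserstein distances
    ([stability_of_certificate]).

    Two consequences of the dual constraint compare [T] and [T'] at a point [x]; put
    [p = P (b_T x)], [p' = P (b_T' x)] and [e = e_T x + e_T' x]. Exchanging the [i]-th
    points of the two tuples, strong convexity gives ([exchange_le])
      [kappa |lambda_i (T'_i x - T_i x)|^2 <= <p' - p, lambda_i (T'_i x - T_i x)> + e].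
    Moving [x] instead, one finds ([second_difference_ge])
      [lambda_1 <p' - p, h> <= f (x + h) + f (x - h) - 2 f x + e].
    As [f] can be taken convex and Lipschitz, the integral of this second difference
    over a box is [O(|h|^2)]: it telescopes to slabs of thickness [|h|] at the boundary
    ([integral_second_difference]). The density of [rho] being bounded, the same holds
    for [rho]. Hence the integral of [|p' - p|] is [O(|h| + w / |h|)], that is
    [O(sqrt w)] for [|h| = sqrt w]. The first inequality then bounds the squared [L^2]
    distances by [O(sqrt w)], which is the exponent [1/4]. *)

(** * Linear programming duality over a simplex *)

Section SimplexDuality.
Context (R : realType).

Definition simplex p : set 'rV[R]_p :=
  [set v | (forall i, 0 <= v 0 i) /\ \sum_i v 0 i = 1].

Lemma continuous_sum (T : topologicalType) (I : Type) (s : seq I) (f : I -> T -> R) :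
  (forall i, continuous (f i)) -> continuous (fun x => \sum_(i <- s) f i x).
Proof.
move=> cf x; elim: s => [|i s IH].
  by under eq_fun do rewrite big_nil; exact: cst_continuous.
by under eq_fun do rewrite big_cons; apply: continuousD; [exact: cf|exact: IH].
Qed.

Lemma simplex_le1 p (v : 'rV[R]_p) i : simplex v -> v 0 i <= 1.
Proof.
move=> [v0 <-]; rewrite (bigD1 i)//= lerDl; exact: sumr_ge0.
Qed.

Lemma compact_simplex p : compact (@simplex p).
Proof.
apply: (@subclosed_compact _ _ [set v : 'rV[R]_p | forall i, `[0, 1]%classic (v 0 i)]).
- have -> : @simplex p = [set v : 'rV[R]_p | forall i, 0 <= v 0 i] `&`
     ((fun v : 'rV[R]_p => \sum_i v 0 i) @^-1` [set (1:R)]) by apply/seteqP; split.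
  apply: closedI.
    rewrite (_ : mkset _ = \bigcap_(i in setT) ((fun v : 'rV[R]_p => v 0 i) @^-1` [set x | 0 <= x])).
      apply: closed_bigI => i _; apply: closed_comp; last exact: closed_ge.
      by move=> x _; exact: coord_continuous.
    by apply/seteqP; split => v /= h i => [_|]; [exact: h|exact: h i I].
  apply: closed_comp; last exact: closed_eq.
  by move=> x _; apply: continuous_sum => i; exact: coord_continuous.
- by apply: (@rV_compact R p (fun=> (`[0, 1]%classic : set R))) => i; exact: segment_compact.
- by move=> v sv i /=; rewrite in_itv/= simplex_le1// andbT; case: sv.
Qed.

Context (p q : nat) (c : 'I_p -> R) (A : 'I_p -> 'I_q -> R) (b : 'I_q -> R).

Let lin (v : 'rV[R]_p) : R := \sum_k c k * v 0 k.
Let defect l (v : 'rV[R]_p) : R := \sum_k A k l * v 0 k - b l.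
Let err2 (v : 'rV[R]_p) : R := \sum_l defect l v ^+ 2.

Let continuous_lin : continuous lin.
Proof.
by apply: continuous_sum => i x; apply: continuousM; [exact: cst_continuous|exact: coord_continuous].
Qed.

Let continuous_err2 : continuous err2.
Proof.
apply: continuous_sum => l x.
have cd : {for x, continuous (defect l)}.
  apply: continuousB; last exact: cst_continuous.
  move: x; apply: continuous_sum => i x.
  by apply: continuousM; [exact: cst_continuous|exact: coord_continuous].
by under eq_fun do rewrite expr2; exact: continuousM.
Qed.

Let towards (v : 'rV[R]_p) k t : 'rV[R]_p := \row_j ((1 - t) * v 0 j + t * (j == k)%:R).

Let sum_towards (a : 'I_p -> R) v k t :
  \sum_j a j * towards v k t 0 j = (1 - t) * (\sum_j a j * v 0 j) + t * a k.
Proof.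
under eq_bigr do rewrite mxE mulrDr !(mulrCA (a _)).
rewrite big_split/= -!mulr_sumr; congr (_ + t * _).
by rewrite (bigD1 k)//= eqxx mulr1 big1 ?addr0// => j /negbTE ->; rewrite mulr0.
Qed.

Let simplex_towards v k t : 0 <= t <= 1 -> simplex v -> simplex (towards v k t).
Proof.
move=> /andP[t0 t1] [v0 v1]; split=> [i|].
  by rewrite mxE addr_ge0// mulr_ge0// subr_ge0.
have := sum_towards (fun=> 1) v k t.
under eq_bigr do rewrite mul1r.
by under [X in _ = _ * X + _ -> _]eq_bigr do rewrite mul1r; rewrite v1 => ->; ring.
Qed.

(** The equality constraints are replaced by a quadratic penalty: the maximum is
    then attained on a compact set whatever the data, and the defects, multiplied
    by the weight of the penalty, are the dual variables. *)
Let penalised (B : R) v := lin v - B / 2 * err2 v.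

(** Moving from a maximizer towards a vertex cannot increase the objective to
    first order. *)
Lemma penalised_first_order B v k : simplex v ->
  (forall w, simplex w -> penalised B w <= penalised B v) ->
  c k <= lin v + B * \sum_l defect l v * (A k l - \sum_j A j l * v 0 j).
Proof.
move=> sv vmax.
pose s l := A k l - \sum_j A j l * v 0 j.
set X := \sum_l defect l v * s l; pose Q := \sum_l s l ^+ 2.
have exp t : penalised B (towards v k t) =
    penalised B v + t * (c k - lin v - B * X) - t ^+ 2 * (B / 2 * Q).
  rewrite /penalised /lin sum_towards -/(lin v).
  have -> : err2 (towards v k t) = err2 v + 2 * t * X + t ^+ 2 * Q.
    rewrite /err2 /X /Q !mulr_sumr -!big_split/=; apply: eq_bigr => l _.
    by rewrite {1}/defect sum_towards /s /defect; ring.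
  by field.
rewrite leNgt; apply/negP => clt.
pose a := c k - lin v - B * X.
have a0 : 0 < a by rewrite /a; lra.
have key t : 0 < t -> t <= 1 -> a <= t * (B / 2 * Q).
  move=> t0 t1; have := vmax _ (simplex_towards k _ sv) => /(_ t).
  rewrite (ltW t0) t1 exp -/a => /(_ isT) h.
  by rewrite -(ler_pM2l t0); move: h; rewrite expr2; lra.
have C0 : 0 < B / 2 * Q by have := key 1 ltr01 (lexx _); lra.
(* Any small enough [t] contradicts [key]; this one is also below [1]. *)
pose t := a / (a + B / 2 * Q) / 2.
have aC : 0 < a + B / 2 * Q by lra.
have t0 : 0 < t by rewrite /t !divr_gt0.
have t12 : t <= 1 / 2 by rewrite /t ler_pdivrMr// mulfVK// ler_pdivrMr//; lra.
have := key t t0 ltac:(lra).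
have : t * (B / 2 * Q) < a.
  by rewrite /t mulrAC ltr_pdivrMr// mulrAC ltr_pdivrMr//; nra.
lra.
Qed.

(** The value of the dual point read off the penalised maximizer [w] is
    [lin w - B * err2 w], so duality holds as soon as some [lin w] is close to the
    primal optimum. If every [lin w] stayed [delta] above it, letting [B] grow would
    make [err2] vanish at a point of the compact set where [lin] is at least the optimum plus [delta], that is,
    produce a feasible point better than the optimum. *)
Lemma simplex_duality :
  (exists2 v, simplex v & forall l, \sum_k A k l * v 0 k = b l) ->
  exists v, [/\ simplex v, forall l, \sum_k A k l * v 0 k = b l &
    forall delta, 0 < delta -> exists u s,
      (forall k, c k <= \sum_l u l * A k l + s) /\
      \sum_l u l * b l + s <= \sum_k c k * v 0 k + delta].
Proof.
move=> [v0 sv0 v0b].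
have err2_ge0 v : 0 <= err2 v by apply: sumr_ge0 => l _; exact: sqr_ge0.
have err2_eq0 v : err2 v = 0 -> forall l, \sum_k A k l * v 0 k = b l.
  move=> /eqP; rewrite psumr_eq0 => [/allP h l|l _]; last exact: sqr_ge0.
  by have := h l (mem_index_enum _); rewrite /= sqrf_eq0 subr_eq0 => /eqP.
have err2_feas (v : 'rV[R]_p) : (forall l, \sum_k A k l * v 0 k = b l) -> err2 v = 0.
  by move=> vb; rewrite /err2 big1// => l _; rewrite /defect vb subrr expr0n.
have cF : compact (@simplex p `&` err2 @^-1` [set 0]).
  apply: compact_closedI; first exact: compact_simplex.
  by apply: closed_comp; [move=> x _; exact: continuous_err2|exact: closed_eq].
have [||v] := EVT_max_rV _ cF (f := lin).
- by exists v0; split => //; exact: err2_feas.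
- exact/continuous_subspaceT/continuous_lin.
rewrite inE => -[sv /err2_eq0 vb] vmax; exists v; split => // delta delta0.
have vmax' w : simplex w -> err2 w = 0 -> lin w <= lin v.
  by move=> sw w0; apply: vmax; rewrite inE.
have vB (B : R) : exists2 w, simplex w & forall w', simplex w' -> penalised B w' <= penalised B w.
  have [||w] := EVT_max_rV _ (@compact_simplex p) (f := penalised B).
  - by exists v0.
  - apply/continuous_subspaceT => x; apply: continuousB; first exact: continuous_lin.
    by apply: continuousM; [exact: cst_continuous|exact: continuous_err2].
  by rewrite inE => sw wmax; exists w => // w' sw'; apply: wmax; rewrite inE.
suff [B [w [B0 sw wmax wlin]]] : exists B w, [/\ 0 <= B, simplex w,
    forall w', simplex w' -> penalised B w' <= penalised B w & lin w <= lin v + delta].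
  exists (fun l => B * defect l w), (lin w - B * \sum_l defect l w * (\sum_j A j l * w 0 j)); split.
    move=> k; apply: le_trans (penalised_first_order k sw wmax) _.
    rewrite le_eqVlt; apply/orP; left; apply/eqP.
    rewrite addrCA; congr (_ + _); rewrite !mulr_sumr -sumrB.
    by apply: eq_bigr => l _; ring.
  have -> : \sum_l B * defect l w * b l + (lin w - B * \sum_l defect l w * (\sum_j A j l * w 0 j)) =
      lin w - B * err2 w.
    rewrite /err2 !mulr_sumr addrCA; congr (_ + _); rewrite -sumrB -sumrN.
    by apply: eq_bigr => l _; rewrite /defect; ring.
  by have := mulr_ge0 B0 (err2_ge0 w); move: wlin; rewrite -/(lin v); lra.
apply: contrapT => hN.
have {}vB B : 0 <= B -> exists2 w, simplex w /\ lin v + delta <= lin w & B / 2 * err2 w <= lin w - lin v.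
  move=> B0; have [w sw wmax] := vB B; exists w.
    split=> //; rewrite leNgt; apply/negP => /ltW wv.
    by apply: hN; exists B, w.
  by have := wmax v sv; rewrite /penalised (err2_feas v vb) mulr0; lra.
have cE : compact (@simplex p `&` lin @^-1` [set x | lin v + delta <= x]).
  apply: compact_closedI; first exact: compact_simplex.
  by apply: closed_comp; [move=> x _; exact: continuous_lin|exact: closed_ge].
have [||w] := EVT_min_rV _ cE (f := err2).
- by have [w [sw wl] _] := vB 0 (lexx _); exists w.
- exact/continuous_subspaceT/continuous_err2.
rewrite inE => -[sw /= lw] wmin.
have [||m] := EVT_max_rV _ (@compact_simplex p) (f := lin).
- by exists v0.
- exact/continuous_subspaceT/continuous_lin.
rewrite inE => sm mmax.
have ew : 0 < err2 w.
  rewrite lt_neqAle err2_ge0 andbT eq_sym; apply/eqP => ew0.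
  by have := vmax' w sw ew0; lra.
have lmv : 0 <= lin m - lin v by rewrite subr_ge0; apply: mmax; rewrite inE.
(* This weight turns the smallest defect [err2 w] into a penalty larger than the
   whole range of [lin] above [lin v]. *)
pose B := 2 * (lin m - lin v + 1) / err2 w.
have [|w' [sw' lw'] ew'] := vB B; first by rewrite /B divr_ge0// ?ltW//; lra.
have : err2 w <= err2 w' by apply: wmin; rewrite inE.
have : lin w' <= lin m by apply: mmax; rewrite inE.
move=> h1 h2.
have h3 : B / 2 * err2 w <= B / 2 * err2 w'.
  by rewrite ler_wpM2l// /B !divr_ge0// ?ltW//; lra.
have h4 : B / 2 * err2 w = lin m - lin v + 1 by rewrite /B; field; rewrite gt_eqF.
lra.
Qed.

End SimplexDuality.

(** * Monotone transport on the line *)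

Section RealTransport.
Context (R : realType).
Local Notation mR := (measurableTypeR R).
Local Open Scope ereal_scope.

(** Right continuity of the distribution function. *)
Lemma ray_ge_of_right (nu : {measure set mR -> \bar R}) (c : \bar R) (s : R) :
  nu setT < +oo ->
  (forall n : nat, c <= nu `]-oo, (s + n.+1%:R^-1)%R]%classic) ->
  c <= nu `]-oo, s]%classic.
Proof.
move=> nufin cn.
have mI (x : R) : measurable (`]-oo, x]%classic : set mR) by exact: measurable_itv.
have cvg : nu \o (fun n => `]-oo, (s + n.+1%:R^-1)%R]%classic : set mR) @ \oo -->
    nu (\bigcap_n (`]-oo, (s + n.+1%:R^-1)%R]%classic : set mR)).
  apply: nonincreasing_cvg_mu.
  - by apply: le_lt_trans nufin; apply: le_measure; rewrite ?inE.
  - by [].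
  - by apply: bigcapT_measurable => k.
  - move=> m n mn; apply/subsetPset => x /=; rewrite !in_itv/= => /le_trans; apply.
    by rewrite lerD2l lef_pV2 ?posrE// ler_nat.
rewrite -(@itvNycEbigcap R false s) in cvg.
by apply: cvge_ge cvg; apply: nearW => n; exact: cn.
Qed.

(** Left continuity of the distribution function at a point that is not an atom. *)
Lemma ray_le_of_left (nu : {measure set mR -> \bar R}) (c : \bar R) (s : R) :
  nu [set s] = 0 ->
  (forall n : nat, nu `]-oo, (s - n.+1%:R^-1)%R]%classic <= c) ->
  nu `]-oo, s]%classic <= c.
Proof.
move=> nus cn.
have mI (x : R) : measurable (`]-oo, x]%classic : set mR) by exact: measurable_itv.
have bE : \bigcup_n (`]-oo, (s - n.+1%:R^-1)%R]%classic : set mR) = `]-oo, s[%classic.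
  apply/seteqP; split => [x [n _ /=]|x /=]; rewrite !in_itv/=.
    by move=> /le_lt_trans; apply; rewrite ltrBlDr ltrDl ?ltr01 ?invr_gt0 ?ltr0n.
  move=> /ltr_add_invr[k xk]; exists k => //=; rewrite in_itv/= lerBrDr.
  exact: ltW.
have cvg : nu \o (fun n => `]-oo, (s - n.+1%:R^-1)%R]%classic : set mR) @ \oo -->
    nu (\bigcup_n (`]-oo, (s - n.+1%:R^-1)%R]%classic : set mR)).
  apply: nondecreasing_cvg_mu => //.
  - by apply: bigcupT_measurable => k.
  - move=> m n mn; apply/subsetPset => x /=; rewrite !in_itv/= => /le_trans; apply.
    by rewrite lerD2l lerN2 lef_pV2 ?posrE// ler_nat.
rewrite bE in cvg.
have -> : (`]-oo, s]%classic : set mR) = `]-oo, s[%classic `|` [set s].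
  apply/seteqP; split => [x|x]/=; rewrite !in_itv/= le_eqVlt.
    by move=> /orP[/eqP ->|->]; [right|left].
  by case=> [->|->]; rewrite ?orbT ?eqxx.
apply: le_trans (measureU2 _ _ _) _ => //=; try exact: measurable_itv.
by rewrite [X in _ + X]nus adde0; apply: cvge_le cvg; apply: nearW => n; exact: cn.
Qed.

Lemma eq_measure_rays (m1 m2 : {measure set mR -> \bar R}) :
  m1 setT < +oo -> m1 setT = m2 setT ->
  (forall s, m1 `]-oo, s]%classic = m2 `]-oo, s]%classic) ->
  forall B, measurable B -> m1 B = m2 B.
Proof.
move=> fin1 eqT eqs B mB.
pose g (n : nat) : set R := `](- n%:R)%R, +oo[%classic.
apply: (@measure_unique _ R mR (@RGenOInfty.G R) g (RGenOInfty.measurableE R) _ _ _ m1 m2) => //.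
- move=> _ _ [x ->] [y ->]; exists (Num.max x y).
  by apply/seteqP; split => z /=; rewrite !in_itv/= !andbT gt_max => /andP.
- by move=> i; exists (- i%:R)%R.
- rewrite -subTset => x _; exists (Num.truncn `|x|%R).+1 => //=.
  by rewrite /g/= in_itv/= andbT ltrNl (le_lt_trans (ler_norm _))// normrN truncnS_gt.
- move=> _ [x ->]; rewrite -setCitvl.
  have mI : measurable (`]-oo, x]%classic : set mR) by exact: measurable_itv.
  have fin2 : m2 [set: R] < +oo by rewrite -[X in X < _]eqT.
  rewrite -!setTD [LHS]measureD// [RHS]measureD// !setTI.
  have e : m1 [set: R] = m2 [set: R] by exact: eqT.
  by have := eqs x => /= e2; rewrite -[X in X - _]/(m1 [set: R]) e; congr (_ - _).
- move=> k; apply: le_lt_trans fin1; apply: le_measure; rewrite ?inE//.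
  exact: measurable_itv.
Qed.

(** The quantile function of [m] composed with the distribution function [F] of
    [nu]: as [nu] has no atom, [F] pushes [nu] to the uniform law on its range.
    The support of [m] in the unit interval keeps the infima that define the
    quantiles bounded and attained. *)
Lemma real_transport (nu m : {measure set mR -> \bar R}) (K : R) :
  nu setT < +oo -> nu setT = m setT ->
  (forall t, nu [set t] = 0) -> nu `]-oo, (- K)%R[%classic = 0 -> nu `]-oo, K]%classic = nu setT ->
  m `]-oo, 0%R[%classic = 0 -> m `]-oo, 1%R]%classic = m setT ->
  exists q : mR -> mR, measurable_fun setT q /\
    forall B, measurable B -> nu (q @^-1` B) = m B.
Proof.
move=> nufin num atom nuNK nuK m0 m1.
have mfin : m setT < +oo by rewrite -num.
have mI (x : R) : measurable (`]-oo, x]%classic : set mR) by exact: measurable_itv.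
pose F x := nu `]-oo, x]%classic; pose H x := m `]-oo, x]%classic.
have Fmono x y : (x <= y)%R -> F x <= F y.
  by move=> xy; apply: le_measure; rewrite ?inE//; exact: subset_itvl.
have Hmono x y : (x <= y)%R -> H x <= H y.
  by move=> xy; apply: le_measure; rewrite ?inE//; exact: subset_itvl.
have FT x : F x <= nu setT by apply: le_measure; rewrite ?inE.
have HT x : H x <= m setT by apply: le_measure; rewrite ?inE.
pose A x := [set s : R | (0 <= s <= 1)%R /\ F x <= H s].
pose q : mR -> mR := fun x => inf (A x).
have A1 x : A x 1%R by split; [rewrite ler01 lexx|rewrite /H m1 -num].
have lbA x : lbound (A x) 0%R by move=> s [/andP[]].
have hA x : has_inf (A x) by split; [exists 1%R|exists 0%R].
have q01 x : (0 <= q x <= 1)%R.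
  apply/andP; split; first by apply: lb_le_inf => //; exists 1%R.
  by apply: ge_inf => //; exists 0%R.
have mono : {in setT &, {homo q : x y / (x <= y)%R}}.
  move=> x y _ _ xy; apply: lb_le_inf; first by exists 1%R.
  move=> s [s01 ys]; apply: ge_inf; first by exists 0%R.
  by split => //; apply: le_trans ys; exact: Fmono.
have mq : measurable_fun setT q by apply: nondecreasing_measurable => // x y; apply: mono; rewrite inE.
exists q; split => //.
pose qnu : {measure set mR -> \bar R} := 
  measure_function_pushforward__canonical__measure_function_Measure nu mq.
have qle (s : R) x : (0 <= s < 1)%R -> (q x <= s)%R <-> F x <= H s.
  move=> /andP[s0 s1]; split; last first.
    by move=> h; apply: ge_inf; [exists 0%R|split=> //; rewrite s0 ltW].
  move=> qs; apply: ray_ge_of_right => // n.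
  have [z [z01 xz] zs] := @inf_adherent _ (A x) n.+1%:R^-1 ltac:(by []) (hA x).
  apply: le_trans xz _; apply: Hmono; apply: ltW; apply: (lt_le_trans zs).
  by rewrite lerD2r.
(* The law of [F] under [nu] is uniform: by continuity from both sides, [F] takes
   the value [r] at the supremum [t] of the points where it is at most [r]. *)
have level (r : \bar R) : 0 <= r -> r <= nu setT -> nu [set x | F x <= r] = r.
  move=> r0; rewrite le_eqVlt => /orP[/eqP ->|rT].
    by congr (nu _); apply/seteqP; split => // x _ /=.
  pose E := [set s : R | F s <= r].
  have EK s : E s -> (s <= K)%R.
    move=> Es; rewrite leNgt; apply/negP => Ks.
    have := le_lt_trans Es rT; rewrite -nuK -/(F K) ltNge => /negP; apply.
    exact/Fmono/ltW.
  have [E0|E0] := pselect (E !=set0); last first.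
    exfalso; apply: E0; exists (- K - 1)%R; rewrite /E/=; apply: le_trans r0.
    rewrite -nuNK; apply: le_measure; rewrite ?inE//.
    by move=> x /=; rewrite !in_itv/= => /le_lt_trans; apply; rewrite ltrBlDr ltrDl ?ltr01 ?invr_gt0 ?ltr0n.
  have hE : has_sup E by split => //; exists K => s; exact: EK.
  pose t := sup E.
  have Flt s : (s < t)%R -> F s <= r.
    move=> st; have [z Ez sz] := @sup_adherent _ E (t - s) ltac:(by rewrite subr_gt0) hE.
    by apply: le_trans Ez; apply: Fmono; move: sz; rewrite -/t subKr => /ltW.
  have Ft : F t = r.
    apply/le_anti/andP; split.
      by apply: ray_le_of_left => // n; apply: Flt; rewrite ltrBlDr ltrDl ?ltr01 ?invr_gt0 ?ltr0n.
    apply: ray_ge_of_right => // n; apply: ltW; rewrite ltNge; apply/negP => h.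
    have : (t + n.+1%:R^-1 <= t)%R by apply: ub_le_sup => //; case: hE.
    by apply/negP; rewrite -ltNge ltrDl.
  rewrite -[RHS]Ft; congr (nu _); apply/seteqP; split => x /=; rewrite in_itv/=.
    by move=> Fx; apply: ub_le_sup => //; case: hE.
  by move=> xt; rewrite -Ft; exact: Fmono.
have qnuT : qnu setT = m setT by rewrite /= /pushforward preimage_setT.
apply: (@eq_measure_rays qnu) => //.
move=> s; rewrite [LHS](_ : _ = nu [set x | (q x <= s)%R]); last first.
  by congr (nu _); apply/seteqP; split => x /=; rewrite in_itv.
have [s0|s0] := ltP s 0%R.
  rewrite (_ : mkset _ = set0) ?measure0.
    apply/esym/le_anti; rewrite measure_ge0 andbT -m0.
    apply: le_measure; rewrite ?inE//.
    by move=> x /=; rewrite !in_itv/= => /le_lt_trans; apply.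
  apply/seteqP; split => x //= qs; have /andP[q0 _] := q01 x.
  by have := le_lt_trans qs s0; rewrite ltNge q0.
have [s1|s1] := ltP s 1%R; last first.
  rewrite (_ : mkset _ = setT); last first.
    by apply/seteqP; split => x //= _; have /andP[_ /le_trans] := q01 x; apply.
  by rewrite num; apply/le_anti; rewrite HT andbT -{1}m1; exact: Hmono.
rewrite -[RHS](level (H s)) ?num//.
by congr (nu _); apply/seteqP; split => x /= => /qle; apply; rewrite s0.
Qed.

End RealTransport.

(** * Transporting a law without atoms to an arbitrary law on [R^n] *)

Section BitCode.
Context (R : realType).
Implicit Types b : nat -> bool.

(** Ternary expansions with digits [0] and [2], so that distinct bit sequences have
    distinct codes and the first digit can be read off by comparing with [2 / 3]. *)
Fixpoint code_upto N b : R :=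
  if N is N'.+1 then (2 * (b 0%N)%:R + code_upto N' (b \o S)) / 3 else 0.

Lemma code_upto_ge0 N b : 0 <= code_upto N b.
Proof.
elim: N b => //= N IH b; by rewrite divr_ge0// addr_ge0.
Qed.

Lemma code_upto_le1 N b : code_upto N b <= 1.
Proof.
elim: N b => //= N IH b; have := IH (b \o S).
by case: (b 0%N) => /= h; rewrite ler_pdivrMr//; lra.
Qed.

Lemma code_upto_nd b : nondecreasing_seq (code_upto ^~ b).
Proof.
apply/nondecreasing_seqP => N; elim: N b => [|N IH] b.
  exact: (code_upto_ge0 1 b).
change ((2 * (b 0%N)%:R + code_upto N (b \o S)) / 3 <=
  (2 * (b 0%N)%:R + code_upto N.+1 (b \o S)) / 3).
by rewrite ler_pM2r ?invr_gt0// lerD2l.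
Qed.

Definition code b : R := limn (code_upto ^~ b).

Lemma cvg_code b : code_upto ^~ b @ \oo --> code b.
Proof.
apply: nondecreasing_is_cvgn; first exact: code_upto_nd.
by exists 1 => _ [N _ <-]; exact: code_upto_le1.
Qed.

Lemma code_ge0 b : 0 <= code b.
Proof.
by apply: limr_ge; [apply/cvgP: (@cvg_code b)|apply: nearW => N; exact: code_upto_ge0].
Qed.

Lemma code_le1 b : code b <= 1.
Proof.
by apply: limr_le; [apply/cvgP: (@cvg_code b)|apply: nearW => N; exact: code_upto_le1].
Qed.

Lemma code_rec b : code b = (2 * (b 0%N)%:R + code (b \o S)) / 3.
Proof.
have h : (fun N => code_upto N.+1 b) @ \oo --> code b.
  by rewrite (cvg_shiftS (code_upto ^~ b)); exact: cvg_code.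
apply: (cvg_unique _ h) => //=.
apply: cvgM; last exact: cvg_cst.
by apply: cvgD; [exact: cvg_cst|exact: cvg_code].
Qed.

Definition code_tail (t : R) : R := if 2 / 3 <= t then 3 * t - 2 else 3 * t.

Fixpoint bit (j : nat) (t : R) : bool :=
  if j is j'.+1 then bit j' (code_tail t) else 2 / 3 <= t.

Lemma bit_code j b : bit j (code b) = b j.
Proof.
have h0 b' : (2 / 3 <= code b') = b' 0%N.
  have := code_ge0 (b' \o S); have := code_le1 (b' \o S).
  by rewrite (code_rec b'); case: (b' 0%N) => /= h1 h2; [apply/idP|apply/negbTE; rewrite -ltNge]; lra.
elim: j b => [|j IH] b /=; first exact: h0.
rewrite /code_tail h0 (_ : (if _ then _ else _) = code (b \o S)) ?IH//.
by rewrite (code_rec b); case: (b 0%N) => /=; field.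
Qed.

Lemma measurable_code d (T : measurableType d) (b : T -> nat -> bool) :
  (forall j, measurable_fun setT (fun x => b x j)) ->
  measurable_fun setT (fun x => code (b x)).
Proof.
move=> mb; apply: (measurable_fun_cvg (h := fun N x => code_upto N (b x))); last first.
  by move=> x _; exact: cvg_code.
move=> N; elim: N b mb => [|N IH] b mb /=; first exact: measurable_cst.
apply: measurable_funM; last exact: measurable_cst.
apply: measurable_funD; last by apply: (IH (fun x => b x \o S)) => j; exact: mb.
apply: measurable_funM; first exact: measurable_cst.
rewrite (_ : (fun x => _) = (fun x => if b x 0%N then 1 else 0 : R)).
  by apply: measurable_fun_ifT; [exact: mb|exact: measurable_cst..].
by apply/funext => x; case: (b x 0%N).
Qed.

Lemma measurable_bit j : measurable_fun [set: R] (bit j).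
Proof.
have m0 : measurable_fun [set: R] (fun t => 2 / 3 <= t).
  by apply: measurable_fun_ler => //; exact: measurable_cst.
elim: j => [|j IH] //=.
apply: (@measurableT_comp _ _ _ _ _ _ (bit j) _ code_tail) => //.
rewrite /code_tail; apply: measurable_fun_ifT => //.
by apply: measurable_funB => //; apply: measurable_funM => //; exact: measurable_cst.
Qed.

(** Countably many bits determine a row, and each of them depends on it
    measurably. *)
Definition row_bits n (v : 'rV[R]_n) (j : nat) : bool :=
  if unpickle j is Some (i, q) then ratr q < v 0 i else false.

Definition code_row n (v : 'rV[R]_n) : R := code (row_bits v).

Lemma measurable_code_row n : measurable_fun setT (@code_row n).
Proof.
apply: measurable_code => j; rewrite /row_bits.
case: (unpickle j) => [[i q]|]; last exact: measurable_cst.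
by apply: measurable_fun_ltr; [exact: measurable_cst|exact: measurable_coord].
Qed.

(** [v_i] is the supremum of the rationals below it; clipping between [- K] and [K] makes
    this supremum exist for every code. *)
Definition decode_coord n (K : R) (i : 'I_n) (t : R) (k : nat) : R :=
  if unpickle k is Some q then
    if bit (pickle (i, q : rat)) t then Num.min (ratr q) K else - K
  else - K.

Definition decode_row n (K : R) (t : R) : 'rV[R]_n :=
  \row_i sups (decode_coord K i t) 0.

Lemma decode_coord_le n (K : R) (i : 'I_n) t k : 0 <= K -> decode_coord K i t k <= K.
Proof.
move=> K0; have NK : - K <= K by rewrite (le_trans _ K0)// oppr_le0.
rewrite /decode_coord; case: (unpickle _) => // q.
by case: ifP => // _; rewrite ge_min lexx orbT.
Qed.

Lemma measurable_decode_row n (K : R) : 0 <= K -> measurable_fun setT (@decode_row n K).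
Proof.
move=> K0; apply: measurable_rowP => i; rewrite /decode_row.
under eq_fun do rewrite mxE.
apply: measurable_fun_sups.
  by move=> t _; exists K => _ [k _ <-]; exact: decode_coord_le.
move=> k; rewrite /decode_coord.
case: (unpickle k : option rat) => [q|]; last exact: measurable_cst.
by apply: measurable_fun_ifT; [exact: measurable_bit|exact: measurable_cst..].
Qed.

Lemma code_rowK n (K : R) (v : 'rV[R]_n) : 0 <= K -> (forall i, `|v 0 i| <= K) ->
  decode_row n K (code_row v) = v.
Proof.
move=> K0 vK; apply/rowP => i; rewrite mxE.
have /ler_normlP[vNK vK'] := vK i.
have bitE q : bit (pickle (i, q : rat)) (code_row v) = (ratr q < v 0 i).
  by rewrite bit_code /row_bits pickleK.
have ubv k : decode_coord K i (code_row v) k <= v 0 i.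
  have NKv : - K <= v 0 i by rewrite lerNl.
  rewrite /decode_coord; case: (unpickle _) => // q; rewrite bitE.
  by case: ifP => // /ltW h; rewrite ge_min h.
apply/le_anti/andP; split.
  apply: sup_le_ub; first by eexists; exists 0%N.
  by move=> _ [k _ <-]; exact: ubv.
rewrite leNgt; apply/negP => lt.
have [q] := @rat_in_itvoo R _ _ lt; rewrite in_itv/= => /andP[h1 h2].
move: h1; apply/negP; rewrite -leNgt.
apply: ub_le_sup; first by exists K => _ [k _ <-]; exact: decode_coord_le.
exists (pickle q) => //; rewrite /decode_coord pickleK bitE h2.
by apply/min_idPl; apply: le_trans vK'; exact: ltW.
Qed.

End BitCode.

Section Transport.
Context (R : realType) (n : nat).
Local Notation V := 'rV[R]_n.+1.

Lemma lebesgue_rV_hyperplane (t : R) : lebesgue_rV R n.+1 [set x : V | x 0 0 = t] = 0%E.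
Proof.
transitivity ((lebesgue_measure \x lebesgue_rV R n)%E
    (([set t] : set (measurableTypeR R)) `*` [set: 'rV[R]_n])).
  rewrite /= /lebesgue_step /pushforward; congr (_ _).
  by apply/seteqP; split => -[x v] /=; rewrite cons_row0 => // -[].
rewrite product_measure1E//.
by rewrite [X in (X * _)%E](lebesgue_measure_set1 t) mul0e.
Qed.

(** A law that charges no hyperplane orthogonal to the first axis can be
    transported, through that coordinate, to any law on the line, hence to the law
    of the codes of [m]; decoding then gives [m]. *)
Lemma transport_exists (rho : probability V R) (A : set V)
    (m : {measure set V -> \bar R}) (K : R) :
  rho `<< lebesgue_rV R n.+1 -> measurable A -> 0 <= K ->
  (forall x, A x -> `|x 0 0| <= K) ->
  m [set v | exists i, K < `|v 0 i|] = 0%E -> m setT = rho A ->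
  exists t : V -> V, measurable_fun setT t /\
    forall B, measurable B -> rho (A `&` t @^-1` B) = m B.
Proof.
move=> dom mA K0 AK mK mT.
have mc : measurable_fun setT (fun x : V => x 0 0 : measurableTypeR R) by exact: measurable_coord.
have mcr : measurable_fun setT (@code_row R n.+1 : V -> measurableTypeR R) by exact: measurable_code_row.
pose rA := measure_function_mrestr__canonical__measure_function_Measure rho mA.
pose nu : {measure set (measurableTypeR R) -> \bar R} :=
  measure_function_pushforward__canonical__measure_function_Measure rA mc.
pose m' : {measure set (measurableTypeR R) -> \bar R} :=
  measure_function_pushforward__canonical__measure_function_Measure m mcr.
have nuE B : nu B = rho ((fun x : V => x 0 0) @^-1` B `&` A) by [].
have m'E B : m' B = m (@code_row R n.+1 @^-1` B) by [].
have nuT : nu setT = rho A by rewrite nuE preimage_setT setTI.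
have [|||||||q [mq qE]] := @real_transport R nu m' K.
- rewrite nuT; apply: le_lt_trans (probability_le1 _ mA) _; exact: ltry.
- by rewrite nuT m'E preimage_setT.
- move=> t; rewrite nuE; apply/eqP; rewrite eq_le measure_ge0 andbT.
  have mh : measurable [set x : V | x 0 0 = t].
    by rewrite -[X in measurable X]setTI; exact: (mc measurableT [set t] (measurable_set1 t)).
  have h0 : rho [set x : V | x 0 0 = t] = 0%E.
    by have /null_content_dominatesP := dom; apply => //; exact: lebesgue_rV_hyperplane.
  by rewrite -h0; apply: le_measure; rewrite ?inE//; exact: (measurableI _ _ mh mA).
- change (rho ((fun x : V => x 0 0) @^-1` `]-oo, (- K)%R[%classic `&` A) = 0%E).
  rewrite (_ : _ `&` _ = set0) ?measure0//.
  apply/seteqP; split => x //= -[]; rewrite in_itv/= => xK /AK /ler_normlP[].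
  by rewrite lerNl leNgt xK.
- rewrite [RHS]nuT; change (rho ((fun x : V => x 0 0) @^-1` `]-oo, K]%classic `&` A) = rho A).
  rewrite (_ : _ `&` _ = A)//.
  apply/seteqP; split => x /=; first by case.
  by move=> Ax; split => //; rewrite in_itv/=; have /ler_normlP[] := AK x Ax.
- change (m (@code_row R n.+1 @^-1` `]-oo, 0%R[%classic) = 0%E).
  rewrite (_ : _ @^-1` _ = set0) ?measure0//.
  by apply/seteqP; split => x //=; rewrite in_itv/= ltNge code_ge0.
- change (m (@code_row R n.+1 @^-1` `]-oo, 1%R]%classic) = m setT).
  rewrite (_ : _ @^-1` _ = setT)//.
  by apply/seteqP; split => x //= _; rewrite in_itv/= code_le1.
have mt : measurable_fun setT (fun x : V => decode_row n.+1 K (q (x 0 0))).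
  apply: (measurableT_comp (measurable_decode_row (n := n.+1) K0)).
  exact: (measurableT_comp mq mc).
exists (fun x => decode_row n.+1 K (q (x 0 0))); split => // B mB.
have mdB : measurable (decode_row n.+1 K @^-1` B : set (measurableTypeR R)).
  by rewrite -[X in measurable X]setTI; exact: measurable_decode_row.
have := qE _ mdB; rewrite nuE m'E setIC => ->.
have mbad : measurable [set v : V | exists i, K < `|v 0 i|].
  rewrite (_ : mkset _ = \bigcup_(i in setT) [set v : V | K < `|v 0 i|]).
    apply: fin_bigcup_measurable => // i _.
    have mi : measurable_fun setT (fun v : V => K < `|v 0 i|).
      apply: measurable_fun_ltr; first exact: measurable_cst.
      by apply: (measurableT_comp (@normr_measurable R _)); exact: measurable_coord.
    by have := mi measurableT [set true] I; rewrite setTI.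
  by apply/seteqP; split => [v [i vi]|v [i _ vi]]; exists i.
have eqD (C : set V) : measurable C -> m C = m (C `\` [set v : V | exists i, K < `|v 0 i|]).
  move=> mC; rewrite [LHS](@measureDI _ _ _ m C _ mC mbad) [X in (_ + X)%E](_ : _ = 0%E) ?adde0//.
  by apply/le_anti; rewrite measure_ge0 andbT -mK le_measure ?inE//; exact: measurableI.
rewrite eqD; last by rewrite -[X in measurable X]setTI; exact (mcr measurableT _ mdB).
rewrite [RHS]eqD//; congr (m _); apply/seteqP; split => v /= [].
  move=> h nb; split => //; move: h; rewrite code_rowK// => i.
  by rewrite leNgt; apply/negP => Ki; apply: nb; exists i.
move=> h nb; split => //; rewrite code_rowK// => i.
by rewrite leNgt; apply/negP => Ki; apply: nb; exists i.
Qed.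

End Transport.

(** * Euclidean norm and derivatives along lines *)

Section Euclid.
Context (R : realType) (n : nat).
Local Notation V := 'rV[R]_n.
Implicit Types u v w : V.

Definition dot u v : R := \sum_i u 0 i * v 0 i.

Lemma dotC u v : dot u v = dot v u.
Proof. by apply: eq_bigr => i _; rewrite mulrC. Qed.

Lemma dotDr u v w : dot u (v + w) = dot u v + dot u w.
Proof. by rewrite -big_split; apply: eq_bigr => i _; rewrite mxE mulrDr. Qed.

Lemma dotZr a u v : dot u (a *: v) = a * dot u v.
Proof. by rewrite mulr_sumr; apply: eq_bigr => i _; rewrite mxE mulrCA. Qed.

Lemma dotNr u v : dot u (- v) = - dot u v.
Proof. by rewrite -scaleN1r dotZr mulN1r. Qed.

Lemma dotBr u v w : dot u (v - w) = dot u v - dot u w.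
Proof. by rewrite dotDr dotNr. Qed.

Lemma dotDl u v w : dot (v + w) u = dot v u + dot w u.
Proof. by rewrite !(dotC _ u) dotDr. Qed.

Lemma dotZl a u v : dot (a *: v) u = a * dot v u.
Proof. by rewrite !(dotC _ u) dotZr. Qed.

Lemma dotNl u v : dot (- v) u = - dot v u.
Proof. by rewrite !(dotC _ u) dotNr. Qed.

Lemma dotBl u v w : dot (v - w) u = dot v u - dot w u.
Proof. by rewrite !(dotC _ u) dotBr. Qed.

Lemma dot_sumr (I : Type) (s : seq I) (f : I -> V) u :
  dot u (\sum_(i <- s) f i) = \sum_(i <- s) dot u (f i).
Proof.
elim: s => [|i s IH]; last by rewrite !big_cons dotDr IH.
by rewrite !big_nil /dot big1// => i _; rewrite mxE mulr0.
Qed.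

Lemma dot_delta u (i : 'I_n) : dot u (delta_mx 0 i) = u 0 i.
Proof.
rewrite /dot (bigD1 i)//= big1 => [|j /negbTE ji]; last by rewrite mxE ji andbF mulr0.
by rewrite mxE !eqxx mulr1 addr0.
Qed.

Lemma dotvv_ge0 v : 0 <= dot v v.
Proof. by apply: sumr_ge0 => i _; rewrite -expr2 sqr_ge0. Qed.

Lemma sqr_enorm v : enorm v ^+ 2 = dot v v.
Proof.
rewrite sqr_sqrtr; first by apply: eq_bigr => i _; rewrite expr2.
by apply: sumr_ge0 => i _; rewrite sqr_ge0.
Qed.

Lemma enorm_ge0 v : 0 <= enorm v. Proof. exact: sqrtr_ge0. Qed.

Lemma enormZ a v : enorm (a *: v) = `|a| * enorm v.
Proof.
apply/eqP; rewrite -(@eqrXn2 _ 2)// ?mulr_ge0 ?enorm_ge0//.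
by rewrite exprMn !sqr_enorm dotZr dotZl mulrA real_normK ?num_real// expr2.
Qed.

Lemma enormN v : enorm (- v) = enorm v.
Proof. by rewrite -scaleN1r enormZ normrN1 mul1r. Qed.

Lemma enormC u v : enorm (u - v) = enorm (v - u).
Proof. by rewrite -enormN opprB. Qed.

Lemma enorm0 : enorm (0 : V) = 0.
Proof. by rewrite -(scale0r 0) enormZ normr0 mul0r. Qed.

Lemma enorm_eq0 v : (enorm v == 0) = (v == 0).
Proof.
apply/eqP/eqP => [v0|->]; last exact: enorm0.
have /eqP : dot v v = 0 by rewrite -sqr_enorm v0 expr0n.
rewrite psumr_eq0 => [/allP h|i _]; last by rewrite -expr2 sqr_ge0.
apply/rowP => i; rewrite mxE; have := h i (mem_index_enum _).
by rewrite /= -expr2 sqrf_eq0 => /eqP.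
Qed.

Lemma dot_le u v : dot u v <= enorm u * enorm v.
Proof.
have [->|u0] := eqVneq u 0.
  by rewrite enorm0 mul0r -(scale0r 0) dotZl mul0r.
have [->|v0] := eqVneq v 0.
  by rewrite enorm0 mulr0 -(scale0r 0) dotZr mul0r.
have pos w : w != 0 -> 0 < enorm w by move=> w0; rewrite lt_neqAle eq_sym enorm_eq0 w0 enorm_ge0.
have := dotvv_ge0 (enorm v *: u - enorm u *: v).
rewrite dotBr !dotBl !dotZl !dotZr -!sqr_enorm (dotC v u) => h.
have : 0 < enorm u * enorm v by rewrite mulr_gt0 ?pos.
by move=> p; rewrite -(ler_pM2l p); nra.
Qed.

Lemma ler_enormD u v : enorm (u + v) <= enorm u + enorm v.
Proof.
rewrite -ler_sqr ?nnegrE ?addr_ge0 ?enorm_ge0//.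
rewrite sqrrD !sqr_enorm dotDr !dotDl (dotC v u).
by have := dot_le u v; lra.
Qed.

Lemma ler_enorm_sum (I : Type) (s : seq I) (f : I -> V) :
  enorm (\sum_(i <- s) f i) <= \sum_(i <- s) enorm (f i).
Proof.
elim: s => [|i s IH]; first by rewrite !big_nil enorm0.
by rewrite !big_cons (le_trans (ler_enormD _ _))// lerD2l.
Qed.

Lemma ler_enormB u v w : enorm (u - w) <= enorm (u - v) + enorm (v - w).
Proof. by have := ler_enormD (u - v) (v - w); rewrite addrA subrK. Qed.

Lemma coord_le_enorm v i : `|v 0 i| <= enorm v.
Proof.
rewrite -ler_sqr ?nnegrE ?enorm_ge0// real_normK ?num_real//.
rewrite sqr_enorm /dot (bigD1 i)//= expr2 lerDl.
by apply: sumr_ge0 => j _; rewrite -expr2 sqr_ge0.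
Qed.

Lemma norm_row_le v (M : R) : 0 <= M -> (forall i, `|v 0 i| <= M) -> `|v| <= M.
Proof.
move=> M0 vM; change (mx_norm v <= M); rewrite mx_normrE.
by apply: bigmax_le => // -[i j] _ /=; rewrite ord1.
Qed.

Lemma coord_le_norm v i : `|v 0 i| <= `|v|.
Proof.
change (`|v 0 i| <= mx_norm v); rewrite mx_normrE.
exact: (le_bigmax _ (fun ij => `|v ij.1 ij.2|) (0, i)).
Qed.

Lemma norm_le_enorm v : `|v| <= enorm v.
Proof. by apply: norm_row_le => [|i]; [exact: enorm_ge0|exact: coord_le_enorm]. Qed.

Lemma enorm_le_norm v : enorm v <= n%:R * `|v|.
Proof.
rewrite {1}(row_sum_delta v) (le_trans (ler_enorm_sum _ _))//.
apply: (@le_trans _ _ (\sum_(i < n) `|v|)); last by rewrite sumr_const card_ord mulr_natl.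
apply: ler_sum => i _; rewrite enormZ.
have -> : enorm (delta_mx 0 i : V) = 1.
  apply/eqP; rewrite -(@eqrXn2 _ 2)// ?enorm_ge0//.
  by rewrite sqr_enorm dot_delta mxE !eqxx expr1n.
by rewrite mulr1 coord_le_norm.
Qed.

End Euclid.

Section LineDerivative.
Context (R : realType) (n : nat).
Local Notation V := 'rV[R]_n.

Lemma is_derive_line (f : V -> R) (a e : V) (t : R) :
  derivable f (a + t *: e) e ->
  is_derive t (1 : R) (fun s : R => f (a + s *: e)) ('D_e f (a + t *: e)).
Proof.
move=> df.
have E : (fun h : R => h^-1 *: (((fun s : R => f (a + s *: e)) \o shift t) (h *: (1 : R)) - f (a + t *: e))) =
    (fun h => h^-1 *: ((f \o shift (a + t *: e)) (h *: e) - f (a + t *: e))).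
  apply/funext => h /=; congr (_ *: (f _ - _)).
  by rewrite [h *: 1]mulr1 scalerDl addrCA.
apply: DeriveDef.
  by rewrite /derivable [X in cvg (X @ _)]E.
by rewrite /derive [X in lim (X @ _)]E.
Qed.

Lemma mean_value_le (g dg : R -> R) (c e s : R) :
  (forall t, `|t| <= `|s| -> is_derive t (1 : R) g (dg t) /\ `|dg t - c| <= e) ->
  `|g s - g 0 - c * s| <= e * `|s|.
Proof.
move=> h.
have cg t : `|t| <= `|s| -> {for t, continuous g}.
  by move=> /h[dt _]; apply/differentiable_continuous/derivable1_diffP.
have [s0|s0] := leP 0 s.
  have [||r] := @MVT_segment R g dg 0 s s0.
  - by move=> x /itvP xs; apply: (h _ _).1; rewrite !ger0_norm ?xs.
  - apply: continuous_in_subspaceT => x; rewrite inE/= => /itvP xs.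
    by apply: cg; rewrite !ger0_norm ?xs.
  move=> /itvP rs ->; rewrite subr0 -mulrBl normrM ler_wpM2r//.
  by apply: (h _ _).2; rewrite !ger0_norm ?rs.
have sN := ltW s0.
have [||r] := @MVT_segment R g dg s 0 sN.
- by move=> x /itvP xs; apply: (h _ _).1; rewrite !ler0_norm ?lerN2 ?xs.
- apply: continuous_in_subspaceT => x; rewrite inE/= => /itvP xs.
  by apply: cg; rewrite !ler0_norm ?lerN2 ?xs.
move=> /itvP rs E.
have -> : g s - g 0 - c * s = (dg r - c) * s by move: E; rewrite sub0r; lra.
rewrite normrM ler_wpM2r//.
by apply: (h _ _).2; rewrite !ler0_norm ?lerN2 ?rs.
Qed.

(** A Frechet estimate: the coordinates are changed one at a time, and the mean
    value theorem is applied to each change. *)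
Lemma increment_le (f : V -> R) (x : V) (c : 'I_n -> R) (d e : R) :
  (forall i y, `|y - x| < d -> derivable f y (delta_mx 0 i) /\ `|partial i f y - c i| <= e) ->
  forall v : V, `|v| < d ->
  `|f (x + v) - f x - \sum_i c i * v 0 i| <= e * \sum_i `|v 0 i|.
Proof.
move=> h v vd.
pose trunc (k : nat) : V := \row_i (if (i < k)%N then v 0 i else 0).
have trunc0 : trunc 0%N = 0 by apply/rowP => i; rewrite !mxE.
have truncn : trunc n = v by apply/rowP => i; rewrite !mxE ltn_ord.
have truncS (i : 'I_n) : trunc i.+1 = trunc i + v 0 i *: delta_mx 0 i.
  apply/rowP => j; rewrite !mxE eqxx/= ltnS leq_eqVlt -val_eqE/=.
  have [ji|ji] := eqVneq (val j) (val i); last by rewrite mulr0 addr0.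
  by rewrite ji ltnn mulr1 add0r; congr (v 0 _); apply: val_inj.
have small (i : 'I_n) t : `|t| <= `|v 0 i| -> `|trunc i + t *: delta_mx 0 i| <= `|v|.
  move=> tv; apply: norm_row_le => // j.
  rewrite !mxE eqxx/=; case: (eqVneq j i) => [->|ji].
    by rewrite ltnn add0r mulr1 (le_trans tv)// coord_le_norm.
  by rewrite mulr0 addr0; case: ifP => _; rewrite ?normr0// coord_le_norm.
have -> : f (x + v) - f x = \sum_(i < n) (f (x + trunc i.+1) - f (x + trunc i)).
  have := @telescope_sumr _ 0 n (fun k => f (x + trunc k)) (leq0n _).
  by rewrite big_mkord truncn trunc0 addr0 => <-.
rewrite -sumrB (le_trans (ler_norm_sum _ _ _))// mulr_sumr; apply: ler_sum => i _.
rewrite truncS.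
have := @mean_value_le (fun s => f (x + trunc i + s *: delta_mx 0 i))
  (fun s => partial i f (x + trunc i + s *: delta_mx 0 i)) (c i) e (v 0 i).
rewrite scale0r addr0 addrA; apply => t tv.
have [|dy py] := h i (x + trunc i + t *: delta_mx 0 i).
  by rewrite -(addrA x) (addrC _ (- x)) addKr (le_lt_trans (small _ _ tv)).
by split => //; exact: is_derive_line.
Qed.

Definition grad (f : V -> R) (x : V) : V := \row_i partial i f x.

Lemma is_derive_along (f : V -> R) (U : set V) (a v : V) (t : R) :
  open U -> (forall i x, U x -> derivable f x (delta_mx 0 i) /\ {for x, continuous (partial i f)}) ->
  U (a + t *: v) ->
  is_derive t (1 : R) (fun s : R => f (a + s *: v)) (dot (grad f (a + t *: v)) v).
Proof.
move=> oU C1 Ux; set x := a + t *: v in Ux *.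
suff E : (fun h : R => h^-1 *: (((fun s : R => f (a + s *: v)) \o shift t) (h *: (1 : R)) - f (a + t *: v)))
    @ 0^' --> dot (grad f x) v.
  by apply: DeriveDef; [exact: (cvgP _ E)|exact: (cvg_lim _ E)].
apply/cvgrPdist_le => e e0.
pose W := \sum_i `|v 0 i| + 1.
have W0 : 0 < W by rewrite ltr_wpDl// sumr_ge0.
have [d d0 hd] : exists2 d, 0 < d & forall i y, `|y - x| < d ->
    derivable f y (delta_mx 0 i) /\ `|partial i f y - grad f x 0 i| <= e / W.
  have near_i (i : 'I_n) : \forall y \near x, derivable f y (delta_mx 0 i) /\ `|partial i f y - grad f x 0 i| <= e / W.
    have [_ /cvgrPdist_le/(_ _ (divr_gt0 e0 W0)) ci] := C1 i x Ux.
    near=> y; split.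
      have /C1 -/(_ i)[//] : U y by near: y; exact: open_nbhs_nbhs.
    rewrite mxE distrC; near: y; exact: ci.
  have /nbhs_ballP[d /= d0 hd] : \forall y \near x, forall i : 'I_n, derivable f y (delta_mx 0 i) /\ `|partial i f y - grad f x 0 i| <= e / W.
    exact: (filter_forall (nbhs_filter x) near_i).
  exists d => // i y yx; apply: hd; rewrite -ball_normE /= distrC.
  exact: yx.
have dv0 : 0 < d / (`|v| + 1) by rewrite divr_gt0// ltr_wpDl.
near=> h.
have h0 : h != 0 by near: h; exact: nbhs_dnbhs_neq.
have hdv : `|h *: v| < d.
  rewrite normrZ (@le_lt_trans _ _ (`|h| * (`|v| + 1)))// ?ler_wpM2l ?lerDl//.
  rewrite -ltr_pdivlMr ?ltr_wpDl//; near: h; exact: dnbhs0_lt.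
have := increment_le hd hdv.
rewrite /= [h *: 1]mulr1 scalerDl (addrC (h *: v)) addrA -/x.
have -> : \sum_i grad f x 0 i * (h *: v) 0 i = h * dot (grad f x) v by exact: dotZr.
have -> : \sum_i `|(h *: v) 0 i| = `|h| * (\sum_i `|v 0 i|).
  by rewrite mulr_sumr; apply: eq_bigr => i _; rewrite mxE normrM.
move=> le; rewrite distrC.
have -> : h^-1 *: (f (x + h *: v) - f x) - dot (grad f x) v =
    h^-1 * (f (x + h *: v) - f x - h * dot (grad f x) v) by rewrite /GRing.scale/=; field.
rewrite normrM normfV ler_pdivrMl ?normr_gt0// (le_trans le)//.
rewrite mulrCA ler_wpM2l// mulrAC ler_pdivrMr//.
by rewrite ler_wpM2l ?(ltW e0)// /W lerDl.
Unshelve. all: by end_near.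
Qed.

End LineDerivative.

(** * The function [|z|^2 / 2 - F z] and its gradient *)

Section ScalarCalculus.
Context (R : realType).

Lemma taylor2_le (f df ddf : R -> R) (C : R) :
  (forall t : R, 0 <= t <= 1 -> [/\ is_derive t (1 : R) f (df t),
     is_derive t (1 : R) df (ddf t) & ddf t <= C]) ->
  f 1 <= f 0 + df 0 + C / 2.
Proof.
move=> h.
have dfC t : 0 <= t <= 1 -> df t <= df 0 + C * t.
  move=> /andP[t0 t1].
  have [||c /itvP ct] := @MVT_segment R df ddf 0 t t0.
  - by move=> x /itvP xt; have [] := h x; rewrite ?xt// (le_trans _ t1)// xt.
  - apply: continuous_in_subspaceT => x; rewrite inE/= => /itvP xt.
    have [|_ dx _] := h x; first by rewrite xt (le_trans _ t1)// xt.
    exact/differentiable_continuous/derivable1_diffP.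
  have [|_ _ le] := h c; first by rewrite ct (le_trans _ t1)// ct.
  have : ddf c * t <= C * t by rewrite ler_wpM2r.
  by rewrite subr0; lra.
pose g (t : R) := f t - (df 0 * t + C / 2 * t ^+ 2).
have dg (t : R) : 0 <= t <= 1 -> is_derive t (1 : R) g (df t - (df 0 + C * t)).
  move=> t01; have [dft _ _] := h t t01.
  apply: is_deriveB => //.
  by apply: is_derive_eq; rewrite /GRing.scale/= !mulr1; field.
have [||c /itvP ct E] := @MVT_segment R g (fun t => df t - (df 0 + C * t)) 0 1 ler01.
- by move=> x /itvP xt; apply: dg; rewrite !xt.
- apply: continuous_in_subspaceT => x; rewrite inE/= => /itvP xt.
  have := dg x; rewrite !xt => /(_ isT) dx.
  exact/differentiable_continuous/derivable1_diffP.
have c01 : 0 <= c <= 1 by rewrite !ct.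
have := dfC c c01; move: E; rewrite /g expr0n/= expr1n; lra.
Qed.

Lemma derive_le_lipschitz (f : R -> R) (t l C r : R) : 0 < r ->
  is_derive t (1 : R) f l ->
  (forall h, `|h| < r -> `|f (t + h) - f t| <= C * `|h|) -> l <= C.
Proof.
move=> r0 dl lip.
rewrite -(@derive_val _ _ _ t 1 f l dl); apply: limr_le; first exact: ex_derive.
near=> h; have h0 : h != 0 by near: h; exact: nbhs_dnbhs_neq.
rewrite /= [h *: 1]mulr1 (addrC h) (le_trans (ler_norm _))//.
rewrite normrM normfV ler_pdivrMl ?normr_gt0// mulrC lip//.
by near: h; exact: dnbhs0_lt.
Unshelve. all: by end_near.
Qed.

End ScalarCalculus.

Section SemiconvexPotential.
Context (R : realType) (n : nat).
Local Notation V := 'rV[R]_n.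
Context (U : set V) (F : V -> R) (kappa tau : R).
Hypothesis (oU : open U) (C2F : C2_on U F) (tau0 : 0 <= tau) (kappa0 : 0 <= kappa).
Hypothesis hessF : forall x v, U x ->
  - tau * enorm v ^+ 2 <= quad_form (hessian F x) v <= (1 - kappa) * enorm v ^+ 2.

Lemma is_derive_dot_grad (a v q : V) (t : R) : U (a + t *: v) ->
  is_derive t (1 : R) (fun s : R => dot (grad F (a + s *: v)) q)
    (\sum_i q 0 i * dot (grad (partial i F) (a + t *: v)) v).
Proof.
move=> Ut; have [_ _ C2] := C2F.
have -> : (fun s : R => dot (grad F (a + s *: v)) q) =
    \sum_(i < n) (fun s : R => q 0 i *: partial i F (a + s *: v)).
  apply/funext => s; rewrite fct_sumE; apply: eq_bigr => i _.
  by rewrite mxE mulrC.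
apply: is_derive_sum => i.
apply: (@is_deriveZ _ _ _ (fun s : R => partial i F (a + s *: v))).
by apply: is_derive_along Ut => // j x Ux; exact: C2.
Qed.

Lemma quad_formE x v :
  quad_form (hessian F x) v = \sum_i v 0 i * dot (grad (partial i F) x) v.
Proof.
rewrite /quad_form mxE; under eq_bigr do rewrite mxE mulr_suml.
rewrite exchange_big/=; apply: eq_bigr => i _; rewrite mulr_sumr.
by apply: eq_bigr => j _; rewrite !mxE mulrA.
Qed.

Let C1F i x : U x -> derivable F x (delta_mx 0 i) /\ {for x, continuous (partial i F)}.
Proof. by case: C2F => _ h _; exact: h. Qed.

Lemma taylor_upper a v : (forall t, 0 <= t <= 1 -> U (a + t *: v)) ->
  F (a + v) <= F a + dot (grad F a) v + (1 - kappa) / 2 * enorm v ^+ 2.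
Proof.
move=> seg.
have := @taylor2_le R (fun s => F (a + s *: v)) (fun s => dot (grad F (a + s *: v)) v)
  (fun s => quad_form (hessian F (a + s *: v)) v) ((1 - kappa) * enorm v ^+ 2).
rewrite scale1r scale0r addr0 [_ / 2]mulrAC; apply => t t01; split.
- exact: is_derive_along oU C1F (seg t t01).
- by rewrite quad_formE; apply: is_derive_dot_grad; exact: seg.
- by have /andP[] := hessF v (seg t t01).
Qed.

Lemma taylor_lower a v : (forall t, 0 <= t <= 1 -> U (a + t *: v)) ->
  F a + dot (grad F a) v - tau / 2 * enorm v ^+ 2 <= F (a + v).
Proof.
move=> seg.
have := @taylor2_le R (fun s => - F (a + s *: v)) (fun s => - dot (grad F (a + s *: v)) v)
  (fun s => - quad_form (hessian F (a + s *: v)) v) (tau * enorm v ^+ 2).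
rewrite scale1r scale0r addr0 => h.
suff : - F (a + v) <= - F a - dot (grad F a) v + tau * enorm v ^+ 2 / 2 by lra.
apply: h => t t01; split.
- by apply: is_deriveN; exact: is_derive_along oU C1F (seg t t01).
- by rewrite quad_formE; apply: is_deriveN; apply: is_derive_dot_grad; exact: seg.
- by have /andP[] := hessF v (seg t t01); lra.
Qed.

(** Minimizing over [y] turns the cost into a separable part minus this function of
    the mean: its convexity, not that of [F], drives the estimates. *)
Definition conj_cost z : R := dot z z / 2 - F z.
Definition grad_conj_cost z : V := z - grad F z.
Local Notation G := conj_cost.
Local Notation P := grad_conj_cost.

Let expand a v : G (a + v) - G a - dot (P a) v =
  enorm v ^+ 2 / 2 - (F (a + v) - F a - dot (grad F a) v).
Proof.
by rewrite /G /P sqr_enorm dotDr !dotDl dotNl (dotC v a); field.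
Qed.

Lemma conj_cost_lower a v : (forall t, 0 <= t <= 1 -> U (a + t *: v)) ->
  G a + dot (P a) v + kappa / 2 * enorm v ^+ 2 <= G (a + v).
Proof. by move=> /taylor_upper h; have := expand a v; lra. Qed.

Lemma conj_cost_upper a v : (forall t, 0 <= t <= 1 -> U (a + t *: v)) ->
  G (a + v) <= G a + dot (P a) v + (1 + tau) / 2 * enorm v ^+ 2.
Proof. by move=> /taylor_lower h; have := expand a v; lra. Qed.

Lemma open_eball z : U z -> exists2 r, 0 < r & forall w, enorm (w - z) < r -> U w.
Proof.
move=> Uz; have /nbhs_ballP[r /= r0 rU] : nbhs z U by exact: open_nbhs_nbhs.
exists r => // w wz; apply: rU; rewrite -ball_normE /= distrC.
exact: le_lt_trans (norm_le_enorm _) wz.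
Qed.

(** With [q] the difference of the gradients, a step of length [|w - z|] from [w]
    against [q] stays above the tangent at [z] by convexity, which bounds [q] in
    terms of the quadratic upper bound. *)
Lemma grad_locally_lipschitz z : U z -> exists2 r, 0 < r &
  forall w, enorm (w - z) < r -> enorm (P w - P z) <= (1 + tau) * enorm (w - z).
Proof.
move=> Uz; have [r r0 rU] := open_eball Uz.
exists (r / 2); first exact: divr_gt0.
move=> w wz; set q := P w - P z; set d := enorm (w - z).
have d0 : 0 <= d by exact: enorm_ge0.
have [->|q0] := eqVneq q 0; first by rewrite enorm0 mulr_ge0// addr_ge0.
have qp : 0 < enorm q by rewrite lt_neqAle eq_sym enorm_eq0 q0 enorm_ge0.
pose e := - (d / enorm q) *: q.
have en : enorm e = d.
  by rewrite enormZ normrN ger0_norm ?divr_ge0 ?enorm_ge0// divfK// gt_eqF.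
have segz t : 0 <= t <= 1 -> U (z + t *: (w - z)).
  move=> /andP[t0 t1]; apply: rU; rewrite (addrC z) addrK enormZ ger0_norm//.
  by rewrite (@le_lt_trans _ _ d) ?ler_piMl//; move: wz; rewrite -/d; lra.
have segw t : 0 <= t <= 1 -> U (w + t *: e).
  move=> /andP[t0 t1]; apply: rU; rewrite addrAC.
  apply: le_lt_trans (ler_enormD _ _) _; rewrite enormZ ger0_norm// en -/d.
  have : t * d <= d by rewrite ler_piMl.
  by move: wz; rewrite -/d; lra.
have sege t : 0 <= t <= 1 -> U (z + t *: (w + e - z)).
  move=> /andP[t0 t1]; apply: rU; rewrite (addrC z) addrK enormZ ger0_norm// addrAC.
  have h1 : enorm (w - z + e) <= d + d by apply: le_trans (ler_enormD _ _) _; rewrite en.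
  apply: (@le_lt_trans _ _ (enorm (w - z + e))); first by rewrite ler_piMl// enorm_ge0.
  by move: wz; rewrite -/d; lra.
have u1 := conj_cost_upper segz; have u2 := conj_cost_upper segw.
have l1 := conj_cost_lower sege.
rewrite subrKC -/d in u1; rewrite en in u2; rewrite subrKC in l1.
have dq : dot (P w - P z) e = - (d * enorm q).
  by rewrite -/q /e dotZr -sqr_enorm; field; rewrite gt_eqF.
have lin : dot (P z) (w + e - z) = dot (P z) (w - z) + dot (P z) e.
  by rewrite addrAC dotDr.
rewrite lin in l1; rewrite dotBl in dq.
have k0 : 0 <= kappa / 2 * enorm (w + e - z) ^+ 2 by rewrite mulr_ge0 ?sqr_ge0 ?divr_ge0.
have : d * enorm q <= (1 + tau) * d ^+ 2 by lra.
have dp : 0 < d.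
  rewrite lt_neqAle d0 andbT eq_sym; apply: contra_neq q0 => /eqP.
  by rewrite /d enorm_eq0 subr_eq0 /q => /eqP ->; rewrite subrr.
by rewrite expr2 mulrCA ler_pM2l.
Qed.

(** The local bound controls the derivative of [t |-> P (a + t v)] in the direction
    of the total increment, whence a bound on the whole segment. *)
Lemma grad_lipschitz a v : (forall t, 0 <= t <= 1 -> U (a + t *: v)) ->
  enorm (P (a + v) - P a) <= (1 + tau) * enorm v.
Proof.
move=> seg; set q := P (a + v) - P a.
pose f (t : R) := dot (P (a + t *: v)) q.
pose df (t : R) := dot v q - \sum_i q 0 i * dot (grad (partial i F) (a + t *: v)) v.
have df1 (t : R) : 0 <= t <= 1 -> is_derive t (1 : R) f (df t).
  move=> t01.
  have -> : f = (fun t : R => dot a q + t * dot v q) - (fun s => dot (grad F (a + s *: v)) q).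
    by apply/funext => s; rewrite /f /P dotBl dotDl dotZl.
  apply: is_deriveB; last by apply: is_derive_dot_grad; exact: seg.
  apply: is_derive_eq; rewrite /GRing.scale/=; ring.
have dfle t : 0 <= t <= 1 -> df t <= (1 + tau) * enorm v * enorm q.
  move=> t01; have [r r0 lip] := grad_locally_lipschitz (seg t t01).
  have W0 : 0 < enorm v + 1 by rewrite ltr_wpDl ?enorm_ge0.
  apply: (@derive_le_lipschitz R f t (df t) _ (r / (enorm v + 1))); [exact: divr_gt0|exact: df1|].
  move=> h; rewrite ltr_pdivlMr// => hr.
  have small : enorm (a + (t + h) *: v - (a + t *: v)) = `|h| * enorm v.
    by rewrite -enormZ scalerDl addrA (addrC _ (- _)) addKr.
  have := lip (a + (t + h) *: v); rewrite small => /(_ _) le.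
  have cs w : `|dot w q| <= enorm w * enorm q.
    rewrite ler_norml -{1}enormN lerNl -dotNl.
    by rewrite (le_trans (dot_le _ _)) ?enormN ?dot_le.
  rewrite /f -dotBl (le_trans (cs _))// mulrAC ler_wpM2r ?enorm_ge0//.
  rewrite (le_trans (le _))//; last by rewrite mulrAC mulrA.
  by rewrite (le_lt_trans _ hr)// ler_wpM2l// lerDl.
have [||c /itvP ct E] := @MVT_segment R f df 0 1 ler01.
- by move=> x /itvP xt; apply: df1; rewrite !xt.
- apply: continuous_in_subspaceT => x; rewrite inE/= => /itvP xt.
  have := df1 x; rewrite !xt => /(_ isT) dx.
  exact/differentiable_continuous/derivable1_diffP.
have c01 : 0 <= c <= 1 by rewrite !ct.
have := dfle c c01; move: E; rewrite /f scale1r scale0r addr0 -dotBl -/q -sqr_enorm subr0 mulr1 => <-.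
have [->|q0] := eqVneq q 0; first by rewrite enorm0 mulr_ge0 ?enorm_ge0 ?addr_ge0.
by rewrite expr2 ler_pM2r// lt_neqAle eq_sym enorm_eq0 q0 enorm_ge0.
Qed.

End SemiconvexPotential.

(** * Convex extension from the hull to the whole space *)

Section ConvexHull.
Context (R : realType) (n : nat).
Local Notation V := 'rV[R]_n.
Implicit Types (A : set V) (x y z : V).

Lemma sub_conv_hull A : A `<=` conv_hull A.
Proof. exact: sub_smallest. Qed.

Lemma conv_hull_segment A x v t : 0 <= t <= 1 ->
  conv_hull A x -> conv_hull A (x + v) -> conv_hull A (x + t *: v).
Proof.
move=> /andP[t0 t1] Hx Hv M [cM AM].
have := cM (x + v) x (Itv01 t0 t1) (mem_set (Hv M (conj cM AM))) (mem_set (Hx M (conj cM AM))).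
rewrite inE; congr M; rewrite /conv/= /unstable.onem/=.
by rewrite scalerDr scalerBl scale1r addrAC addrCA subrr addr0 addrC.
Qed.

Lemma conv_hull_eball A z r :
  (forall x, A x -> enorm (x - z) <= r) -> forall x, conv_hull A x -> enorm (x - z) <= r.
Proof.
move=> Ar x Hx; apply: (Hx [set x | enorm (x - z) <= r]); split => // u v l.
rewrite !inE/= => ur vr; rewrite /conv/= /unstable.onem/=.
have l0 : 0 <= l%:num by []. have l1 : 0 <= 1 - l%:num by rewrite subr_ge0.
have -> : l%:num *: u + (1 - l%:num) *: v - z = l%:num *: (u - z) + (1 - l%:num) *: (v - z).
  by rewrite !scalerBr addrACA -opprD -scalerDl subrKC scale1r.
apply: le_trans (ler_enormD _ _) _; rewrite !enormZ !ger0_norm//.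
apply: (@le_trans _ _ (l%:num * r + (1 - l%:num) * r)); last by rewrite -mulrDl subrKC mul1r.
by rewrite lerD// ler_wpM2l.
Qed.

Lemma conv_hull_sum A m (a : 'I_m -> R) (x : 'I_m -> V) :
  (forall i, 0 < a i) -> \sum_i a i = 1 -> (forall i, conv_hull A (x i)) ->
  conv_hull A (\sum_i a i *: x i).
Proof.
elim: m a x => [|m IH] a x a0 a1 Hx.
  by move: a1; rewrite big_ord0 => /esym/eqP; rewrite oner_eq0.
case: m => [|m] in a x a0 a1 Hx IH *.
  by move: a1; rewrite !big_ord1 => ->; rewrite scale1r.
rewrite big_ord_recl; rewrite big_ord_recl in a1.
set s := (X in _ + X) in a1.
have s0 : 0 < s by rewrite /s big_ord_recl ltr_wpDr// sumr_ge0// => i _; exact: ltW.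
have /= Hs := IH (fun i => a (lift ord0 i) / s) (fun i => x (lift ord0 i)).
have {}Hs : conv_hull A (\sum_(i < m.+1) (a (lift ord0 i) / s) *: x (lift ord0 i)).
  by apply: Hs => // [i|]; [rewrite divr_gt0|rewrite -mulr_suml divff// gt_eqF].
have := @conv_hull_segment A (x ord0)
  (\sum_(i < m.+1) (a (lift ord0 i) / s) *: x (lift ord0 i) - x ord0) s.
rewrite subrKC => /(_ _ (Hx _) Hs) H.
have -> : a ord0 *: x ord0 + \sum_(i < m.+1) a (lift ord0 i) *: x (lift ord0 i) =
  x ord0 + s *: (\sum_(i < m.+1) (a (lift ord0 i) / s) *: x (lift ord0 i) - x ord0).
  rewrite scalerBr scaler_sumr addrCA addrC.
  have -> : a ord0 = 1 - s by rewrite -a1 addrK.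
  rewrite scalerBl scale1r; congr (_ + _); apply: eq_bigr => i _.
  by rewrite scalerA mulrCA divff ?mulr1// gt_eqF.
by apply: H; rewrite (ltW s0)/= -a1 lerDr ltW.
Qed.

End ConvexHull.

Section ConvexExtension.
Context (R : realType) (n : nat).
Local Notation V := 'rV[R]_n.

(** [G] is convex and Lipschitz on the whole space, but its subgradients [P] and its
    strong convexity are known on [H] only. Convexity appears through midpoints, the
    form in which it is used for second differences. *)
Record regular_on (H : set V) (kappa L : R) (G : V -> R) (P : V -> V) : Prop := Regular {
  reg_lip : forall z w, G z - G w <= L * enorm (z - w);
  reg_mid : forall z h, 2 * G z <= G (z + h) + G (z - h);
  reg_sub : forall z w, H z -> G z + dot (P z) (w - z) <= G w;
  reg_strong : forall z w, H z -> H w ->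
    G z + dot (P z) (w - z) + kappa / 2 * enorm (w - z) ^+ 2 <= G w;
  reg_grad : forall z, H z -> enorm (P z) <= L }.

(** [G] is the supremum of the affine minorants at the points of the hull.
    Subtracting the linear map [dot q], which only changes the cost by terms that
    depend on one variable, makes the gradient vanish at [x0]: then it is at most
    [(1 + tau) * D] on the hull, whatever [F]. *)
Lemma regular_extension (A U : set V) (F : V -> R) (kappa tau D L : R) (x0 : V) :
  open U -> C2_on U F -> 0 <= tau -> 0 <= kappa ->
  (forall x v, U x ->
    - tau * enorm v ^+ 2 <= quad_form (hessian F x) v <= (1 - kappa) * enorm v ^+ 2) ->
  conv_hull A `<=` U -> A x0 -> (forall x, A x -> enorm (x - x0) <= D) ->
  (1 + tau) * D <= L ->
  exists G P q, regular_on (conv_hull A) kappa L G P /\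
    forall z, conv_hull A z -> F z = dot z z / 2 - G z - dot q z.
Proof.
move=> oU C2F tau0 kappa0 hessF HU Ax0 AD DL.
set H := conv_hull A.
have Hx0 : H x0 by exact: sub_conv_hull.
pose q := grad_conj_cost F x0.
pose P z := grad_conj_cost F z - q.
pose G0 z := conj_cost F z - dot q z.
have seg z w : H z -> H w -> forall t, 0 <= t <= 1 -> U (z + t *: (w - z)).
  by move=> Hz Hw t t01; apply: HU; apply: conv_hull_segment => //; rewrite subrKC.
have PL z : H z -> enorm (P z) <= L.
  move=> Hz; apply: le_trans DL.
  have := grad_lipschitz oU C2F tau0 kappa0 hessF (seg _ _ Hx0 Hz).
  rewrite subrKC => /le_trans; apply; rewrite ler_wpM2l ?addr_ge0//.
  exact: conv_hull_eball Hz.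
have strong z w : H z -> H w ->
    G0 z + dot (P z) (w - z) + kappa / 2 * enorm (w - z) ^+ 2 <= G0 w.
  move=> Hz Hw; have := conj_cost_lower oU C2F hessF (seg _ _ Hz Hw).
  by rewrite subrKC /G0 /P dotBl !dotBr; lra.
have sub0 z w : H z -> H w -> G0 z + dot (P z) (w - z) <= G0 w.
  move=> Hz Hw; apply: le_trans (strong z w Hz Hw); rewrite lerDl.
  by rewrite mulr_ge0 ?sqr_ge0 ?divr_ge0.
have dotL z w : H z -> dot (P z) w <= L * enorm w.
  move=> Hz; apply: le_trans (dot_le _ _) _.
  by rewrite ler_wpM2r ?enorm_ge0 ?PL.
pose E w := [set G0 z + dot (P z) (w - z) | z in H].
pose G w := sup (E w).
have E0 w : E w !=set0 by exists (G0 x0 + dot (P x0) (w - x0)); exists x0.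
have ubE w : has_ubound (E w).
  exists (G0 x0 + L * enorm (w - x0)) => _ [z Hz <-].
  have -> : w - z = (x0 - z) + (w - x0) by rewrite [RHS]addrC addrA subrK.
  rewrite dotDr addrA lerD ?dotL//; exact: sub0.
have GE z w : H z -> G0 z + dot (P z) (w - z) <= G w.
  by move=> Hz; apply: ub_le_sup => //; exists z.
have Gle w c : (forall z, H z -> G0 z + dot (P z) (w - z) <= c) -> G w <= c.
  by move=> h; apply: sup_le_ub => // _ [z Hz <-]; exact: h.
have GG0 z : H z -> G z = G0 z.
  move=> Hz; apply/le_anti/andP; split; first by apply: Gle => w Hw; exact: sub0.
  by have := GE z z Hz; rewrite subrr -(scale0r 0) dotZr mul0r addr0.
exists G, P, q; split; last first.
  by move=> z Hz; rewrite GG0// /G0 /conj_cost; lra.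
split => [z w|z h|z w Hz|z w Hz Hw|z Hz].
- rewrite lerBlDr; apply: Gle => y Hy.
  have -> : z - y = (z - w) + (w - y) by rewrite addrA subrK.
  by rewrite dotDr addrCA lerD ?dotL ?GE.
- rewrite mulr2n mulrDl mul1r.
  have : G z <= (G (z + h) + G (z - h)) / 2.
    apply: Gle => y Hy; have := GE y (z + h) Hy; have := GE y (z - h) Hy.
    rewrite (addrAC z h) (addrAC z (- h)) (dotDr _ (z - y) h) (dotDr _ (z - y) (- h)) dotNr.
    lra.
  lra.
- by rewrite GG0//; exact: GE.
- by rewrite !GG0//; exact: strong.
- exact: PL.
Qed.

End ConvexExtension.

(** * Second differences and Lebesgue measure *)

Section BorelRows.
Context (R : realType) (n : nat).
Local Notation V := 'rV[R]_n.


Lemma measurable_addr (h : V) : measurable_fun setT (fun x : V => x + h).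
Proof.
apply: measurable_rowP => i; under eq_fun do rewrite mxE.
by apply: measurable_funD; [exact: measurable_coord|exact: measurable_cst].
Qed.

Lemma continuous_measurable_row (f : V -> R) :
  continuous f -> measurable_fun setT f.
Proof.
move=> /continuousP cf; apply: (measurability _ (RGenOpens.measurableE R)).
move=> _ [_ [a [b ->]] <-]; rewrite setTI; apply: open_measurable_rV.
exact/cf/interval_open.
Qed.

Lemma lipschitz_measurable (f : V -> R) (L : R) :
  (forall x y, f x - f y <= L * enorm (x - y)) -> measurable_fun setT f.
Proof.
move=> fL; apply: continuous_measurable_row => x.
apply/(@cvgrPdist_le R R V (nbhs x) (nbhs_filter x) f (f x)) => e e0.
pose W := (`|L| + 1) * (n%:R + 1).
have W0 : 0 < W by rewrite mulr_gt0// ltr_wpDl.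
near=> y.
have xy : `|x - y| < e / W.
  near: y; apply/nbhs_ballP; exists (e / W); first exact: divr_gt0.
  by move=> y; rewrite -ball_normE.
have le : `|f x - f y| <= L * enorm (x - y).
  by rewrite ler_norml lerNl opprB fL enormC fL.
apply: le_trans le _; apply: (@le_trans _ _ (`|L| * (n%:R * `|x - y|))).
  apply: (@le_trans _ _ (`|L| * enorm (x - y))).
    by rewrite ler_wpM2r ?enorm_ge0// ler_norm.
  by rewrite ler_wpM2l// enorm_le_norm.
rewrite mulrA; apply: (@le_trans _ _ (W * `|x - y|)).
  by rewrite ler_wpM2r// ler_pM// lerDl.
by move: xy; rewrite ltr_pdivlMr// mulrC => /ltW.
Unshelve. all: by end_near.
Qed.

Lemma measurable_enorm : measurable_fun setT (@enorm R n).
Proof.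
apply: (@lipschitz_measurable _ 1) => x y; rewrite mul1r lerBlDr.
by have := ler_enormD (x - y) y; rewrite subrK.
Qed.

End BorelRows.

Section TranslationInvariance.
Context (R : realType) (n : nat).
Local Notation V := 'rV[R]_n.+1.
Local Notation leb := (lebesgue_rV R n.+1).

Definition box (a b : V) : set V := [set v | forall i, a 0 i <= v 0 i <= b 0 i].

Definition boxes : set (set V) := [set A | exists a b, A = box a b].

Lemma box_empty (a b : V) : ~ (forall i, a 0 i <= b 0 i) -> box a b = set0.
Proof.
move=> h; apply/seteqP; split => v //= vab; apply: h => i.
by have /andP[/le_trans] := vab i; apply.
Qed.

(** An open ball of the sup norm is a countable union of closed boxes. *)
Lemma measurable_boxes : measurable = <<s boxes >>.
Proof.
apply/seteqP; split; last first.
  apply: smallest_sub; first exact: smallest_sigma_algebra.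
  by move=> _ [a [b ->]]; exact: measurable_box.
apply: smallest_sub; first exact: smallest_sigma_algebra.
move=> U oU; rewrite (open_bigcup_boxes oU).
have mbox (a b : V) : @measurable _ (g_sigma_algebraType boxes) (box a b).
  by apply: sub_sigma_algebra; exists a, b.
change (@measurable _ (g_sigma_algebraType boxes) (\bigcup_(c : 'rV[rat]_n.+1 * rat)
    [set v | ball (map_mx ratr c.1 : V) (ratr c.2 : R) `<=` U /\
             ball (map_mx ratr c.1 : V) (ratr c.2 : R) v])).
apply: (@countable_bigcupT_measurable _ (g_sigma_algebraType boxes)) => // -[q r]/=.
have [bU|bU] := pselect (ball (map_mx ratr q : V) (ratr r : R) `<=` U); last first.
  by rewrite (_ : mkset _ = set0)//; apply/seteqP; split => // x [].
rewrite (_ : mkset _ = \bigcup_k box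
   (\row_i (ratr (q 0 i) - (ratr r - k.+1%:R^-1))) (\row_i (ratr (q 0 i) + (ratr r - k.+1%:R^-1)))).
  by apply: (@bigcupT_measurable _ (g_sigma_algebraType boxes)) => k; exact: mbox.
apply/seteqP; split => v /=.
  move=> [_ bv]; have : `|map_mx ratr q - v| < ratr r by rewrite -ball_normE in bv.
  move=> /ltr_add_invr[k kr]; exists k => // i; rewrite !mxE.
  have := coord_le_norm (map_mx ratr q - v) i; rewrite !mxE => h.
  have : `|ratr (q 0 i) - v 0 i| <= ratr r - k.+1%:R^-1 :> R.
    by rewrite (le_trans h)// lerBrDr ltW.
  rewrite ler_norml => /andP[h1 h2]; apply/andP; split.
    by rewrite lerBlDr -lerBlDl.
  by rewrite -lerBlDl -opprB lerNl.
move=> [k _ bv]; split=> //.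
have aux (a b c : R) : a - c <= b <= a + c -> 0 <= c /\ `|a - b| <= c.
  by move=> /andP[h1 h2]; rewrite ler_norml; split; [lra|apply/andP; split; lra].
have r0 : 0 <= ratr r - k.+1%:R^-1 :> R by have := bv ord0; rewrite !mxE => /aux[].
rewrite -ball_normE /=; apply: (@le_lt_trans _ _ (ratr r - k.+1%:R^-1)).
  by apply: norm_row_le => // i; have := bv i; rewrite !mxE => /aux[].
by rewrite ltrBlDr ltrDl invr_gt0.
Qed.

Lemma lebesgue_rV_translate (h : V) (A : set V) : measurable A ->
  leb [set x | A (x + h)] = leb A.
Proof.
move=> mA.
pose m1 : {measure set V -> \bar R} :=
  measure_function_pushforward__canonical__measure_function_Measure leb (measurable_addr h).
pose g (k : nat) : set V := box (const_mx (- k%:R)) (const_mx k%:R).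
apply: (@measure_unique _ R V boxes g measurable_boxes _ _ _ m1 leb) => //.
- move=> _ _ [a [b ->]] [c [d ->]].
  exists (\row_i Num.max (a 0 i) (c 0 i)), (\row_i Num.min (b 0 i) (d 0 i)).
  apply/seteqP; split => v /=.
    move=> [v1 v2] i; rewrite !mxE ge_max le_min.
    by have /andP[-> ->] := v1 i; have /andP[-> ->] := v2 i.
  move=> v12; split=> i; have := v12 i; rewrite !mxE ge_max le_min;
  by move=> /andP[/andP[? ?] /andP[? ?]]; apply/andP.
- by move=> k; exists (const_mx (- k%:R)), (const_mx k%:R).
- rewrite -subTset => v _; exists (Num.truncn `|v|).+1 => //= i; rewrite !mxE -ler_norml.
  by rewrite (le_trans (coord_le_norm v i))// ltW// truncnS_gt.
- move=> _ [a [b ->]].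
  change (leb [set x | box a b (x + h)] = leb (box a b)).
  have -> : [set x | box a b (x + h)] = box (a - h) (b - h).
    by apply/seteqP; split => v /= vab i; have := vab i; rewrite !mxE lerBlDr lerBrDr.
  have [ab|/box_empty abN] := pselect (forall i, a 0 i <= b 0 i).
    rewrite !lebesgue_rV_box// => [|i]; last by rewrite !mxE lerD2r.
    by congr EFin; apply: eq_bigr => i _; rewrite !mxE opprB addrA subrK.
  rewrite abN box_empty// => h'.
  have : box a b a; last by rewrite abN.
  by move=> i; rewrite lexx/=; have := h' i; rewrite !mxE lerD2r.
- move=> k; change (leb [set x : V | g k (x + h)%R] < +oo)%E.
  have -> : [set x | g k (x + h)] = box (const_mx (- k%:R) - h) (const_mx k%:R - h).
    by apply/seteqP; split => v /= vab i; have := vab i; rewrite !mxE lerBlDr lerBrDr.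
  rewrite lebesgue_rV_box ?ltry// => i; rewrite !mxE lerD2r.
  by rewrite (@le_trans _ _ 0)// oppr_le0.
Qed.

(** The second difference is [psi (x + h) - psi x], where [psi] is a first
    difference, of size [L * r], shifted to be nonnegative. By translation
    invariance its integral over a box only sees a slab of thickness [r]: hence the
    square of [r]. *)
Lemma integral_second_difference (f : V -> R) (L D r : R) (x0 : V) (k : 'I_n.+1) :
  (forall x y, f x - f y <= L * enorm (x - y)) ->
  (forall x h, 2 * f x <= f (x + h) + f (x - h)) ->
  0 <= L -> 0 <= D -> 0 <= r ->
  (\int[leb]_(x in box (x0 - const_mx D) (x0 + const_mx D))
     (f (x + r *: delta_mx 0 k) + f (x - r *: delta_mx 0 k) - 2 * f x)%:E <=
   (2 * L * r ^+ 2 * (2 * D) ^+ n)%:E)%E.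
Proof.
move=> fL fmid L0 D0 r0; set h := r *: delta_mx 0 k; set B := box _ _.
have mf : measurable_fun setT f := lipschitz_measurable fL.
have hE : enorm h = r.
  rewrite enormZ ger0_norm// (_ : enorm _ = 1) ?mulr1//.
  by apply/eqP; rewrite -(@eqrXn2 _ 2)// ?enorm_ge0// sqr_enorm dot_delta mxE !eqxx expr1n.
pose psi (x : V) := f x - f (x - h) + L * r.
have mfh (a : V) : measurable_fun setT (fun x : V => f (x + a)).
  exact: (measurableT_comp mf (measurable_addr a)).
have mpsi : measurable_fun setT psi.
  by apply: measurable_funD; [apply: measurable_funB => //; exact: mfh|exact: measurable_cst].
have psi0 x : 0 <= psi x.
  have := fL (x - h) x; rewrite [x - h - x]addrAC subrr add0r enormN hE /psi; lra.
have psiM x : psi x <= 2 * L * r.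
  have := fL x (x - h); rewrite opprB subrKC hE /psi; lra.
have mB : measurable B by exact: measurable_box.
pose Bh : set V := [set x | B (x - h)].
have mBh : measurable Bh.
  by rewrite -[X in measurable X]setTI; exact: (measurable_addr (- h)).
have mEpsi (A : set V) : measurable_fun A (EFin \o psi).
  by apply/measurable_EFinP; exact: measurable_funS mpsi.
have shift : (\int[leb]_(x in B) (psi (x + h))%:E = \int[leb]_(x in Bh) (psi x)%:E)%E.
  pose m1 : {measure set V -> \bar R} :=
    measure_function_pushforward__canonical__measure_function_Measure leb (measurable_addr h).
  rewrite -(@eq_measure_integral _ _ _ Bh leb m1) => [|A mA _]; last first.
    exact: lebesgue_rV_translate.
  rewrite (ge0_integral_pushforward (measurable_addr h) leb mBh (mEpsi _)); last first.
    by move=> y _ /=; rewrite lee_fin.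
  congr (integral _ _ _); apply/seteqP; split => x; rewrite /Bh /preimage/= addrK//.
pose slab : set V := box
  (\row_i (if i == k then x0 0 i + D else x0 0 i - D))
  (\row_i (if i == k then x0 0 i + D + r else x0 0 i + D)).
have mslab : measurable slab by exact: measurable_box.
have lslab : leb slab = (r * (2 * D) ^+ n)%:E.
  rewrite lebesgue_rV_box => [|i]; last by rewrite !mxE; case: eqP => _; lra.
  congr EFin; rewrite (bigD1 k)//= !mxE eqxx; congr (_ * _); first by ring.
  rewrite (eq_bigr (fun=> 2 * D)) => [|i /negbTE ik]; last by rewrite !mxE ik; ring.
  by rewrite prodr_const (@eq_card _ _ (predC1 k))// cardC1 card_ord.
have Bhsub : Bh `<=` B `|` slab.
  move=> x xB; have xB' i := xB i; rewrite /h in xB'.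
  have [xk|xk] := leP (x 0 k) (x0 0 k + D); [left|right] => i; have := xB' i; rewrite !mxE;
    rewrite eqxx/=; case: (eqVneq i k) => [->|ik] /=; rewrite ?mulr0 ?mulr1 => /andP[h1 h2];
    apply/andP; split; lra.
have key : (\int[leb]_(x in B) (psi (x + h))%:E <=
    \int[leb]_(x in B) (psi x)%:E + (2 * L * r * (r * (2 * D) ^+ n))%:E)%E.
  rewrite shift; apply: (@le_trans _ _ (\int[leb]_(x in B `|` (slab `\` B)) (psi x)%:E)%E).
    apply: ge0_subset_integral => //.
    - by apply: measurableU => //; exact: measurableD.
    - by move=> x _; rewrite lee_fin.
    - by move=> x /Bhsub[Bx|sx]; [left|have [?|?] := pselect (B x); [left|right]].
  rewrite (@ge0_integral_setU _ _ _ leb _ _ mB (measurableD mslab mB) (EFin \o psi) (mEpsi _)); last 2 first.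
  - by move=> x _; rewrite lee_fin.
  - by apply/disj_setPS => x [? []].
  rewrite leeD2l// (@le_trans _ _ (\int[leb]_(x in slab) (2 * L * r)%:E)%E)//; last first.
    by rewrite integral_cst// [X in (_ * X)%E]lslab -EFinM lexx.
  apply: (@le_trans _ _ (\int[leb]_(x in slab) (psi x)%:E)%E).
    apply: ge0_subset_integral => //.
    - exact: measurableD.
    - by move=> x _; rewrite lee_fin.
  apply: ge0_le_integral => //.
  - by move=> x _; rewrite lee_fin.
  - by move=> x _; rewrite lee_fin.
pose dlt (x : V) := f (x + h) + f (x - h) - 2 * f x.
have dlt0 x : 0 <= dlt x by rewrite /dlt subr_ge0.
have psih x : psi (x + h) = dlt x + psi x by rewrite /psi /dlt addrK; ring.
have mdlt : measurable_fun setT dlt.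
  apply: measurable_funB; last by apply: measurable_funM => //; exact: measurable_cst.
  by apply: measurable_funD; exact: mfh.
have fin : (\int[leb]_(x in B) (psi x)%:E)%E \is a fin_num.
  rewrite ge0_fin_numE; last by apply: integral_ge0 => x _; rewrite lee_fin.
  apply: (@le_lt_trans _ _ (\int[leb]_(x in B) (2 * L * r)%:E)%E).
    apply: ge0_le_integral => //.
    - by move=> x _; rewrite lee_fin.
    - by move=> x _; rewrite lee_fin.
  have lB : leb B = (\prod_i ((x0 + const_mx D) 0 i - (x0 - const_mx D) 0 i))%:E.
    by rewrite lebesgue_rV_box => // i; rewrite !mxE; lra.
  by rewrite integral_cst// [X in (_ * X)%E]lB -EFinM ltry.
have split : (\int[leb]_(x in B) (psi (x + h))%:E =
    \int[leb]_(x in B) (dlt x)%:E + \int[leb]_(x in B) (psi x)%:E)%E.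
  rewrite -ge0_integralD//.
  - by apply: eq_integral => x _; rewrite psih EFinD.
  - by move=> x _; rewrite lee_fin.
  - by apply/measurable_EFinP; exact: measurable_funS mdlt.
  - by move=> x _; rewrite lee_fin.
move: key; rewrite split addeC leeD2lE// => /le_trans; apply.
by rewrite lee_fin le_eqVlt; apply/orP; left; apply/eqP; ring.
Qed.

End TranslationInvariance.

Section DensityBound.
Context (R : realType) (n : nat).
Local Notation V := 'rV[R]_n.
Local Notation leb := (lebesgue_rV R n).

(** The Radon-Nikodym derivative is nonnegative almost everywhere only, hence the
    detour through absolute values. *)
Lemma density_integral_le (rho : probability V R) (M : R) (B : set V) (f : V -> R) (K : R) :
  rho `<< leb -> Linfty_norm rho = M%:E -> measurable B -> measurable_fun setT f ->
  (forall x, B x -> 0 <= f x <= K) ->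
  (\int[rho]_(x in B) (f x)%:E <= M%:E * \int[leb]_(x in B) (f x)%:E)%E.
Proof.
move=> dom normM mB mf fK.
have mfB : measurable_fun B (EFin \o f) by apply/measurable_EFinP; exact: measurable_funS mf.
have lebT : (0 < leb setT)%E.
  rewrite lt_neqAle measure_ge0 andbT eq_sym; apply/eqP => leb0.
  have /null_content_dominatesP/(_ _ measurableT leb0) := dom.
  by rewrite probability_setT => /eqP; rewrite onee_eq0.
pose rn := Radon_Nikodym (charge_of_finite_measure rho) leb.
have mrn : measurable_fun setT rn by apply: (@measurable_int _ _ _ leb); exact: Radon_Nikodym_integrable.
have rnM : {ae leb, forall x, (`|rn x| <= M%:E)%E}.
  have := ess_sup_ge leb (abse \o rn).
  by move: normM; rewrite /Linfty_norm unlock lebT => ->.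
have M0 : 0 <= M by rewrite -lee_fin -normM; exact: Lnorm_ge0.
have fint : rho.-integrable B (EFin \o f).
  apply: (@le_integrable _ _ _ _ _ mB _ (cst K%:E)) => //.
    by move=> x Bx /=; have /andP[f0 fk] := fK x Bx; rewrite lee_fin ger0_norm// ger0_norm// (le_trans f0).
  exact: finite_measure_integrable_cst.
rewrite -(Radon_Nikodym_change_of_variables dom mB fint) -/rn.
apply: (le_trans (lee_abs _)); apply: le_trans.
  apply: le_abse_integral => //; apply: emeasurable_funM => //; exact: measurable_funS mrn.
rewrite -ge0_integralZl_EFin//; last by move=> x /fK/andP[? _]; rewrite lee_fin.
apply: ae_ge0_le_integral => //.
- apply: measurableT_comp => //; apply: emeasurable_funM => //; exact: measurable_funS mrn.
- by move=> x /fK/andP[? _]; rewrite mule_ge0 ?lee_fin.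
- by apply: emeasurable_funM.
move: rnM; apply: filterS => x rx Bx; have /andP[f0 _] := fK x Bx.
rewrite /= abseM muleC [X in (_ * X)%E]gee0_abs ?lee_fin//. exact: lee_wpmul2r.
Qed.

End DensityBound.

(** * Discrete plans and their potentials *)

Section FinitePlans.
Context (R : realType).

Lemma lp_duality (X Z : finType) (c : X -> R) (A : X -> Z -> R) (b : Z -> R) :
  (exists v : X -> R, [/\ forall x, 0 <= v x, \sum_x v x = 1 &
     forall z, \sum_x A x z * v x = b z]) ->
  exists v : X -> R, [/\ forall x, 0 <= v x, \sum_x v x = 1,
    forall z, \sum_x A x z * v x = b z &
    forall delta, 0 < delta -> exists (u : Z -> R) s,
      (forall x, c x <= \sum_z u z * A x z + s) /\
      \sum_z u z * b z + s <= \sum_x c x * v x + delta].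
Proof.
move=> [v0 [v00 v01 v0b]].
have sumX (I : finType) (f : I -> R) : \sum_(k < #|I|) f (enum_val k) = \sum_x f x.
  by rewrite (reindex_onto enum_rank enum_val) /=; [apply: eq_big => x; rewrite ?enum_rankK ?eqxx|move=> i _; exact: enum_valK].
have := @simplex_duality R #|X| #|Z| (fun k => c (enum_val k))
  (fun k l => A (enum_val k) (enum_val l)) (fun l => b (enum_val l)).
case.
  exists (\row_k v0 (enum_val k)).
    split=> [i|]; first by rewrite mxE.
    by under eq_bigr do rewrite mxE; rewrite (sumX X).
  move=> l; under eq_bigr do rewrite mxE.
  by rewrite (sumX X (fun x => A x (enum_val l) * v0 x)).
move=> v [[v_ge0 v1] vb vd]; exists (fun x => v 0 (enum_rank x)); split => //.
- by rewrite -(sumX X); under eq_bigr do rewrite enum_valK.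
- move=> z; rewrite -(sumX X); under eq_bigr do rewrite enum_valK.
  by have := vb (enum_rank z); rewrite enum_rankK.
move=> delta /vd[u [s [us ud]]].
exists (fun z => u (enum_rank z)), s; split.
  move=> x; have := us (enum_rank x); rewrite enum_rankK => /le_trans; apply.
  by rewrite -(sumX Z); under [X in _ <= X + _]eq_bigr do rewrite enum_valK.
rewrite -(sumX Z); under eq_bigr do rewrite enum_valK.
by rewrite -(sumX X); under [X in _ <= X + _]eq_bigr do rewrite enum_valK.
Qed.

Context (N : nat) (J : finType).
Local Notation JN := {ffun 'I_N -> J}.

Lemma product_marginal (m : 'I_N -> J -> R) i k : (forall i, \sum_k m i k = 1) ->
  \sum_(f : JN) (f i == k)%:R * \prod_j m j (f j) = m i k.
Proof.
move=> m1.
transitivity (\prod_j \sum_l ((j == i) ==> (l == k))%:R * m j l).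
  rewrite bigA_distr_bigA/=; apply: eq_bigr => f _.
  rewrite [RHS](bigD1 i)//= [in LHS](bigD1 i)//= eqxx mulrA; congr (_ * _).
  by apply: eq_bigr => j /negbTE ->; rewrite /= mul1r.
rewrite (bigD1 i)//= eqxx/= (bigD1 k)//= eqxx mul1r big1 => [|l /negbTE ->]; last by rewrite mul0r.
rewrite addr0 big1 ?mulr1// => j /negbTE ->.
by rewrite -[RHS](m1 j); apply: eq_bigr => l _; rewrite /= mul1r.
Qed.

Lemma product_total (m : 'I_N -> J -> R) : (forall i, \sum_k m i k = 1) ->
  \sum_(f : JN) \prod_j m j (f j) = 1.
Proof.
by move=> m1; rewrite -(bigA_distr_bigA (fun j l => m j l)) big1.
Qed.

(** Duality for plans between finite sets, in a form without values: along an
    optimal plan [g], some feasible potentials have a slack of integral at most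
    [delta]. The multiplier of the total mass is absorbed in [u0]. *)
Lemma plan_duality (m0 : J -> R) (m : 'I_N -> J -> R) (c : J -> JN -> R) :
  (forall k, 0 <= m0 k) -> \sum_k m0 k = 1 ->
  (forall i k, 0 <= m i k) -> (forall i, \sum_k m i k = 1) ->
  exists g : J -> JN -> R, [/\ forall j f, 0 <= g j f,
    forall j, \sum_f g j f = m0 j,
    forall i k, \sum_j \sum_(f : JN | f i == k) g j f = m i k &
    forall delta, 0 < delta -> exists (u0 : J -> R) (u : 'I_N -> J -> R),
      (forall j f, c j f <= u0 j + \sum_i u i (f i)) /\
      \sum_j \sum_f g j f * (u0 j + \sum_i u i (f i) - c j f) <= delta].
Proof.
move=> m00 m01 mp m1.
pose A (x : J * JN) (z : J + 'I_N * J) : R :=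
  match z with inl j => (x.1 == j)%:R | inr (i, k) => (x.2 i == k)%:R end.
pose b (z : J + 'I_N * J) : R := match z with inl j => m0 j | inr (i, k) => m i k end.
have pairE (F : J * JN -> R) : \sum_x F x = \sum_j \sum_f F (j, f).
  by rewrite pair_bigA; apply: eq_bigr => -[].
have sumZ (F : J + 'I_N * J -> R) : \sum_z F z = \sum_j F (inl j) + \sum_i \sum_k F (inr (i, k)).
  by rewrite big_sumType/= pair_bigA; congr (_ + _); apply: eq_bigr => -[].
have pick1 (I : finType) (F : I -> R) a : \sum_x F x * (a == x)%:R = F a.
  rewrite (bigD1 a)//= eqxx mulr1 big1 ?addr0// => x /negbTE xa.
  by rewrite eq_sym xa mulr0.
have [|v [v0 v1 vb vd]] := @lp_duality _ _ (fun x => c x.1 x.2) A b.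
  exists (fun x : J * JN => m0 x.1 * \prod_i m i (x.2 i)); split.
  - by move=> x; rewrite mulr_ge0// prodr_ge0.
  - by rewrite pairE/= -[RHS]m01; apply: eq_bigr => j _; rewrite -mulr_sumr product_total// mulr1.
  - case=> [j|[i k]]; rewrite pairE/=.
      under eq_bigr => j' _ do rewrite -mulr_sumr -mulr_sumr product_total// mulr1 mulrC eq_sym.
      exact: pick1.
    under eq_bigr => j' _.
      under eq_bigr do rewrite mulrCA.
      rewrite -mulr_sumr product_marginal//; over.
    by rewrite -mulr_suml m01 mul1r.
exists (fun j f => v (j, f)); split => //.
- move=> j; have := vb (inl j); rewrite pairE/= => <-.
  under [RHS]eq_bigr do rewrite -mulr_sumr mulrC eq_sym.
  by rewrite (pick1 _ (fun j => \sum_f v (j, f)) j).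
- move=> i k; have := vb (inr (i, k)); rewrite pairE/= => <-.
  apply: eq_bigr => j _; rewrite big_mkcond; apply: eq_bigr => f _.
  by case: eqP => _; rewrite ?mul1r ?mul0r.
move=> delta /vd[u [s [us ud]]].
have uA (x : J * JN) : \sum_z u z * A x z + s = u (inl x.1) + s + \sum_i u (inr (i, x.2 i)).
  rewrite sumZ/= pick1 addrAC; congr (_ + _); apply: eq_bigr => i _.
  exact: (pick1 _ (fun k => u (inr (i, k)))).
exists (fun j => u (inl j) + s), (fun i k => u (inr (i, k))); split.
  by move=> j f; have := us (j, f); rewrite uA.
rewrite -(pairE (fun x => v x * (u (inl x.1) + s + \sum_i u (inr (i, x.2 i)) - c x.1 x.2))).
under eq_bigr do rewrite -uA mulrBr mulrDr.
rewrite sumrB big_split/= -mulr_suml v1 mul1r lerBlDr [leRHS]addrC.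
under [X in _ <= X + _]eq_bigr do rewrite mulrC.
apply: le_trans ud; rewrite lerD2r le_eqVlt; apply/orP; left; apply/eqP.
under eq_bigr do rewrite mulr_sumr.
rewrite exchange_big/=; apply: eq_bigr => z _; rewrite -vb mulr_sumr.
by apply: eq_bigr => x _; ring.
Qed.

End FinitePlans.

Section Cells.
Context (R : realType) (n : nat).
Local Notation V := 'rV[R]_n.

Lemma finite_net (K e : R) : 0 < e -> exists (J : finType) (z : J -> V),
  forall v : V, (forall i, `|v 0 i| <= K) -> exists j, enorm (v - z j) <= e.
Proof.
move=> e0; pose s := e / (n%:R + 1).
have s0 : 0 < s by rewrite divr_gt0// ltr_wpDl.
pose m := Num.truncn (2 * K / s).
exists {ffun 'I_n -> 'I_m.+1}, (fun j : {ffun 'I_n -> 'I_m.+1} => \row_i (- K + (j i)%:R * s)) => v vK.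
exists [ffun i => inord (Num.truncn ((v 0 i + K) / s))].
have coord i : `|v 0 i - (- K + (inord (Num.truncn ((v 0 i + K) / s)) : 'I_m.+1)%:R * s)| <= s.
  have /ler_normlP[h1 h2] := vK i.
  have p0 : 0 <= (v 0 i + K) / s by rewrite divr_ge0 ?(ltW s0)//; lra.
  rewrite inordK; last first.
    by rewrite ltnS; apply: le_truncn; rewrite ler_pM2r ?invr_gt0//; lra.
  have /andP[h3 h4] := truncn_itv p0; rewrite ler_pdivlMr// in h3.
  rewrite ltr_pdivrMr// -natr1 mulrDl mul1r in h4.
  by rewrite ler_norml; apply/andP; split; lra.
apply: le_trans (enorm_le_norm _) _.
apply: (@le_trans _ _ (n%:R * s)).
  by rewrite ler_wpM2l//; apply: norm_row_le => [|i]; [exact: ltW|rewrite !mxE ffunE].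
by rewrite /s mulrCA ler_piMr ?ltW// ltr_pdivrMr ?ltr_wpDl// mul1r ltrDl.
Qed.

(** The choice of a point of a finite net near [v] depends on finitely many
    measurable tests on [v]. *)
Lemma finite_cells (K e : R) : 0 < e -> 0 <= K ->
  exists (J : finType) (z : J -> V) (c : V -> J),
    (forall A : set J, measurable (c @^-1` A)) /\
    forall v : V, (forall i, `|v 0 i| <= K) -> enorm (v - z (c v)) <= e.
Proof.
move=> e0 K0; have [J [z zP]] := finite_net K e0.
have [j0 _] : exists j, enorm (0 - z j) <= e by apply: zP => i; rewrite mxE normr0.
pose near (v : V) : {ffun J -> bool} := [ffun j => enorm (v - z j) <= e].
pose c v := odflt j0 [pick j | near v j].
exists J, z, c; split.
  move=> A; rewrite (_ : _ @^-1` _ = \bigcup_(b in [set b : {ffun J -> bool} | A (odflt j0 [pick j | b j])])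
     \bigcap_(j in setT) [set v | near v j = b j]); last first.
    apply/seteqP; split => [v Av|v [b Ab vb]] /=; first by exists (near v).
    by rewrite /c (_ : near v = b)//; apply/ffunP => j; exact: vb.
  apply: fin_bigcup_measurable => //.
  move=> b _; apply: fin_bigcap_measurable; first exact: finite_finset.
  move=> j _.
  have mj : measurable_fun setT (fun v : V => enorm (v - z j) <= e).
    apply: measurable_fun_ler; last exact: measurable_cst.
    exact: (measurableT_comp (@measurable_enorm R n) (measurable_addr (- z j))).
  have := mj measurableT [set b j] I; rewrite setTI; congr measurable.
  by apply/seteqP; split => v /=; rewrite ffunE.
move=> v vK; rewrite /c; case: pickP => [j|/= no]; first by rewrite ffunE.
by have [j jP] := zP v vK; have := no j; rewrite ffunE jP.
Qed.

End Cells.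

(** * Realising a discrete plan by maps *)

Section FiniteTransport.
Context (R : realType) (n : nat).
Local Notation V := 'rV[R]_n.+1.

Lemma atoms_measure (I : Type) (s : seq I) (w : I -> R) (pt : I -> V) :
  (forall i, 0 <= w i) -> exists m : {measure set V -> \bar R},
    forall B : set V, m B = (\sum_(i <- s) w i * \1_B (pt i))%:E.
Proof.
move=> w0; elim: s => [|i s [m IH]].
  by exists (@mzero _ V R) => B; rewrite big_nil.
pose a := NngNum (w0 i).
exists (measure_add (mscale a (@dirac _ V (pt i) R)) m) => B.
etransitivity; first exact: measure_addE.
by rewrite /= /mscale/= IH big_cons EFinD EFinM.
Qed.

Lemma transport_finite (rho : probability V R) (A : set V) (K : R) (X : finType)
    (x0 : X) (w : X -> R) :
  rho `<< lebesgue_rV R n.+1 -> measurable A -> 0 <= K ->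
  (forall x, A x -> `|x 0 0| <= K) ->
  (forall x, 0 <= w x) -> rho A = (\sum_x w x)%:E ->
  exists k : V -> X, (forall B : set X, measurable (k @^-1` B)) /\
    forall x, rho (A `&` k @^-1` [set x]) = (w x)%:E.
Proof.
move=> dom mA K0 AK w0 wA.
pose pt (x : X) : V := const_mx (enum_rank x)%:R.
have pt_inj : injective pt.
  move=> x y /rowP/(_ ord0); rewrite !mxE => /eqP; rewrite eqr_nat => /eqP h.
  by apply: enum_rank_inj; exact: val_inj.
have [m mE] := atoms_measure (index_enum X) pt w0.
pose K' := K + #|X|%:R.
have K'0 : 0 <= K' by rewrite addr_ge0.
have [|||t [mt tE]] := @transport_exists R n rho A m K' dom mA K'0.
- by move=> x /AK h; rewrite (le_trans h)// lerDl.
- rewrite mE big1// => x _; rewrite indicE memNset ?mulr0//= => -[i].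
  rewrite mxE ger0_norm// ltNge => /negP; apply.
  by apply: ler_wpDl => //; rewrite ler_nat ltnW.
- by rewrite mE wA; congr EFin; apply: eq_bigr => x _; rewrite indicT mulr1.
pose dec (v : V) : X := odflt x0 [pick x | v == pt x].
have decK x : dec (pt x) = x.
  rewrite /dec; case: pickP => [y /eqP/pt_inj ->//|/(_ x)]; by rewrite eqxx.
have msing (v : V) : measurable [set v].
  rewrite (_ : [set v] = box v v); first exact: measurable_box.
  apply/seteqP; split => [_ -> i|u uv /=]; first by rewrite lexx.
  by apply/rowP => i; have := uv i; rewrite -eq_le => /eqP.
have mdec (B : set X) : measurable (dec @^-1` B).
  have mfin (C : set X) : measurable (pt @` C).
    rewrite -bigcup_imset1; apply: fin_bigcup_measurable => //; exact: finite_finset.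
  have -> : dec @^-1` B = (pt @` B) `|` (if `[< B x0 >] then ~` (range pt) else set0).
    apply/seteqP; split => v.
      rewrite /preimage/= {1}/dec; case: pickP => [x /eqP -> Bx|no /= Bx0]; first by left; exists x.
      right; rewrite (asboolT Bx0) => -[x _ xv].
      by have := no x; rewrite -xv eqxx.
    case=> [[x Bx <-]|]; first by rewrite /= decK.
    case: asboolP => // Bx0 no; rewrite /= /dec; case: pickP => //= x /eqP vx.
    by exfalso; apply: no; exists x.
  apply: measurableU => //; case: ifP => _ //; exact: measurableC.
exists (dec \o t); split.
  by move=> B; rewrite comp_preimage -[X in measurable X]setTI; exact: mt.
move=> x; rewrite comp_preimage tE// mE (bigD1 x)//= big1 => [|y yx].
  by rewrite indicE mem_set ?mulr1 ?addr0//= decK.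
by rewrite indicE memNset ?mulr0//= decK => /eqP; apply/negP.
Qed.

End FiniteTransport.

Section PlanMaps.
Context (R : realType) (n N : nat).
Local Notation V := 'rV[R]_n.+1.

Lemma measurable_fun_cases (X : finType) (k : V -> X) (t : X -> V -> V) :
  (forall B : set X, measurable (k @^-1` B)) -> (forall x, measurable_fun setT (t x)) ->
  measurable_fun setT (fun v => t (k v) v).
Proof.
move=> mk mt _ B mB; rewrite setTI.
rewrite (_ : _ @^-1` B = \bigcup_(x in setT) ((k @^-1` [set x]) `&` (t x @^-1` B))).
  apply: fin_bigcup_measurable; first exact: finite_finset.
  by move=> x _; apply: measurableI => //; rewrite -[X in measurable X]setTI; exact: mt.
apply/seteqP; split => [v tv|v [x _ [/= <-//]]].
by exists (k v).
Qed.

Lemma measure_cells (m : {measure set V -> \bar R}) (X : finType) (k : V -> X) (A : set V) :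
  (forall B : set X, measurable (k @^-1` B)) -> measurable A ->
  (m A = \sum_x m (A `&` k @^-1` [set x]))%E.
Proof.
move=> mk mA.
have AE : A = \bigcup_(x in setT) (A `&` k @^-1` [set x]).
  apply/seteqP; split => [v Av|v [x _ []]//]; by exists (k v).
rewrite [in LHS]AE.
rewrite measure_fin_bigcup//.
- rewrite [RHS]fsbig_seq ?index_enum_uniq// (_ : [set` index_enum X] = setT)//.
  by apply/seteqP; split => // x _ /=; exact: mem_index_enum.
- exact: finite_finset.
- by move=> x y _ _ [v [[_ <-] [_ <-]]].
- by move=> x _; exact: measurableI.
Qed.

End PlanMaps.

Section NearOptimalMaps.
Context (R : realType) (n N : nat).
Local Notation V := 'rV[R]_n.+1.
Implicit Types (S Y : set V) (mu : 'I_N -> probability V R).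

(** The mean of a tuple, the first point being set apart as in the maps of the
    problem. *)
Definition bary (lambda : 'I_N.+1 -> R) (x : V) (y : 'I_N -> V) : V :=
  lambda ord0 *: x + \sum_i lambda (lift ord0 i) *: y i.

Lemma bary_lipschitz (lambda : 'I_N.+1 -> R) x x' y y' : (forall i, 0 <= lambda i) ->
  enorm (bary lambda x y - bary lambda x' y') <=
  lambda ord0 * enorm (x - x') + \sum_i lambda (lift ord0 i) * enorm (y i - y' i).
Proof.
move=> l0; rewrite /bary opprD addrACA -scalerBr -sumrB.
apply: le_trans (ler_enormD _ _) _; rewrite enormZ ger0_norm// lerD2l.
apply: le_trans (ler_enorm_sum _ _) _; apply: ler_sum => i _.
by rewrite -scalerBr enormZ ger0_norm.
Qed.

(** Lipschitz extension of values given at finitely many points, from above: it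
    keeps the potentials feasible. *)
Lemma inf_convolution (J : finType) (j0 : J) (z : J -> V) (U : J -> R) (a : R) : 0 <= a ->
  exists u : V -> R, [/\ forall x y, u x - u y <= a * enorm (x - y),
    forall x j, u x <= U j + a * enorm (x - z j) &
    forall x, exists j, u x = U j + a * enorm (x - z j)].
Proof.
move=> a0; pose F x j := U j + a * enorm (x - z j).
pose k x := [arg min_(j < j0) F x j]%O.
have kP x j : F x (k x) <= F x j by rewrite /k; case: arg_minP => // i _; apply.
exists (fun x => F x (k x)); split => [x y|x j|x]; [|exact: kP|by exists (k x)].
apply: (@le_trans _ _ (F x (k y) - F y (k y))); first by rewrite lerB.
rewrite /F opprD addrACA subrr add0r -mulrBr ler_wpM2l// lerBlDr.
exact: ler_enormB.
Qed.

(** Values outside a set of full measure may be changed to [y0]. *)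
Lemma transport_redirect (rho : probability V R) (A W : set V) (m : {measure set V -> \bar R})
    (t : V -> V) (y0 : V) :
  measurable A -> measurable W -> measurable_fun setT t -> m (~` W) = 0%E ->
  (forall B, measurable B -> rho (A `&` t @^-1` B) = m B) ->
  measurable_fun setT (fun x => if `[< W (t x) >] then t x else y0) /\
  forall B, measurable B ->
    rho (A `&` (fun x => if `[< W (t x) >] then t x else y0) @^-1` B) = m B.
Proof.
move=> mA mW mt mW0 tE; set t' := fun x => _.
have mt' : measurable_fun setT t'.
  apply: measurable_fun_ifT; [|exact: mt|exact: measurable_cst].
  apply: (measurable_fun_bool true); rewrite setTI.
  rewrite (_ : _ @^-1` _ = t @^-1` W).
    by rewrite -[X in measurable X]setTI; exact: mt.
  by apply/seteqP; split => x /= /asboolP.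
split=> // B mB.
have mpre (C : set V) : measurable C -> measurable (t @^-1` C).
  by move=> mC; rewrite -[X in measurable X]setTI; exact: mt.
have mpre' : measurable (t' @^-1` B) by rewrite -[X in measurable X]setTI; exact: mt'.
have split_ (C : set V) : measurable C -> rho (A `&` C) = rho (A `&` C `&` t @^-1` W).
  move=> mC; have mAC : measurable (A `&` C) by exact: measurableI.
  rewrite [LHS](@measureDI _ _ _ rho _ _ mAC (mpre _ mW)) [X in (X + _)%E](_ : _ = 0%E) ?add0e//.
  apply/le_anti; rewrite measure_ge0 andbT -mW0 -(tE _ (measurableC mW)).
  apply: le_measure; rewrite ?inE.
  - by apply: measurableD => //; exact: mpre.
  - by apply: measurableI => //; apply: mpre; exact: measurableC.
  - by move=> x [[? _] ?]; split.
rewrite split_// -tE// [RHS]split_; last exact: mpre.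
congr (rho _); apply/seteqP; split => x [[Ax Bx] Wx]; split => //; split => //.
  by move: Bx; rewrite /t'/= (asboolT Wx).
by rewrite /t'/= (asboolT Wx).
Qed.

Lemma integral_cells (rho : probability V R) S (X : finType) (k : V -> X) (H : X -> R) :
  measurable S -> (forall B : set X, measurable (k @^-1` B)) -> (forall x, 0 <= H x) ->
  (\int[rho]_(x in S) (H (k x))%:E = \sum_p (H p)%:E * rho (S `&` k @^-1` [set p]))%E.
Proof.
move=> mS mk H0.
transitivity (\int[rho]_(x in S) (\sum_p (H p)%:E * (\1_(k @^-1` [set p]) x)%:E))%E.
  apply: eq_integral => x _; rewrite (bigD1 (k x))//= big1 => [|p pk].
    by rewrite indicE mem_set// mule1 adde0.
  by rewrite indicE memNset ?mule0//= => kp; rewrite -kp eqxx in pk.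
rewrite ge0_integral_sum//.
- apply: eq_bigr => p _; rewrite ge0_integralZl_EFin//.
  + by rewrite integral_indic// setIC.
  + by apply/measurable_EFinP; exact: measurable_indic.
- move=> p; apply: emeasurable_funM; first exact: measurable_cst.
  by apply/measurable_EFinP; exact: measurable_indic.
- by move=> p x _; rewrite mule_ge0 ?lee_fin.
Qed.

Section plan_realisation.
Context (rho : probability V R) (mu : 'I_N -> probability V R) (S Y : set V) (K : R).
Context (J : finType) (j0 : J) (c : V -> J).
Hypotheses (dom : rho `<< lebesgue_rV R n.+1) (mS : measurable S) (mY : measurable Y).
Hypotheses (muY : forall i, mu i Y = 1%E) (K0 : 0 <= K).
Hypotheses (SK : forall x, S x -> forall i, `|x 0 i| <= K).
Hypotheses (YK : forall x, Y x -> forall i, `|x 0 i| <= K).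
Hypothesis mc : forall B : set J, measurable (c @^-1` B).
Local Notation JN := {ffun 'I_N -> J}.

(** As [rho] has no atoms, each cell of the first variable splits according to [g].
    For each [i], the points whose [i]-th cell is [l] have the same mass under [rho]
    as that cell under [mu i], so they can be transported onto [mu i] restricted to
    the cell. *)
Lemma plan_realised_by_maps (g : J -> JN -> R) : (forall j f, 0 <= g j f) ->
  (forall j, (\sum_f g j f)%:E = rho (S `&` c @^-1` [set j])) ->
  (forall i k, (\sum_j \sum_(f : JN | f i == k) g j f)%:E = mu i (Y `&` c @^-1` [set k])) ->
  exists (T : 'I_N -> V -> V) (ck : V -> J * JN), [/\ transport_maps S Y rho mu T,
    forall B : set (J * JN), measurable (ck @^-1` B),
    forall p, rho (S `&` ck @^-1` [set p]) = (g p.1 p.2)%:E &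
    {ae rho, forall x, S x -> c x = (ck x).1 /\ forall i, c (T i x) = (ck x).2 i}].
Proof.
move=> g0 g_rho g_mu.
have mA j : measurable (S `&` c @^-1` [set j]) by exact: measurableI.
(* A measurable choice of the cells of the other points: it has the conditional law
   prescribed by [g] on each cell of the first variable. *)
have /choice[k kP] j : exists k : V -> JN, (forall B : set JN, measurable (k @^-1` B)) /\
    forall f, rho (S `&` c @^-1` [set j] `&` k @^-1` [set f]) = (g j f)%:E.
  apply: (@transport_finite _ _ rho (S `&` c @^-1` [set j]) K _ [ffun=> j0]) => //.
  by move=> x [Sx _]; exact: SK.
pose kk x := k (c x) x.
pose ck x := (c x, kk x).
have mck (B : set (J * JN)) : measurable (ck @^-1` B).
  rewrite (_ : _ @^-1` _ = \bigcup_(j in setT) (c @^-1` [set j] `&` k j @^-1` [set f | B (j, f)])).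
    apply: fin_bigcup_measurable; first exact: finite_finset.
    by move=> j _; apply: measurableI => //; case: (kP j).
  apply/seteqP; split => [x Bx|x [j _ [/= cx Bx]]]; first by exists (c x).
  by rewrite /ck /kk /preimage/= cx.
have mkk i (B : set J) : measurable ((fun x => kk x i) @^-1` B).
  by have := mck [set p : J * JN | B (p.2 i)].
have ckE p : rho (S `&` ck @^-1` [set p]) = (g p.1 p.2)%:E.
  have [_ <-] := kP p.1; congr (rho _).
  apply/seteqP; split => x.
    by move=> [Sx]; rewrite /preimage/= => <-.
  by move=> [[Sx cx] kx]; split => //; rewrite /ck /kk /preimage/= cx kx; case: p {cx kx}.
pose P i l := S `&` (fun x => kk x i) @^-1` [set l].
have mP i l : measurable (P i l) by exact: measurableI.
have rhoP i l : rho (P i l) = mu i (Y `&` c @^-1` [set l]).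
  rewrite -g_mu (measure_cells rho mck (mP i l)).
  transitivity (\sum_(p : J * JN) (if p.2 i == l then g p.1 p.2 else 0)%:E)%E.
    apply: eq_bigr => p _; case: eqP => [pil|pil].
      rewrite -ckE; congr (rho _); apply/seteqP; split => x; first by move=> [[]].
      by move=> [Sx xp]; split=> //; split=> //; rewrite /= -pil -xp.
    rewrite (_ : _ `&` _ = set0) ?measure0//; apply/seteqP; split => x //.
    by move=> [[_ xl] xp]; apply: pil; rewrite -xl -xp.
  rewrite sumEFin; congr EFin; rewrite -(pair_bigA _ (fun j (f : JN) => if f i == l then g j f else 0))/=.
  by apply: eq_bigr => j _; rewrite -big_mkcond.
pose W l := Y `&` c @^-1` [set l].
have mW l : measurable (W l) by exact: measurableI.
have /choice[y0 y0Y] (i : 'I_N) : exists y, Y y.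
  apply: contrapT => no; have := muY i; rewrite (_ : Y = set0) ?measure0.
    by move=> /esym/eqP; rewrite onee_eq0.
  by apply/seteqP; split => y // Yy; apply: no; exists y.
have /choice[t tP] (il : 'I_N * J) : exists t : V -> V, measurable_fun setT t /\
    forall B, measurable B -> rho (P il.1 il.2 `&` t @^-1` B) = mu il.1 (B `&` W il.2).
  case: il => i l /=.
  have [|||t [mt tE]] := @transport_exists R n rho (P i l)
      (measure_function_mrestr__canonical__measure_function_Measure (mu i) (mW l)) K dom (mP i l) K0.
  - by move=> x [Sx _]; exact: SK.
  - rewrite /= /mrestr (_ : _ `&` _ = set0) ?measure0//.
    apply/seteqP; split => x //= -[[j Kj] [Yx _]].
    by have := YK Yx j; rewrite leNgt Kj.
  - by rewrite /= /mrestr setTI rhoP.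
  by exists t.
pose t' i l x := if `[< W l (t (i, l) x) >] then t (i, l) x else y0 i.
have t'P i l := @transport_redirect rho (P i l) (W l)
  (measure_function_mrestr__canonical__measure_function_Measure (mu i) (mW l)) (t (i, l)) (y0 i)
  (mP i l) (mW l) (tP (i, l)).1.
have {}t'P i l : measurable_fun setT (t' i l) /\
    forall B, measurable B -> rho (P i l `&` t' i l @^-1` B) = mu i (B `&` W l).
  by apply: t'P; [rewrite /= /mrestr setICl measure0|exact: (tP (i, l)).2].
pose T i x := t' i (kk x i) x.
have mT i : measurable_fun setT (T i).
  by apply: (@measurable_fun_cases _ _ _ (fun x => kk x i) (t' i)); [exact: mkk|move=> l; exact: (t'P i l).1].
have TY i x : Y (T i x) by rewrite /T /t'; case: asboolP => [[]|].
exists T, ck; split => //.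
- move=> i; split => //; first exact: measurable_funS (mT i).
  move=> B mB.
  have mTB : measurable (T i @^-1` B) by rewrite -[X in measurable X]setTI; exact: mT.
  rewrite (measure_cells rho (mkk i) (measurableI _ _ mS mTB)).
  transitivity (\sum_l mu i (B `&` W l))%E.
    apply: eq_bigr => l _; rewrite -(t'P i l).2//; congr (rho _).
    by apply/seteqP; split => x [[Sx]] => [Bx xl|xl Bx]; split => //; rewrite /preimage/= /T in Bx xl *;
      [rewrite -xl|rewrite xl].
  transitivity (mu i (B `&` Y)).
    rewrite (measure_cells (mu i) mc (measurableI _ _ mB mY)); apply: eq_bigr => l _.
    by rewrite setIA.
  have mYC : mu i (~` Y) = 0%E by rewrite probability_setC// muY subee.
  rewrite [RHS](@measureDI _ _ _ (mu i) _ _ mB mY) [X in (X + _)%E](_ : _ = 0%E) ?add0e//.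
  apply/le_anti; rewrite measure_ge0 andbT -mYC; apply: le_measure; rewrite ?inE.
  + exact: measurableD.
  + exact: measurableC.
  + by move=> x [].
- have nb (il : 'I_N * J) : {ae rho, forall x, ~ (P il.1 il.2 `&` t' il.1 il.2 @^-1` (~` W il.2)) x}.
    have mb : measurable (P il.1 il.2 `&` t' il.1 il.2 @^-1` (~` W il.2)).
      apply: measurableI => //; rewrite -[X in measurable X]setTI.
      by apply: (t'P _ _).1 => //; exact: measurableC.
    exists (P il.1 il.2 `&` t' il.1 il.2 @^-1` (~` W il.2)); split => //.
      by rewrite (t'P _ _).2 ?setICl ?measure0//; exact: measurableC.
    by move=> x /= /contrapT.
  have := filter_forall (ae_filter_ringOfSetsType rho) nb.
  apply: filterS => x nbx Sx; split => // i.
  apply: contrapT => neq; apply: (nbx (i, kk x i)); split => //=.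
  by move=> [_ /= e]; apply: neq; rewrite /ck/= -e.
Qed.

End plan_realisation.

End NearOptimalMaps.

(** * Approximate duality for the problem restricted to maps *)

Section NearDuality.
Context (R : realType) (n N : nat).
Local Notation V := 'rV[R]_n.+1.

Lemma fine_prob (mu : probability V R) (A : set V) : measurable A ->
  (fine (mu A))%:E = mu A.
Proof. by move=> mA; rewrite fineK// fin_num_measure. Qed.

Lemma sum_cells (mu : probability V R) (A : set V) (J : finType) (c : V -> J) :
  measurable A -> mu A = 1%E -> (forall B : set J, measurable (c @^-1` B)) ->
  \sum_j fine (mu (A `&` c @^-1` [set j])) = 1.
Proof.
move=> mA muA mc; apply: EFin_inj; rewrite -sumEFin -muA (measure_cells mu mc mA).
by apply: eq_bigr => j _; rewrite fine_prob//; exact: measurableI.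
Qed.

Lemma measurable_row_in d (W : measurableType d) (D : set W) (f : W -> V) : measurable D ->
  (forall i, measurable_fun D (fun x => f x 0 i)) -> measurable_fun D f.
Proof.
move=> mD mf; pose g x : V := \row_i ((fun x => f x 0 i) \_ D) x.
have mg : measurable_fun setT g.
  apply: measurable_rowP => i; rewrite /g; under eq_fun do rewrite mxE.
  exact/(measurable_restrictT _ mD).
apply: (eq_measurable_fun g); last exact: measurable_funS mg.
by move=> x xD; apply/rowP => i; rewrite mxE patchE xD.
Qed.

Lemma measurable_bary (lambda : 'I_N.+1 -> R) (D : set V) (T : 'I_N -> V -> V) :
  measurable D -> (forall i, measurable_fun D (T i)) ->
  measurable_fun D (fun x => bary lambda x (T ^~ x)).
Proof.
move=> mD mT; apply: measurable_row_in => // k; rewrite /bary.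
under eq_fun do rewrite mxE summxE mxE.
apply: measurable_funD.
  apply: measurable_funM; first exact: measurable_cst.
  exact: measurable_funS (@measurable_coord R n.+1 k).
apply: measurable_sum => i; under eq_fun do rewrite mxE.
apply: measurable_funM; first exact: measurable_cst.
exact: (measurableT_comp (@measurable_coord R n.+1 k) (mT i)).
Qed.

(** The space is cut in cells of size [e], and discrete plans and potentials are
    computed for their centres. The inf-convolutions of the potentials are feasible
    everywhere because the gain is Lipschitz with constant [L * lambda i] in the
    [i]-th variable. Moving points to the centres of their cells costs [L * e] in
    the potentials and [L * e] in the gain. *)
Lemma near_duality (rho : probability V R) (mu : 'I_N -> probability V R) (S Y : set V)
    (K L : R) (lambda : 'I_N.+1 -> R) (G : V -> R) (delta : R) :
  rho `<< lebesgue_rV R n.+1 -> measurable S -> measurable Y ->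
  rho S = 1%E -> (forall i, mu i Y = 1%E) -> 0 <= K ->
  (forall x, S x -> forall i, `|x 0 i| <= K) ->
  (forall x, Y x -> forall i, `|x 0 i| <= K) ->
  (forall i, 0 <= lambda i) -> \sum_i lambda i = 1 -> 0 <= L ->
  (forall z w, G z - G w <= L * enorm (z - w)) -> 0 < delta ->
  exists T (u0 : V -> R) (u : 'I_N -> V -> R), [/\ transport_maps S Y rho mu T,
    forall x y, u0 x - u0 y <= lambda ord0 * L * enorm (x - y),
    forall i x y, u i x - u i y <= lambda (lift ord0 i) * L * enorm (x - y),
    forall x (y : 'I_N -> V), G (bary lambda x y) <= u0 x + \sum_i u i (y i) &
    (\int[rho]_(x in S) (u0 x + \sum_i u i (T i x) - G (bary lambda x (T ^~ x)))%:E <=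
     delta%:E)%E].
Proof.
move=> dom mS mY rhoS muY K0 SK YK l0 l1 L0 GL d0.
pose e := delta / (4 * (L + 1)).
have L1 : 0 < L + 1 by lra.
have e0 : 0 < e by rewrite divr_gt0// mulr_gt0.
have eL : 2 * L * e <= delta / 2.
  have -> : delta / 2 = 2 * (L + 1) * e by rewrite /e; field; rewrite gt_eqF.
  by rewrite ler_pM2r// ler_pM2l// lerDl.
have [J [z [c [mc cz]]]] := @finite_cells R n.+1 K e e0 K0.
pose j0 := c 0.
have mSc j : measurable (S `&` c @^-1` [set j]) by exact: measurableI.
have mYc j : measurable (Y `&` c @^-1` [set j]) by exact: measurableI.
have [g [g0 gm0 gm gd]] := @plan_duality R N J
  (fun j => fine (rho (S `&` c @^-1` [set j])))
  (fun i j => fine (mu i (Y `&` c @^-1` [set j])))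
  (fun j f => G (bary lambda (z j) (z \o f)))
  (fun j => fine_ge0 (measure_ge0 _ _)) (sum_cells mS rhoS mc)
  (fun i j => fine_ge0 (measure_ge0 _ _)) (fun i => sum_cells mY (muY i) mc).
have [||T [ck [TP mck ckE Tck]]] := plan_realised_by_maps j0 dom mS mY muY K0 SK YK mc g0.
- by move=> j; rewrite gm0 fine_prob.
- by move=> i k; rewrite gm fine_prob.
have d2 : 0 < delta / 2 by rewrite divr_gt0.
have [U0 [U [Uf Ud]]] := gd _ d2.
have lL i : 0 <= lambda i * L by exact: mulr_ge0.
have [u0 [u0L u0le u0at]] := inf_convolution j0 z U0 (lL ord0).
have /choice[u uP] i := inf_convolution j0 z (U i) (lL (lift ord0 i)).
have feas x (y : 'I_N -> V) : G (bary lambda x y) <= u0 x + \sum_i u i (y i).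
  have [j ->] := u0at x.
  have /choice[f fP] i : exists k, u i (y i) = U i k + lambda (lift ord0 i) * L * enorm (y i - z k).
    by have [_ _ /(_ (y i))] := uP i.
  rewrite (eq_bigr _ (fun i _ => fP i)) big_split/=.
  pose y' := z \o [ffun i => f i].
  have h : G (bary lambda (z j) y') <= U0 j + \sum_i U i (f i).
    have := Uf j [ffun i => f i]; rewrite (eq_bigr (fun i => U i (f i)))// => i _.
    by rewrite ffunE.
  have := GL (bary lambda x y) (bary lambda (z j) y').
  have := bary_lipschitz x (z j) y y' l0.
  move=> /(ler_wpM2l L0) h1 h2; have := le_trans h2 h1.
  rewrite mulrDr mulr_sumr => {h1}h2.
  have -> : \sum_i lambda (lift ord0 i) * L * enorm (y i - z (f i)) =
     \sum_i L * (lambda (lift ord0 i) * enorm (y i - y' i)).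
    by apply: eq_bigr => i _; rewrite /y'/= ffunE; ring.
  by move: h h2; rewrite (mulrAC (lambda ord0)) (mulrC _ L); lra.
have mG : measurable_fun setT G by exact: lipschitz_measurable GL.
have TY i x : S x -> Y (T i x) by case: (TP i) => _ h _; exact: h.
have mT i : measurable_fun S (T i) by case: (TP i).
have mu0 : measurable_fun setT u0 := lipschitz_measurable u0L.
have mu_ i : measurable_fun setT (u i) by have [h _ _] := uP i; exact: lipschitz_measurable h.
exists T, u0, u; split => //; first by move=> i x y; have [h _ _] := uP i; exact: h.
pose H (p : J * {ffun 'I_N -> J}) :=
  U0 p.1 + \sum_i U i (p.2 i) - G (bary lambda (z p.1) (z \o p.2)) + 2 * L * e.
have H0 p : 0 <= H p.
  apply: addr_ge0; first by rewrite subr_ge0; exact: Uf.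
  by rewrite mulr_ge0 ?(ltW e0)// mulr_ge0.
apply: (@le_trans _ _ (\int[rho]_(x in S) (H (ck x))%:E)%E); last first.
  rewrite (integral_cells rho mS mck H0).
  under eq_bigr do rewrite ckE -EFinM.
  rewrite sumEFin lee_fin.
  rewrite -(pair_bigA _ (fun j f => H (j, f) * g j f))/= /H/=.
  under eq_bigr => j _ do (under eq_bigr => f _ do rewrite mulrDl mulrC;
    rewrite big_split/= -mulr_sumr).
  rewrite big_split/= -mulr_sumr.
  under [X in _ + _ * X]eq_bigr do rewrite gm0.
  rewrite (sum_cells mS rhoS mc) mulr1; lra.
have mgap : measurable_fun S (fun x => u0 x + \sum_i u i (T i x) - G (bary lambda x (T ^~ x))).
  apply: measurable_funB; last exact: (measurableT_comp mG (measurable_bary lambda mS mT)).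
  apply: measurable_funD; first exact: measurable_funS mu0.
  by apply: measurable_sum => i; exact: (measurableT_comp (mu_ i) (mT i)).
apply: ae_ge0_le_integral => //.
- by move=> x _; rewrite lee_fin subr_ge0.
- exact/measurable_EFinP.
- by move=> x _; rewrite lee_fin.
- apply/measurable_EFinP => _ B mB; apply: measurableI => //.
  exact: (mck (H @^-1` B)).
apply: filterS Tck => x h Sx; have [h1 h2] := h Sx; rewrite lee_fin.
have cx : enorm (x - z (ck x).1) <= e by rewrite -h1; apply: cz; exact: SK.
have cT i : enorm (T i x - z ((ck x).2 i)) <= e by rewrite -h2; apply: cz; apply: YK; exact: TY.
set p := ck x in cx cT *.
have a1 : u0 x <= U0 p.1 + L * (lambda ord0 * e).
  apply: le_trans (u0le x p.1) _; rewrite lerD2l mulrA (mulrC L).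
  exact: ler_wpM2l.
have a2 : \sum_i u i (T i x) <= \sum_i U i (p.2 i) + L * \sum_i lambda (lift ord0 i) * e.
  rewrite mulr_sumr -big_split/=; apply: ler_sum => i _.
  have [_ /(_ (T i x) (p.2 i)) h' _] := uP i; apply: le_trans h' _.
  by rewrite lerD2l mulrA (mulrC L); exact: ler_wpM2l.
have a3 : G (bary lambda (z p.1) (z \o p.2)) - G (bary lambda x (T ^~ x)) <=
    L * (lambda ord0 * e + \sum_i lambda (lift ord0 i) * e).
  apply: le_trans (GL _ _) _; rewrite ler_wpM2l// enormC.
  apply: le_trans (bary_lipschitz _ _ _ _ l0) _.
  rewrite lerD ?ler_wpM2l//; apply: ler_sum => i _; exact: ler_wpM2l.
have tot : lambda ord0 * e + \sum_i lambda (lift ord0 i) * e = e.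
  by rewrite -mulr_suml -mulrDl -[X in _ = X]mul1r -l1 big_ord_recl.
rewrite /H; move: a1 a2 a3; rewrite tot; move: tot.
set s := \sum_i lambda (lift ord0 i) * e; set q := lambda ord0 * e => tot a1 a2 a3.
have : L * q + L * s = L * e by rewrite -mulrDr tot.
lra.
Qed.

End NearDuality.

(** * Transported integrals and the Wasserstein distance *)

Section BoundedIntegrals.
Context d (W : measurableType d) (R : realType) (P : probability W R) (S : set W).
Hypothesis mS : measurable S.
Implicit Types h g : W -> R.

Definition bmeas h := measurable_fun S h /\ exists K : R, forall x, S x -> `|h x| <= K.

Lemma bmeasD h g : bmeas h -> bmeas g -> bmeas (fun x => h x + g x).
Proof.
move=> [mh [K hK]] [mg [K' gK]]; split; first exact: measurable_funD.
by exists (K + K') => x Sx; rewrite (le_trans (ler_normD _ _))// lerD ?hK ?gK.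
Qed.

Lemma bmeasN h : bmeas h -> bmeas (fun x => - h x).
Proof.
move=> [mh [K hK]]; split; last by exists K => x Sx; rewrite normrN hK.
exact: (measurableT_comp (@oppr_measurable R _) mh).
Qed.

Lemma bmeasB h g : bmeas h -> bmeas g -> bmeas (fun x => h x - g x).
Proof. by move=> bh /bmeasN; exact: bmeasD. Qed.

Lemma bmeas_cst c : bmeas (fun=> c).
Proof. by split; [exact: measurable_cst|exists `|c|]. Qed.

Lemma bmeas_sum (I : Type) (s : seq I) (h : I -> W -> R) :
  (forall i, bmeas (h i)) -> bmeas (fun x => \sum_(i <- s) h i x).
Proof.
move=> bh; elim: s => [|i s IH].
  by under eq_fun do rewrite big_nil; exact: bmeas_cst.
by under eq_fun do rewrite big_cons; exact: bmeasD.
Qed.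

Lemma bmeas_integrable h : bmeas h -> P.-integrable S (EFin \o h).
Proof.
move=> [mh [K hK]]; apply: (@le_integrable _ _ _ _ _ mS _ (cst K%:E)) => //.
- exact/measurable_EFinP.
- by move=> x Sx /=; rewrite lee_fin (le_trans (hK x Sx))// ler_norm.
- exact: finite_measure_integrable_cst.
Qed.

Local Notation I := (Rintegral P S).

Lemma IntD h g : bmeas h -> bmeas g -> I (fun x => h x + g x) = I h + I g.
Proof. by move=> /bmeas_integrable ih /bmeas_integrable ig; exact: RintegralD. Qed.

Lemma IntB h g : bmeas h -> bmeas g -> I (fun x => h x - g x) = I h - I g.
Proof. by move=> /bmeas_integrable ih /bmeas_integrable ig; exact: RintegralB. Qed.

Lemma IntN h : bmeas h -> I (fun x => - h x) = - I h.
Proof.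
move=> bh; have := IntB (bmeas_cst 0) bh; rewrite Rintegral_cst// mul0r sub0r => <-.
by apply: eq_Rintegral => x _; rewrite sub0r.
Qed.

Lemma Int_sum (J : Type) (s : seq J) (h : J -> W -> R) : (forall i, bmeas (h i)) ->
  I (fun x => \sum_(i <- s) h i x) = \sum_(i <- s) I (h i).
Proof.
move=> bh; elim: s => [|i s IH].
  under (eq_Rintegral) do rewrite big_nil.
  by rewrite big_nil Rintegral_cst// mul0r.
rewrite big_cons -IH -IntD//; last exact: bmeas_sum.
by apply: eq_Rintegral => x _; rewrite big_cons.
Qed.

Lemma IntE h : bmeas h -> (I h)%:E = (\int[P]_(x in S) (h x)%:E)%E.
Proof.
move=> bh; rewrite fineK//; apply: integral_fune_fin_num => //.
exact: bmeas_integrable.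
Qed.

Lemma bmeas_lipschitz_comp n (f : 'rV[R]_n -> R) (a : R) (T : W -> 'rV[R]_n) (z : 'rV[R]_n) (D : R) :
  0 <= a -> (forall x y, f x - f y <= a * enorm (x - y)) -> measurable_fun S T ->
  (forall x, S x -> enorm (T x - z) <= D) -> bmeas (fun x => f (T x)).
Proof.
move=> a0 fa mT TD; split.
  exact: (measurableT_comp (lipschitz_measurable fa) mT).
exists (`|f z| + a * D) => x Sx.
have -> : f (T x) = f z + (f (T x) - f z) by rewrite addrC subrK.
rewrite (le_trans (ler_normD _ _))// lerD2l.
apply: (@le_trans _ _ (a * enorm (T x - z))); last by rewrite ler_wpM2l// TD.
by rewrite ler_norml lerNl opprB fa enormC fa.
Qed.

End BoundedIntegrals.

Section PushforwardW1.
Context (R : realType) (n : nat).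
Local Notation V := 'rV[R]_n.

Lemma pushforward_integral (rho mu : probability V R) (S : set V) (T : V -> V)
    (phi : V -> R) (K : R) :
  measurable S -> rho S = 1%E -> measurable_fun S T ->
  (forall A, measurable A -> rho (S `&` T @^-1` A) = mu A) ->
  measurable_fun setT phi -> (forall x, `|phi x| <= K) ->
  \int[rho]_(x in S) phi (T x) = \int[mu]_x phi x.
Proof.
move=> mS rhoS mT TE mphi phiK.
have rhoSC : rho (~` S) = 0%E by rewrite probability_setC// rhoS subee.
pose T' := T \_ S.
have mT' : measurable_fun setT T' by exact/(measurable_restrictT _ mS).
have bT : bmeas setT (fun x => phi (T' x)).
  by split; [exact: (measurableT_comp mphi mT')|exists K => x _].
pose nu : {measure set V -> \bar R} :=
  measure_function_pushforward__canonical__measure_function_Measure rho mT'.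
have nuE A : measurable A -> nu A = mu A.
  move=> mA; rewrite -TE//= /pushforward.
  have mTA : measurable (T' @^-1` A) by rewrite -[X in measurable X]setTI; exact (mT' measurableT A mA).
  rewrite (@measureDI _ _ _ rho _ _ mTA mS) [X in (X + _)%E](_ : _ = 0%E) ?add0e.
    congr (rho _); apply/seteqP; split => x.
      by move=> [Tx Sx]; split => //; move: Tx; rewrite /T' /= patchE mem_set.
    by move=> [Sx Tx]; split => //; rewrite /T' /= patchE mem_set.
  apply/le_anti; rewrite measure_ge0 andbT -rhoSC; apply: le_measure; rewrite ?inE.
  - exact: measurableD.
  - exact: measurableC.
  - by move=> x [].
rewrite /Rintegral; congr fine.
rewrite -(@eq_measure_integral _ _ _ setT mu nu) => [|A mA _]; last exact: nuE.
rewrite integral_pushforward//=; last 2 first.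
- exact/measurable_EFinP.
- by rewrite preimage_setT; exact: bmeas_integrable.
rewrite preimage_setT [RHS](@negligible_integral _ _ _ rho setT (~` S))//; last 2 first.
- exact: measurableC.
- exact: (bmeas_integrable rho measurableT bT).
rewrite setTD setCK; apply: eq_integral => x xS /=.
by rewrite /T' patchE xS.
Qed.

(** Test functions are bounded on [Y] only; clipping keeps their values there and
    their Lipschitz constant. *)
Definition clip (K t : R) : R := Num.max (- K) (Num.min t K).

Lemma clip_bound K t : 0 <= K -> `|clip K t| <= K.
Proof.
move=> K0; rewrite /clip ler_norml le_max lexx/= ge_max ge_min lexx orbT andbT.
by rewrite (le_trans _ K0)// oppr_le0.
Qed.

Lemma clip_id K t : `|t| <= K -> clip K t = t.
Proof.
rewrite ler_norml /clip => /andP[h1 h2].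
by rewrite (min_idPl h2); apply/max_idPr.
Qed.

Lemma clip_lip K s t c : 0 <= K -> 0 <= c -> s - t <= c -> clip K s - clip K t <= c.
Proof.
move=> K0 c0; rewrite /clip.
by case: (leP s K) => h1; case: (leP t K) => h2; rewrite !maxElt; do 2 case: ltP => ?; lra.
Qed.

Lemma measurable_clip K (phi : V -> R) : measurable_fun setT phi ->
  measurable_fun setT (fun x => clip K (phi x)).
Proof.
move=> mphi; apply: measurable_maxr; first exact: measurable_cst.
by apply: measurable_minr => //; exact: measurable_cst.
Qed.

Lemma W1_dual (mu mu' : probability V R) (phi : V -> R) (a K : R) : 0 < a ->
  (forall x y, phi x - phi y <= a * enorm (x - y)) -> (forall x, `|phi x| <= K) ->
  ((\int[mu]_x phi x - \int[mu']_x phi x)%:E <= a%:E * W1 mu mu')%E.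
Proof.
move=> a0 philip phiK.
have mphi := lipschitz_measurable philip.
rewrite -lee_pdivrMl//; apply: le_ereal_inf_tmp => _ [pi [pi1 pi2] <-].
rewrite lee_pdivrMl//.
have b1 : bmeas setT (fun z : V * V => phi z.1).
  by split; [exact: (measurableT_comp mphi measurable_fst)|exists K => z _].
have b2 : bmeas setT (fun z : V * V => phi z.2).
  by split; [exact: (measurableT_comp mphi measurable_snd)|exists K => z _].
have mb : bmeas setT phi by split => //; exists K => x _.
have e1 : \int[mu]_x phi x = \int[pi]_z phi z.1.
  pose nu : {measure set V -> \bar R} :=
    measure_function_pushforward__canonical__measure_function_Measure pi (@measurable_fst _ _ V V).
  rewrite /Rintegral; congr fine.
  rewrite -(@eq_measure_integral _ _ _ setT mu nu) => [|A mA _]; last first.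
    rewrite -[RHS](pi1 A mA) /= /pushforward; congr (pi _).
    by apply/seteqP; split => z //= [].
  rewrite integral_pushforward//=; last 2 first.
  - exact/measurable_EFinP.
  - by rewrite ?preimage_setT; exact: (bmeas_integrable pi measurableT b1).
have e2 : \int[mu']_x phi x = \int[pi]_z phi z.2.
  pose nu : {measure set V -> \bar R} :=
    measure_function_pushforward__canonical__measure_function_Measure pi (@measurable_snd _ _ V V).
  rewrite /Rintegral; congr fine.
  rewrite -(@eq_measure_integral _ _ _ setT mu' nu) => [|A mA _]; last first.
    rewrite -[RHS](pi2 A mA) /= /pushforward; congr (pi _).
    by apply/seteqP; split => z //= [].
  rewrite integral_pushforward//=; last 2 first.
  - exact/measurable_EFinP.
  - by rewrite ?preimage_setT; exact: (bmeas_integrable pi measurableT b2).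
rewrite e1 e2 -(IntB pi measurableT b1 b2) (IntE pi measurableT (bmeasB b1 b2)).
have mdist : measurable_fun setT (fun z : V * V => enorm (z.1 - z.2)).
  apply: (measurableT_comp (@measurable_enorm R n)).
  apply: measurable_rowP => i; under eq_fun do rewrite !mxE.
  apply: measurable_funB; exact: (measurableT_comp (@measurable_coord R n i)).
rewrite -ge0_integralZl_EFin//; last 3 first.
- by move=> z _; rewrite lee_fin enorm_ge0.
- exact/measurable_EFinP.
- exact: ltW.
have [->|fin] := eqVneq (\int[pi]_z (a%:E * (enorm (z.1 - z.2))%:E))%E +oo%E; first by rewrite leey.
apply: le_integral => //.
- exact: (bmeas_integrable pi measurableT (bmeasB b1 b2)).
- apply/integrableP; split.
    by apply: emeasurable_funM; [exact: measurable_cst|exact/measurable_EFinP].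
  rewrite ltey; move: fin; congr (_ != _); apply: eq_integral => z _.
  by rewrite gee0_abs// mule_ge0// lee_fin ?enorm_ge0// ltW.
- by move=> z _; rewrite -EFinM lee_fin philip.
Qed.

End PushforwardW1.

(** * Optimality certificates and their stability *)

Section CostRewriting.
Context (R : realType) (n N : nat).
Local Notation V := 'rV[R]_n.+1.
Implicit Types (lambda : 'I_N.+1 -> R) (x : 'I_N.+1 -> V).

(** The infimum is attained at the mean. *)
Lemma inf_quadratic lambda x : (forall i, 0 < lambda i) -> \sum_i lambda i = 1 ->
  inf [set \sum_i lambda i / 2 * enorm (x i - y) ^+ 2 | y in [set: V]] =
  \sum_i lambda i * (dot (x i) (x i) / 2) -
  dot (\sum_i lambda i *: x i) (\sum_i lambda i *: x i) / 2.
Proof.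
move=> l0 l1; set b := \sum_i lambda i *: x i.
have E y : \sum_i lambda i / 2 * enorm (x i - y) ^+ 2 =
    \sum_i lambda i * (dot (x i) (x i) / 2) - dot b b / 2 + dot (b - y) (b - y) / 2.
  have -> : dot (b - y) (b - y) = dot b b - 2 * dot y b + dot y y.
    by rewrite dotBr !dotBl (dotC b y); ring.
  have -> : dot y b = \sum_i lambda i * dot y (x i).
    by rewrite /b dot_sumr; apply: eq_bigr => i _; rewrite dotZr.
  transitivity (\sum_i (lambda i * (dot (x i) (x i) / 2) - lambda i * dot y (x i) + lambda i * (dot y y / 2))).
    by apply: eq_bigr => i _; rewrite sqr_enorm dotBr !dotBl (dotC (x i) y); field.
  by rewrite big_split/= sumrB -mulr_suml l1; field.
apply/le_anti/andP; split.
  apply: ge_inf; last by exists b => //; rewrite E subrr (_ : dot 0 0 = 0) ?mul0r ?addr0 // -sqr_enorm enorm0 expr0n.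
  exists 0 => _ [y _ <-]; apply: sumr_ge0 => i _.
  by rewrite mulr_ge0 ?sqr_ge0// divr_ge0// ltW.
apply: lb_le_inf; first by exists (\sum_i lambda i / 2 * enorm (x i - b) ^+ 2); exists b.
by move=> _ [y _ <-]; rewrite E lerDl divr_ge0// dotvv_ge0.
Qed.

Lemma baryE lambda (v : V) (T : 'I_N -> V -> V) :
  \sum_i lambda i *: maps_point T v i = bary lambda v (T ^~ v).
Proof.
rewrite big_ord_recl /bary /maps_point unlift_none; congr (_ + _).
by apply: eq_bigr => i _; rewrite liftK.
Qed.

Definition marginal_cost (l : R) (q v : V) : R := l * (dot v v / 2 - dot q v).

Lemma costE lambda (S Y : set V) (F G : V -> R) (q : V) (T : 'I_N -> V -> V) :
  (forall i, 0 < lambda i) -> \sum_i lambda i = 1 ->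
  (forall z, conv_hull (S `|` Y) z -> F z = dot z z / 2 - G z - dot q z) ->
  forall v, S v -> (forall i, Y (T i v)) ->
  cost lambda F (maps_point T v) =
  marginal_cost (lambda ord0) q v + \sum_i marginal_cost (lambda (lift ord0 i)) q (T i v)
  - G (bary lambda v (T ^~ v)).
Proof.
move=> l0 l1 FG v Sv YT; rewrite /cost inf_quadratic// baryE.
rewrite FG; last first.
  rewrite -baryE; apply: conv_hull_sum => // i.
  by apply: sub_conv_hull; rewrite /maps_point; case: unlift => [j|]; [right|left].
have -> : dot q (bary lambda v (T ^~ v)) = lambda ord0 * dot q v + \sum_i lambda (lift ord0 i) * dot q (T i v).
  by rewrite /bary dotDr dotZr dot_sumr; congr (_ + _); apply: eq_bigr => i _; rewrite dotZr.
rewrite big_ord_recl /maps_point unlift_none.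
under eq_bigr do rewrite liftK.
rewrite /marginal_cost; under [in RHS]eq_bigr do rewrite mulrBr.
by rewrite sumrB; ring.
Qed.

End CostRewriting.

Section DualCertificates.
Context (R : realType) (n N : nat).
Local Notation V := 'rV[R]_n.+1.
Context (rho : probability V R) (S Y : set V) (lambda : 'I_N.+1 -> R) (x0 : V) (D L : R).
Context (F G : V -> R) (q : V).
Hypotheses (dom : rho `<< lebesgue_rV R n.+1) (mS : measurable S) (mY : measurable Y).
Hypotheses (rhoS : rho S = 1%E) (l0 : forall i, 0 < lambda i) (l1 : \sum_i lambda i = 1).
Hypotheses (D0 : 0 <= D) (L0 : 0 < L) (SYD : forall x, (S `|` Y) x -> enorm (x - x0) <= D).
Hypothesis GL : forall z w, G z - G w <= L * enorm (z - w).
Hypothesis FG : forall z, conv_hull (S `|` Y) z -> F z = dot z z / 2 - G z - dot q z.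
Implicit Types (mu : 'I_N -> probability V R) (T : 'I_N -> V -> V).

Local Notation Int := (Rintegral rho S).
Local Notation lam i := (lambda (lift ord0 i)).
Local Notation gain T := (fun x => G (bary lambda x (T ^~ x))).

Let l0' i : 0 <= lambda i. Proof. exact: ltW. Qed.

Let bound x : (S `|` Y) x -> enorm x <= enorm x0 + D.
Proof.
move=> /SYD; rewrite -lerBlDl => /(le_trans _); apply.
by rewrite lerBlDr; have := ler_enormD (x - x0) x0; rewrite subrK.
Qed.

Lemma measurable_marginal_cost l : measurable_fun setT (marginal_cost l q).
Proof.
apply: measurable_funM; first exact: measurable_cst.
apply: measurable_funB.
  apply: measurable_funM; last exact: measurable_cst.
  under eq_fun do rewrite -sqr_enorm.
  by apply: measurable_funX; exact: measurable_enorm.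
apply: (@lipschitz_measurable _ _ _ (enorm q)) => x y.
by rewrite -dotBr dot_le.
Qed.

Lemma marginal_cost_bounded l : exists K, 0 <= K /\ forall x, (S `|` Y) x -> `|marginal_cost l q x| <= K.
Proof.
pose r := enorm x0 + D.
have r0 : 0 <= r by rewrite addr_ge0 ?enorm_ge0.
exists (`|l| * (r ^+ 2 / 2 + enorm q * r)); split.
  by rewrite mulr_ge0// addr_ge0 ?mulr_ge0 ?sqr_ge0 ?enorm_ge0 ?divr_ge0.
move=> x /bound xr; rewrite normrM ler_wpM2l// (le_trans (ler_normB _ _))// lerD//.
  rewrite -sqr_enorm ger0_norm ?divr_ge0 ?sqr_ge0// ler_pM2r// ler_sqr ?nnegrE ?enorm_ge0//.
rewrite (@le_trans _ _ (enorm q * enorm x))//; last by rewrite ler_wpM2l ?enorm_ge0.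
by rewrite ler_norml dot_le andbT lerNl -dotNr (le_trans (dot_le _ _))// enormN.
Qed.

Section transport.
Context mu T (TP : transport_maps S Y rho mu T).

Lemma transport_measurable i : measurable_fun S (T i). Proof. by case: (TP i). Qed.
Lemma transport_in i x : S x -> Y (T i x). Proof. by case: (TP i) => _ h _; exact: h. Qed.

Lemma bmeas_transport i (phi : V -> R) (K : R) : measurable_fun setT phi ->
  (forall y, Y y -> `|phi y| <= K) -> bmeas S (fun x => phi (T i x)).
Proof.
move=> mphi phiK; split; first exact: (measurableT_comp mphi (transport_measurable i)).
by exists K => x Sx; apply: phiK; exact: transport_in.
Qed.

Lemma int_transport i (phi : V -> R) (K : R) : 0 <= K -> measurable_fun setT phi ->
  (forall y, Y y -> `|phi y| <= K) ->
  Int (fun x => phi (T i x)) = \int[mu i]_x clip K (phi x).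
Proof.
move=> K0 mphi phiK; case: (TP i) => mT TY TE.
rewrite -(pushforward_integral mS rhoS mT TE (measurable_clip K mphi) (fun x => clip_bound _ K0)).
by apply: eq_Rintegral => x; rewrite inE => Sx; rewrite clip_id//; apply: phiK; exact: TY.
Qed.

Lemma bmeas_gain : bmeas S (gain T).
Proof.
split.
  apply: (measurableT_comp (lipschitz_measurable GL)).
  apply: measurable_bary => // i; exact: transport_measurable.
exists (`|G x0| + L * D) => x Sx.
set b := bary _ _ _.
have bD : enorm (b - x0) <= D.
  apply: (@conv_hull_eball _ _ (S `|` Y)) => //.
  rewrite /b -baryE; apply: conv_hull_sum => // i.
  apply: sub_conv_hull; rewrite /maps_point; case: unlift => [j|]; last by left.
  by right; exact: transport_in.
have -> : G b = G x0 + (G b - G x0) by rewrite addrC subrK.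
rewrite (le_trans (ler_normD _ _))// lerD2l.
apply: (@le_trans _ _ (L * enorm (b - x0))); last by rewrite ler_wpM2l// ltW.
by rewrite ler_norml lerNl opprB GL enormC GL.
Qed.

Lemma bmeas_lip_transport i (phi : V -> R) (a : R) : 0 <= a ->
  (forall x y, phi x - phi y <= a * enorm (x - y)) -> bmeas S (fun x => phi (T i x)).
Proof.
move=> a0 pl; apply: (@bmeas_lipschitz_comp _ _ _ _ _ phi a (T i) x0 D) => //.
  exact: transport_measurable.
by move=> x Sx; apply: SYD; right; exact: transport_in.
Qed.

End transport.

Lemma bmeas_lip (phi : V -> R) (a : R) : 0 <= a ->
  (forall x y, phi x - phi y <= a * enorm (x - y)) -> bmeas S phi.
Proof.
move=> a0 pl; apply: (@bmeas_lipschitz_comp _ _ _ _ _ phi a id x0 D) => //.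
by move=> x Sx; apply: SYD; left.
Qed.

(** Apart from the gain, the cost only depends on the marginals: minimizing the cost
    is maximizing the gain. *)
Lemma transport_cost_gain mu T (TP : transport_maps S Y rho mu T) :
  transport_cost (cost lambda F) S rho T =
  (Int (marginal_cost (lambda ord0) q) +
   \sum_i Int (fun x => marginal_cost (lam i) q (T i x)) - Int (gain T))%:E.
Proof.
have [K0 [K00 K0P]] := marginal_cost_bounded (lambda ord0).
have b0 : bmeas S (marginal_cost (lambda ord0) q).
  split; first exact: measurable_funS (measurable_marginal_cost _).
  by exists K0 => x Sx; apply: K0P; left.
have bi i : bmeas S (fun x => marginal_cost (lam i) q (T i x)).
  have [K [K' KP]] := marginal_cost_bounded (lam i).
  apply: (bmeas_transport TP i (measurable_marginal_cost _)) => y Yy.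
  by apply: KP; right.
have bG := bmeas_gain TP.
have bs : bmeas S (fun x => \sum_i marginal_cost (lam i) q (T i x)) by exact: bmeas_sum.
rewrite -(Int_sum rho mS)// -(IntD rho mS)// -(IntB rho mS)//; last exact: bmeasD.
rewrite (IntE rho mS); last by apply: bmeasB => //; exact: bmeasD.
apply: eq_integral => x; rewrite inE => Sx; congr EFin.
by apply: (costE (S := S) (Y := Y)) => // i; exact: transport_in TP _ _ Sx.
Qed.

Lemma optimal_gain mu T T' : optimal_maps (cost lambda F) S Y rho mu T ->
  transport_maps S Y rho mu T' -> Int (gain T') <= Int (gain T).
Proof.
move=> [TP Topt] TP'; have := Topt T' TP'.
rewrite (transport_cost_gain TP) (transport_cost_gain TP') lee_fin.
have -> : \sum_i Int (fun x => marginal_cost (lam i) q (T i x)) =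
    \sum_i Int (fun x => marginal_cost (lam i) q (T' i x)).
  apply: eq_bigr => i _; have [K [K0 KP]] := marginal_cost_bounded (lam i).
  have KY y : Y y -> `|marginal_cost (lam i) q y| <= K by move=> Yy; apply: KP; right.
  by rewrite !(@int_transport mu _ _ _ _ K) //; exact: measurable_marginal_cost.
by rewrite lerD2l lerN2.
Qed.

(** Potentials for the problem of maximal gain, with the Lipschitz constant of the
    gain in each variable. *)
Record dual_feasible (u0 : V -> R) (u : 'I_N -> V -> R) : Prop := DualFeasible {
  df_lip0 : forall x y, u0 x - u0 y <= lambda ord0 * L * enorm (x - y);
  df_lip : forall i x y, u i x - u i y <= lam i * L * enorm (x - y);
  df_feas : forall x (y : 'I_N -> V), G (bary lambda x y) <= u0 x + \sum_i u i (y i) }.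

(** The slack of the dual constraint at the points selected by [T]: its integral is
    the duality gap, so it measures how far [T] is from being optimal. *)
Definition gap u0 u T (x : V) : R := u0 x + \sum_i u i (T i x) - G (bary lambda x (T ^~ x)).

Let lL i : 0 < lambda i * L. Proof. exact: mulr_gt0. Qed.

Lemma bmeas_gap mu T u0 u : transport_maps S Y rho mu T -> dual_feasible u0 u ->
  bmeas S (gap u0 u T).
Proof.
move=> TP [lip0 lip _]; apply: bmeasB; last exact: bmeas_gain TP.
apply: bmeasD; first exact: bmeas_lip (ltW (lL _)) lip0.
by apply: bmeas_sum => i; have := bmeas_lip_transport TP i (ltW (lL _)) (lip i).
Qed.

Lemma Int_gap mu T u0 u : transport_maps S Y rho mu T -> dual_feasible u0 u ->
  Int (gap u0 u T) = Int u0 + \sum_i Int (fun x => u i (T i x)) - Int (gain T).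
Proof.
move=> TP [lip0 lip _].
have b0 := bmeas_lip (ltW (lL _)) lip0.
have bi i := bmeas_lip_transport TP i (ltW (lL _)) (lip i).
have bs : bmeas S (fun x => \sum_i u i (T i x)) by exact: bmeas_sum.
rewrite (IntB rho mS); [|exact: bmeasD|exact: bmeas_gain TP].
by rewrite (IntD rho mS)// (Int_sum rho mS).
Qed.

Lemma gap_ge0 T u0 u x : dual_feasible u0 u -> 0 <= gap u0 u T x.
Proof. by move=> [_ _ f]; rewrite subr_ge0. Qed.

Lemma lip_bounded (phi : V -> R) a y : 0 <= a ->
  (forall x y, phi x - phi y <= a * enorm (x - y)) -> (S `|` Y) y ->
  `|phi y| <= `|phi x0| + a * D.
Proof.
move=> a0 pl /SYD yD; have -> : phi y = phi x0 + (phi y - phi x0) by rewrite addrC subrK.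
rewrite (le_trans (ler_normD _ _))// lerD2l.
apply: (@le_trans _ _ (a * enorm (y - x0))); last by rewrite ler_wpM2l.
by rewrite ler_norml lerNl opprB pl enormC pl.
Qed.

(** The easy half of the Kantorovich-Rubinstein duality, on the side of [rho]. *)
Lemma W1_transport mu mu' T T' i (phi : V -> R) a : 0 < a ->
  transport_maps S Y rho mu T -> transport_maps S Y rho mu' T' ->
  (forall x y, phi x - phi y <= a * enorm (x - y)) ->
  ((Int (fun x => phi (T i x)) - Int (fun x => phi (T' i x)))%:E <= a%:E * W1 (mu i) (mu' i))%E.
Proof.
move=> a0 TP TP' pl; pose K := `|phi x0| + a * D.
have K0 : 0 <= K by rewrite addr_ge0// mulr_ge0// ltW.
have mphi := lipschitz_measurable pl.
have pK y : Y y -> `|phi y| <= K by move=> Yy; apply: (lip_bounded (ltW a0) pl); right.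
rewrite (int_transport TP i K0 mphi pK) (int_transport TP' i K0 mphi pK).
apply: (@W1_dual _ _ _ _ _ a K) => // [x y|x]; last exact: clip_bound.
by apply: clip_lip => //; rewrite mulr_ge0 ?enorm_ge0// ltW.
Qed.

(** An optimal [T] gains at least as much as the maps built by [near_duality], and
    the integrals of the potentials are the same for both. *)
Lemma optimal_certificate mu T delta : (forall i, mu i Y = 1%E) ->
  optimal_maps (cost lambda F) S Y rho mu T -> 0 < delta ->
  exists u0 u, dual_feasible u0 u /\ Int (gap u0 u T) <= delta.
Proof.
move=> muY opt d0; have TP := opt.1.
have K0 : 0 <= enorm x0 + D by rewrite addr_ge0 ?enorm_ge0.
have SK x : S x -> forall i, `|x 0 i| <= enorm x0 + D.
  by move=> Sx i; rewrite (le_trans (coord_le_enorm x i))// bound//; left.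
have YK x : Y x -> forall i, `|x 0 i| <= enorm x0 + D.
  by move=> Yx i; rewrite (le_trans (coord_le_enorm x i))// bound//; right.
have [T' [u0 [u [TP' lip0 lip feas gapd]]]] :=
  near_duality dom mS mY rhoS muY K0 SK YK l0' l1 (ltW L0) GL d0.
have df : dual_feasible u0 u by split.
exists u0, u; split=> //.
have : Int (gap u0 u T') <= delta.
  by rewrite -lee_fin (IntE rho mS)//; exact: bmeas_gap TP' df.
rewrite (Int_gap TP df) (Int_gap TP' df).
have -> : \sum_i Int (fun x => u i (T i x)) = \sum_i Int (fun x => u i (T' i x)).
  apply: eq_bigr => i _; pose K := `|u i x0| + lam i * L * D.
  have K'0 : 0 <= K by rewrite addr_ge0// mulr_ge0// ltW.
  have uK y : Y y -> `|u i y| <= K.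
    by move=> Yy; apply: (lip_bounded (ltW (lL _)) (lip i)); right.
  have mu_ := lipschitz_measurable (lip i).
  by rewrite (int_transport TP i K'0 mu_ uK) (int_transport TP' i K'0 mu_ uK).
by have := optimal_gain opt TP'; lra.
Qed.

(** Changing marginals moves the integrals of the potentials, of either problem, by
    at most [L * w]. With the potentials of the second problem this bounds the gain
    of [T] by that of [T']; with those of the first, it bounds the gap of [T']. *)
Lemma stability_of_certificate mu mu' T T' u0 u delta w :
  (forall i, mu' i Y = 1%E) ->
  optimal_maps (cost lambda F) S Y rho mu T -> optimal_maps (cost lambda F) S Y rho mu' T' ->
  (\sum_i (lam i)%:E * W1 (mu i) (mu' i) <= w%:E)%E ->
  dual_feasible u0 u -> Int (gap u0 u T) <= delta -> 0 < delta ->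
  Int (gap u0 u T') <= 2 * delta + 2 * L * w.
Proof.
move=> muY opt opt' Ww df gapT d0; have TP := opt.1; have TP' := opt'.1.
have [v0 [v [dfv gapv]]] := optimal_certificate muY opt' d0.
have sumW (phi : 'I_N -> V -> R) :
    (forall i x y, phi i x - phi i y <= lam i * L * enorm (x - y)) ->
    \sum_i (Int (fun x => phi i (T i x)) - Int (fun x => phi i (T' i x))) <= L * w.
  move=> pl; rewrite -lee_fin -sumEFin EFinM.
  apply: (@le_trans _ _ (L%:E * \sum_i (lam i)%:E * W1 (mu i) (mu' i))%E); last first.
    by rewrite lee_wpmul2l// lee_fin ltW.
  rewrite ge0_sume_distrr; last first.
    move=> i _; rewrite mule_ge0 ?lee_fin ?l0'//.
    apply: le_ereal_inf_tmp => _ [pi _ <-].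
    by apply: integral_ge0 => z _; rewrite lee_fin enorm_ge0.
  apply: lee_sum => i _; rewrite muleA -EFinM (mulrC L).
  exact: W1_transport (lL _) TP TP' (pl i).
have h1 := sumW v (df_lip dfv).
have h2 : \sum_i (Int (fun x => u i (T' i x)) - Int (fun x => u i (T i x))) <= L * w.
  apply: le_trans (sumW (fun i x => - u i x) _); last first.
    by move=> i x y; rewrite opprK addrC enormC (df_lip df).
  apply: ler_sum => i _.
  have bi := bmeas_lip_transport TP i (ltW (lL _)) (df_lip df i).
  have bi' := bmeas_lip_transport TP' i (ltW (lL _)) (df_lip df i).
  by rewrite !(IntN rho mS)// opprK addrC.
rewrite sumrB in h1; rewrite sumrB in h2.
have g1 := bmeas_gap TP dfv.
have g1_ge0 : 0 <= Int (gap v0 v T) by apply: Rintegral_ge0 => x _; exact: gap_ge0.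
move: gapT gapv g1_ge0; rewrite (Int_gap TP df) (Int_gap TP' df) (Int_gap TP' dfv) (Int_gap TP dfv).
by lra.
Qed.

End DualCertificates.

(** * From duality gaps to the distance between the maps *)

Section MapEstimate.
Context (R : realType) (n N : nat).
Local Notation V := 'rV[R]_n.+1.
Context (rho : probability V R) (S Y : set V) (lambda : 'I_N.+1 -> R) (x0 : V) (D L kappa M : R).
Context (G : V -> R) (P : V -> V).
Hypotheses (dom : rho `<< lebesgue_rV R n.+1) (mS : measurable S).
Hypotheses (rhoM : Linfty_norm rho = M%:E).
Hypotheses (l0 : forall i, 0 < lambda i) (l1 : \sum_i lambda i = 1).
Hypotheses (D0 : 0 <= D) (L0 : 0 < L) (SYD : forall x, (S `|` Y) x -> enorm (x - x0) <= D).
Hypotheses (kappa0 : 0 < kappa) (regG : regular_on (conv_hull (S `|` Y)) kappa L G P).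
Implicit Types (T : 'I_N -> V -> V) (u : 'I_N -> V -> R).

Local Notation Int := (Rintegral rho S).
Local Notation lam i := (lambda (lift ord0 i)).
Local Notation dual_feasible := (dual_feasible lambda L G).
Local Notation gap := (gap lambda G).

Let lL i : 0 < lambda i * L. Proof. exact: mulr_gt0. Qed.

Let bary_addl h x (y : 'I_N -> V) : bary lambda (x + h) y = bary lambda x y + lambda ord0 *: h.
Proof. by rewrite /bary scalerDr addrAC. Qed.

(** The smallest [f] compatible with [u] is a supremum of translates of [G], hence
    convex. *)
Lemma convex_potential (u0 : V -> R) u : dual_feasible u0 u -> exists f, [/\ dual_feasible f u,
  forall x, f x <= u0 x & forall x h, 2 * f x <= f (x + h) + f (x - h)].
Proof.
move=> [lip0 lip feas]; pose E x := [set G (bary lambda x y) - \sum_i u i (y i) | y in [set: 'I_N -> V]].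
have E0 x : E x !=set0 by exists (G (bary lambda x (fun=> 0)) - \sum_i u i 0); exists (fun=> 0).
have Eu x : ubound (E x) (u0 x) by move=> _ [y _ <-]; rewrite lerBlDr feas.
have hub x : has_ubound (E x) by exists (u0 x).
pose f x := sup (E x).
have fE x y : G (bary lambda x y) - \sum_i u i (y i) <= f x by apply: ub_le_sup => //; exists y.
have fle x c : (forall y, G (bary lambda x y) - \sum_i u i (y i) <= c) -> f x <= c.
  by move=> h; apply: sup_le_ub => // _ [y _ <-].
exists f; split.
- split => // [x y|x y]; last by rewrite -lerBlDr.
  rewrite lerBlDr; apply: fle => z.
  have := fE y z; have := reg_lip regG (bary lambda x z) (bary lambda y z).
  have := bary_lipschitz x y z z (fun i => ltW (l0 i)).
  have -> : \sum_i lam i * enorm (z i - z i) = 0.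
    by rewrite big1 // => i _; rewrite subrr enorm0 mulr0.
  rewrite addr0.
  move=> h1; have := ler_wpM2l (ltW L0) h1; rewrite mulrA (mulrC L); lra.
- by move=> x; apply: fle => y; rewrite lerBlDr.
- move=> x h; have : f x <= (f (x + h) + f (x - h)) / 2.
    apply: fle => y; have := fE (x + h) y; have := fE (x - h) y.
    rewrite !bary_addl scalerN; have := reg_mid regG (bary lambda x y) (lambda ord0 *: h).
    lra.
  lra.
Qed.

Section pointwise.
Context (f : V -> R) (u : 'I_N -> V -> R) (df : dual_feasible f u).
Context (T T' : 'I_N -> V -> V) (x : V).
Hypotheses (Sx : S x) (YT : forall i, Y (T i x)) (YT' : forall i, Y (T' i x)).

Let b := bary lambda x (T ^~ x).
Let b' := bary lambda x (T' ^~ x).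
Let E := gap f u T x + gap f u T' x.
Let q := P b' - P b.

Let hull (y : 'I_N -> V) : (forall i, Y (y i)) -> conv_hull (S `|` Y) (bary lambda x y).
Proof.
move=> Yy; have := baryE lambda x (fun i _ => y i) => <-.
apply: conv_hull_sum => // i; apply: sub_conv_hull.
by rewrite /maps_point; case: unlift => [j|]; [right|left].
Qed.

(** Up to the gaps, the gradients [lambda ord0 *: P b] and [lambda ord0 *: P b'] are
    subgradients of [f] at [x]: evaluate one at [x - h], the other at [x + h]. *)
Lemma second_difference_ge h :
  lambda ord0 * dot q h <= f (x + h) + f (x - h) - 2 * f x + E.
Proof.
have h1 := df_feas df (x - h) (T ^~ x); have h2 := df_feas df (x + h) (T' ^~ x).
rewrite bary_addl scalerN -/b in h1; rewrite bary_addl -/b' in h2.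
have s1 := reg_sub regG (b - lambda ord0 *: h) (hull YT).
have s2 := reg_sub regG (b' + lambda ord0 *: h) (hull YT').
move: h1 h2 s1 s2; rewrite -/b -/b' [b - _ - b]addrAC [b' + _ - b']addrAC !subrr !add0r.
by rewrite dotNr !dotZr /E /gap /q -/b -/b' dotBl; lra.
Qed.

Lemma coord_gradient_le r k : 0 < r ->
  lambda ord0 * r * `|q 0 k| <=
  f (x + r *: delta_mx 0 k) + f (x - r *: delta_mx 0 k) - 2 * f x + E.
Proof.
move=> r0; have [q0|q0] := leP 0 (q 0 k).
  have := second_difference_ge (r *: delta_mx 0 k).
  by rewrite ger0_norm// dotZr dot_delta mulrA.
have := second_difference_ge (- (r *: delta_mx 0 k)).
rewrite ltr0_norm// opprK dotNr dotZr dot_delta mulrN -[_ * r * _]mulrA mulrN.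
by rewrite mulrN [f (x - _) + _]addrC.
Qed.

(** The potentials are tested on the two tuples obtained by exchanging the [i]-th
    coordinates of [T x] and [T' x]; strong convexity of [G] bounds their gains from
    below. *)
Lemma exchange_le i : kappa * (lam i * enorm (T' i x - T i x)) ^+ 2 <=
  lam i * dot q (T' i x - T i x) + E.
Proof.
set d := T' i x - T i x.
pose y j := if j == i then T' j x else T j x.
pose y' j := if j == i then T j x else T' j x.
have Yy j : Y (y j) by rewrite /y; case: ifP.
have Yy' j : Y (y' j) by rewrite /y'; case: ifP.
have by_ : bary lambda x y = b + lam i *: d.
  rewrite /b /bary -addrA; congr (_ + _); rewrite (bigD1 i)//= [in RHS](bigD1 i)//=.
  rewrite {1}/y eqxx addrAC -scalerDr subrKC; congr (_ + _).
  by apply: eq_bigr => j /negbTE ji; rewrite /y ji.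
have by'_ : bary lambda x y' = b' - lam i *: d.
  rewrite /b' /bary -addrA; congr (_ + _); rewrite (bigD1 i)//= [in RHS](bigD1 i)//=.
  rewrite {1}/y' eqxx addrAC -scalerBr opprB subrKC; congr (_ + _).
  by apply: eq_bigr => j /negbTE ji; rewrite /y' ji.
have sumu : \sum_j u j (y j) + \sum_j u j (y' j) = \sum_j u j (T j x) + \sum_j u j (T' j x).
  rewrite -!big_split; apply: eq_bigr => j _ /=; rewrite /y /y'.
  by case: ifP => // _; rewrite addrC.
have h1 := df_feas df x y; have h2 := df_feas df x y'.
have s1 := reg_strong regG (hull YT) (hull Yy).
have s2 := reg_strong regG (hull YT') (hull Yy').
move: h1 h2 s1 s2; rewrite by_ by'_ -/b -/b' (addrC b) addrK (addrC b') addrK.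
rewrite enormN dotNr !dotZr enormZ gtr0_norm// /E /gap -/b -/b' /q dotBl.
move: sumu; lra.
Qed.

(** Young's inequality in [exchange_le] leaves the square of [q], at most [2 * L]
    times the sum of its coordinates, which [coord_gradient_le] bounds. *)
Lemma map_distance_le i r : 0 < r ->
  (lam i * enorm (T' i x - T i x)) ^+ 2 <= 2 / kappa *
  (L / (kappa * lambda ord0 * r) * (\sum_k (f (x + r *: delta_mx 0 k) +
     f (x - r *: delta_mx 0 k) - 2 * f x) + n.+1%:R * E) + E).
Proof.
move=> r0; set A := \sum_k _; set d := enorm _.
have c0 : 0 < lambda ord0 * r by rewrite mulr_gt0.
have qL k : `|q 0 k| <= 2 * L.
  have PL z : conv_hull (S `|` Y) z -> `|P z 0 k| <= L.
    by move=> Hz; rewrite (le_trans (coord_le_enorm _ _))// (reg_grad regG).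
  have := PL _ (hull YT); have := PL _ (hull YT'); rewrite /q !mxE => a1 a2.
  by rewrite (le_trans (ler_normB _ _))// mulr2n mulrDl mul1r lerD.
have q2 : enorm q ^+ 2 <= 2 * L * ((A + n.+1%:R * E) / (lambda ord0 * r)).
  have s1 : \sum_k `|q 0 k| <= (A + n.+1%:R * E) / (lambda ord0 * r).
    rewrite ler_pdivlMr// mulrC mulr_sumr.
    have -> : A + n.+1%:R * E = \sum_(k < n.+1) (f (x + r *: delta_mx 0 k) +
      f (x - r *: delta_mx 0 k) - 2 * f x + E).
      by rewrite big_split/= sumr_const card_ord mulr_natl.
    by apply: ler_sum => k _; exact: coord_gradient_le.
  rewrite sqr_enorm; apply: (@le_trans _ _ (2 * L * \sum_k `|q 0 k|)).
    rewrite mulr_sumr; apply: ler_sum => k _.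
    rewrite -expr2 -real_normK ?num_real// expr2 ler_wpM2r//.
  by rewrite ler_wpM2l// mulr_ge0// ltW.
have ex := exchange_le i; rewrite -/d in ex.
have cs : lam i * dot q (T' i x - T i x) <= enorm q * (lam i * d).
  by rewrite mulrCA ler_wpM2l ?dot_le// ltW.
have yng : enorm q * (lam i * d) <= enorm q ^+ 2 / (2 * kappa) + kappa / 2 * (lam i * d) ^+ 2.
  rewrite -subr_ge0 (_ : _ - _ = (enorm q - kappa * (lam i * d)) ^+ 2 / (2 * kappa)).
    by rewrite divr_ge0 ?sqr_ge0// mulr_ge0// ltW.
  by field; rewrite gt_eqF.
have key : kappa / 2 * (lam i * d) ^+ 2 <= enorm q ^+ 2 / (2 * kappa) + E by move: ex cs yng; lra.
have : (lam i * d) ^+ 2 <= 2 / kappa * (enorm q ^+ 2 / (2 * kappa) + E).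
  have k2 : 0 < kappa / 2 by rewrite divr_gt0.
  rewrite -(ler_pM2l k2) (le_trans key)// le_eqVlt; apply/orP; left; apply/eqP.
  by field; rewrite gt_eqF.
move=> /le_trans; apply; rewrite ler_wpM2l ?divr_ge0 ?(ltW kappa0)// lerD2r.
rewrite ler_pdivrMr ?mulr_gt0//; apply: le_trans q2 _.
rewrite le_eqVlt; apply/orP; left; apply/eqP; field.
by rewrite !gt_eqF// mulr_gt0.
Qed.

End pointwise.

(** The pointwise bound, integrated: the second differences cost [r ^+ 2] and the
    gaps [eps], both divided by [r]. *)
Lemma integral_map_distance_le (mu mu' : 'I_N -> probability V R) T T' (u0 : V -> R) u i r eps :
  transport_maps S Y rho mu T -> transport_maps S Y rho mu' T' ->
  dual_feasible u0 u -> Int (gap u0 u T) + Int (gap u0 u T') <= eps -> 0 < r ->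
  Int (fun x => (lam i * enorm (T' i x - T i x)) ^+ 2) <=
  2 / kappa * (L / (kappa * lambda ord0 * r) *
    (n.+1%:R * (M * (2 * (lambda ord0 * L) * r ^+ 2 * (2 * D) ^+ n)) + n.+1%:R * eps) + eps).
Proof.
move=> TP TP' dfu gapE r0; have [f [df fu fmid]] := convex_potential dfu.
have GL := reg_lip regG.
have lf := df_lip0 df.
pose dlt k x := f (x + r *: delta_mx 0 k) + f (x - r *: delta_mx 0 k) - 2 * f x.
pose E x := gap f u T x + gap f u T' x.
have bgap (v0 : V -> R) T0 mu0 : transport_maps S Y rho mu0 T0 -> dual_feasible v0 u -> bmeas S (gap v0 u T0).
  by move=> TP0 dfv; exact: (bmeas_gap mS l0 l1 L0 SYD GL TP0 dfv).
have bE : bmeas S E by apply: bmeasD; [exact: bgap TP df|exact: bgap TP' df].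
have mf : measurable_fun setT f := lipschitz_measurable lf.
have mfh (a : V) : measurable_fun setT (fun x : V => f (x + a)).
  exact: (measurableT_comp mf (measurable_addr a)).
have mdlt k : measurable_fun setT (dlt k).
  apply: measurable_funB; last by apply: measurable_funM => //; exact: measurable_cst.
  by apply: measurable_funD; exact: mfh.
have hE k : enorm (r *: delta_mx 0 k : V) = r.
  rewrite enormZ gtr0_norm// (_ : enorm _ = 1) ?mulr1//.
  by apply/eqP; rewrite -(@eqrXn2 _ 2)// ?enorm_ge0// sqr_enorm dot_delta mxE !eqxx expr1n.
have dlt0 k x : 0 <= dlt k x by rewrite subr_ge0.
have dltM k x : dlt k x <= 2 * (lambda ord0 * L * r).
  have := lf (x + r *: delta_mx 0 k) x; have := lf (x - r *: delta_mx 0 k) x.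
  by rewrite [x - _ - x]addrAC [x + _ - x]addrAC !subrr !add0r enormN !hE /dlt; lra.
have bdlt k : bmeas S (dlt k).
  split; first exact: measurable_funS (mdlt k).
  by exists (2 * (lambda ord0 * L * r)) => x _; rewrite ger0_norm.
have bA : bmeas S (fun x => \sum_k dlt k x) by exact: bmeas_sum.
have Idlt k : Int (dlt k) <= M * (2 * (lambda ord0 * L) * r ^+ 2 * (2 * D) ^+ n).
  rewrite -lee_fin (IntE rho mS (bdlt k)).
  pose B := box (x0 - const_mx D) (x0 + const_mx D).
  have mB : measurable B by exact: measurable_box.
  have M0 : 0 <= M by rewrite -lee_fin -rhoM; exact: Lnorm_ge0.
  apply: (@le_trans _ _ (\int[rho]_(x in B) (dlt k x)%:E)%E).
    apply: ge0_subset_integral => //.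
    - by apply/measurable_EFinP; exact: measurable_funS (mdlt k).
    - by move=> x _; rewrite lee_fin.
    move=> x Sx j; have xD : enorm (x - x0) <= D by apply: SYD; left.
    have := le_trans (coord_le_enorm (x - x0) j) xD.
    by rewrite !mxE ler_norml => /andP[h1 h2]; apply/andP; split; lra.
  apply: le_trans (density_integral_le (K := 2 * (lambda ord0 * L * r)) dom rhoM mB (mdlt k) _) _.
    by move=> x _; rewrite dlt0 dltM.
  rewrite EFinM lee_wpmul2l ?lee_fin//.
  exact: (@integral_second_difference R n f (lambda ord0 * L) D r x0 k lf fmid (ltW (lL _)) D0 (ltW r0)).
have IE : Int E <= eps.
  apply: le_trans gapE; rewrite (IntD rho mS (bgap _ _ _ TP df) (bgap _ _ _ TP' df)).
  by apply: lerD; apply: le_Rintegral => //; try (apply: bmeas_integrable => //; exact: bgap);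
    move=> x _; rewrite /gap lerD2r lerD2r.
have c0 : 0 <= L / (kappa * lambda ord0 * r).
  by rewrite divr_ge0 ?(ltW L0)// !mulr_ge0// ltW.
have k0 : 0 <= 2 / kappa by rewrite divr_ge0// ltW.
have scal (c : R) (h : V -> R) : bmeas S h -> bmeas S (fun x => c * h x).
  move=> [mh [K hK]]; split; first by apply: measurable_funM => //; exact: measurable_cst.
  by exists (`|c| * K) => x Sx; rewrite normrM ler_wpM2l// hK.
have Iscal (c : R) (h : V -> R) : bmeas S h -> Int (fun x => c * h x) = c * Int h.
  by move=> bh; apply: RintegralZl => //; exact: bmeas_integrable.
pose rhs x := 2 / kappa * (L / (kappa * lambda ord0 * r) * (\sum_k dlt k x + n.+1%:R * E x) + E x).
have b1 : bmeas S (fun x => \sum_k dlt k x + n.+1%:R * E x) by apply: bmeasD => //; exact: scal.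
have b2 : bmeas S (fun x => L / (kappa * lambda ord0 * r) * (\sum_k dlt k x + n.+1%:R * E x) + E x).
  by apply: bmeasD => //; exact: scal.
have mTT : measurable_fun S (fun x => (lam i * enorm (T' i x - T i x)) ^+ 2).
  apply: measurable_funX; apply: measurable_funM; first exact: measurable_cst.
  apply: (measurableT_comp (@measurable_enorm R n.+1)).
  apply: measurable_row_in => // j; under eq_fun do rewrite !mxE.
  apply: measurable_funB; apply: (measurableT_comp (@measurable_coord R n.+1 j)).
    by case: (TP' i).
  by case: (TP i).
have ptw x : S x -> (lam i * enorm (T' i x - T i x)) ^+ 2 <= rhs x.
  move=> Sx; apply: map_distance_le => // j; [by case: (TP j) => _ h _; exact: h|].
  by case: (TP' j) => _ h _; exact: h.
have brhs : bmeas S rhs by exact: scal.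
have bT : bmeas S (fun x => (lam i * enorm (T' i x - T i x)) ^+ 2).
  split => //; case: brhs => _ [K rK]; exists K => x Sx.
  rewrite ger0_norm ?sqr_ge0// (le_trans (ptw x Sx))// (le_trans _ (rK x Sx))//.
  exact: ler_norm.
apply: (@le_trans _ _ (Int rhs)).
  by apply: le_Rintegral => //; exact: bmeas_integrable.
have sb1 := scal (L / (kappa * lambda ord0 * r)) _ b1.
have sbE := scal n.+1%:R _ bE.
rewrite /rhs (Iscal (2 / kappa) _ b2) ler_wpM2l// (IntD rho mS sb1 bE) (Iscal _ _ b1).
rewrite lerD// ler_wpM2l// (IntD rho mS bA sbE) (Iscal _ _ bE) lerD//.
  rewrite (Int_sum rho mS)// (@le_trans _ _ (\sum_(k < n.+1) (M * (2 * (lambda ord0 * L) * r ^+ 2 * (2 * D) ^+ n))))//.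
    by apply: ler_sum => k _.
  by rewrite sumr_const card_ord -[leLHS]mulr_natl.
by rewrite ler_wpM2l.
Qed.

End MapEstimate.

(** * The stability estimate *)

Section Assembly.
Context (R : realType).

Lemma diam_ge n (A : set 'rV[R]_n) x y : compact A -> A x -> A y ->
  enorm (x - y) <= diam A.
Proof.
move=> cA Ax Ay; apply: ub_le_sup; last by exists x => //; exists y.
have [K [_ KA]] := compact_bounded cA.
exists (n%:R * (K + 1 + (K + 1))) => _ [u Au [v Av <-]].
apply: le_trans (enorm_le_norm _) _; rewrite ler_wpM2l//.
by rewrite (le_trans (ler_normB _ _))// lerD// KA// ltrDl.
Qed.

Lemma L2distE n (rho : probability 'rV[R]_n R) (S : set 'rV[R]_n) f g :
  measurable S -> bmeas S (fun x => enorm (f x - g x) ^+ 2) ->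
  L2dist rho S f g = (Num.sqrt (\int[rho]_(x in S) (enorm (f x - g x) ^+ 2)))%:E.
Proof.
move=> mS bfg; rewrite /L2dist unlock.
rewrite (_ : (\int[rho]_x _)%E = (\int[rho]_(x in S) (enorm (f x - g x) ^+ 2))%:E).
  by rewrite poweR_EFin powR12_sqrt// Rintegral_ge0// => x _; exact: sqr_ge0.
rewrite (IntE rho mS bfg) [RHS]integral_mkcond; apply: eq_integral => x _.
rewrite !patchE; case: ifPn => xS.
  rewrite /= ger0_norm ?enorm_ge0//.
  by rewrite powR_mulrn ?enorm_ge0.
by rewrite abse0 poweR0r// pnatr_eq0.
Qed.

Lemma L2dist0 (rho : probability 'rV[R]_0 R) S f g : L2dist rho S f g = 0%E.
Proof.
rewrite /L2dist (@eq_Lnorm _ _ _ _ _ _ (cst 0%E)); first by rewrite Lnorm0// eqe pnatr_eq0.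
by move=> x; rewrite patchE; case: ifP => // _; rewrite /= [f x - g x]thinmx0 enorm0.
Qed.

(** The bound of [integral_map_distance_le] for a step [r = sqrt w] and gaps
    [eps = 3 L w], divided by [sqrt w]. *)
Definition stability_constant (n : nat) (lambda1 D kappa L M : R) : R :=
  2 / kappa * (L / (kappa * lambda1) *
    (n.+1%:R * (M * (2 * (lambda1 * L) * (2 * D) ^+ n)) + n.+1%:R * (3 * L)) + 3 * L).

Section core.
Context (n N : nat).
Local Notation V := 'rV[R]_n.+1.
Context (lambda : 'I_N.+1 -> R) (D kappa tau M : R) (S Y U : set V) (F : V -> R).
Context (rho : probability V R) (mu mu' : 'I_N -> probability V R) (T T' : 'I_N -> V -> V).
Hypotheses (hkappa : 0 < kappa <= 1) (htau : 0 <= tau).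
Hypotheses (l0 : forall i, 0 < lambda i) (l1 : \sum_i lambda i = 1).
Hypotheses (cS : compact S) (cY : compact Y) (diamD : diam (S `|` Y) = D).
Hypotheses (oU : open U) (HU : closure (conv_hull (S `|` Y)) `<=` U) (C2F : C2_on U F).
Hypothesis hessF : forall x v, U x ->
  - tau * enorm v ^+ 2 <= quad_form (hessian F x) v <= (1 - kappa) * enorm v ^+ 2.
Hypotheses (rhoS : rho S = 1%E) (dom : rho `<< lebesgue_rV R n.+1).
Hypothesis rhoM : Linfty_norm rho = M%:E.
Hypotheses (muY : forall i, mu i Y = 1%E) (muY' : forall i, mu' i Y = 1%E).
Hypotheses (opt : optimal_maps (cost lambda F) S Y rho mu T).
Hypotheses (opt' : optimal_maps (cost lambda F) S Y rho mu' T').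

Local Notation lam i := (lambda (lift ord0 i)).
Local Notation L := ((1 + tau) * D + 1).
Local Notation Int := (Rintegral rho S).
Local Notation K := (stability_constant n (lambda ord0) D kappa L M).

Let diam_le x y : (S `|` Y) x -> (S `|` Y) y -> enorm (x - y) <= D.
Proof. by rewrite -diamD; apply: diam_ge; exact: compactU. Qed.

Let S_neq0 : exists x0, S x0.
Proof.
apply: contrapT => no; move: rhoS; rewrite (_ : S = set0) ?measure0.
  by move=> /esym/eqP; rewrite onee_eq0.
by apply/seteqP; split => y // Sy; apply: no; exists y.
Qed.

Let D0 : 0 <= D.
Proof.
have [x0 Sx0] := S_neq0; have := @diam_le x0 x0 (or_introl Sx0) (or_introl Sx0).
by rewrite subrr enorm0.
Qed.

Let mS : measurable S.
Proof.
rewrite -[S]setCK; apply: measurableC; apply: open_measurable_rV.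
by rewrite openC; apply: compact_closed => //; exact: norm_hausdorff.
Qed.

Let mY : measurable Y.
Proof.
rewrite -[Y]setCK; apply: measurableC; apply: open_measurable_rV.
by rewrite openC; apply: compact_closed => //; exact: norm_hausdorff.
Qed.

Let TY i x : S x -> Y (T i x). Proof. by case: opt => /(_ i)[_ h _] _; exact: h. Qed.
Let TY' i x : S x -> Y (T' i x). Proof. by case: opt' => /(_ i)[_ h _] _; exact: h. Qed.

Let bdist i : bmeas S (fun x => enorm (T i x - T' i x) ^+ 2).
Proof.
split.
  apply: measurable_funX; apply: (measurableT_comp (@measurable_enorm R n.+1)).
  apply: measurable_row_in => // j; under eq_fun do rewrite !mxE.
  apply: measurable_funB; apply: (measurableT_comp (@measurable_coord R n.+1 j)).
    by case: opt => /(_ i)[].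
  by case: opt' => /(_ i)[].
exists (D ^+ 2) => x Sx; rewrite ger0_norm ?sqr_ge0// ler_sqr ?nnegrE ?enorm_ge0//.
by apply: diam_le; right; [exact: TY|exact: TY'].
Qed.

Let K0 : 0 <= K.
Proof.
have M0 : 0 <= M by rewrite -lee_fin -rhoM; exact: Lnorm_ge0.
have /andP[k0 _] := hkappa; have l00 := ltW (l0 ord0).
have L0 : 0 <= L by rewrite addr_ge0// mulr_ge0// addr_ge0.
rewrite /stability_constant mulr_ge0 ?divr_ge0 ?(ltW k0)// addr_ge0 ?mulr_ge0//.
  by rewrite invr_ge0 mulr_ge0// ltW.
rewrite addr_ge0// !mulr_ge0// exprn_ge0// mulr_ge0//.
Qed.

(** With gaps of order [w], the step [r = sqrt w] balances the second differences,
    of order [r], and the gaps, of order [w / r]. *)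
Lemma squared_distance_le_pos w i : 0 < w <= 1 ->
  (\sum_i (lam i)%:E * W1 (mu i) (mu' i) <= w%:E)%E ->
  lam i ^+ 2 * Int (fun x => enorm (T i x - T' i x) ^+ 2) <= K * Num.sqrt w.
Proof.
move=> /andP[w0 w1] Ww; have /andP[k0 _] := hkappa.
have [x0 Sx0] := S_neq0.
have SYD x : (S `|` Y) x -> enorm (x - x0) <= D by move=> h; apply: diam_le => //; left.
have L0 : 0 < L by rewrite ltr_wpDl// mulr_ge0// addr_ge0.
have HU' : conv_hull (S `|` Y) `<=` U := subset_trans (@subset_closure _ _) HU.
have [G [P [q [regG FG]]]] := @regular_extension R n.+1 (S `|` Y) U F kappa tau D L x0
  oU C2F htau (ltW k0) hessF HU' (or_introl Sx0) SYD (ltW (ltr_pwDr ltr01 (lexx _))).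
have GL := reg_lip regG.
pose delta := L * w / 3.
have d0 : 0 < delta by rewrite divr_gt0// mulr_gt0.
have [u0 [u [df gapT]]] := optimal_certificate dom mS mY rhoS l0 l1 D0 L0 SYD GL FG muY opt d0.
have gapT' := stability_of_certificate dom mS mY rhoS l0 l1 D0 L0 SYD GL FG muY' opt opt' Ww df gapT d0.
have sw0 : 0 < Num.sqrt w by rewrite sqrtr_gt0.
have eps : Int (gap lambda G u0 u T) + Int (gap lambda G u0 u T') <= 3 * L * w.
  by move: gapT gapT'; rewrite /delta; lra.
have := integral_map_distance_le dom mS rhoM l0 l1 D0 L0 SYD k0 regG i opt.1 opt'.1 df eps sw0.
have -> : Int (fun x => (lam i * enorm (T' i x - T i x)) ^+ 2) =
    lam i ^+ 2 * Int (fun x => enorm (T i x - T' i x) ^+ 2).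
  rewrite -RintegralZl//; last exact: bmeas_integrable.
  by apply: eq_Rintegral => x _; rewrite enormC exprMn.
move=> /le_trans; apply.
have sw : Num.sqrt w ^+ 2 = w by rewrite sqr_sqrtr// ltW.
have sw1 : Num.sqrt w <= 1 by rewrite -sqrtr1 ler_wsqrtr.
have -> : 3 * L * w = 3 * L * Num.sqrt w ^+ 2 by rewrite sw.
move: (Num.sqrt w) sw0 sw1 => s s0 s1.
move: ((1 + tau) * D + 1) L0 => l lp.
rewrite /stability_constant -(mulrA (2 / kappa)).
apply: ler_wpM2l; first by rewrite divr_ge0// ltW.
rewrite [leRHS]mulrDl; apply: lerD.
  rewrite le_eqVlt; apply/orP; left; apply/eqP; field.
  by rewrite !gt_eqF.
by rewrite expr2 mulrA ler_piMr// !mulr_ge0 ?(ltW s0)// ltW.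
Qed.

Lemma squared_distance_le w i : 0 <= w <= 1 ->
  (\sum_i (lam i)%:E * W1 (mu i) (mu' i) <= w%:E)%E ->
  lam i ^+ 2 * Int (fun x => enorm (T i x - T' i x) ^+ 2) <= K * Num.sqrt w.
Proof.
move=> /andP[]; rewrite le_eqVlt => /orP[/eqP <- _ W0|w0 w1 Ww]; last first.
  by apply: squared_distance_le_pos; rewrite ?w0.
rewrite sqrtr0 mulr0 leNgt; apply/negP; set c := _ * _ => c0.
have Kc : 0 < K + c by rewrite ltr_wpDl.
(* If the distance [c] were positive, [w = t ^ 2] with this [t] would make
   [K * t] smaller than [c]. *)
pose t := c / (K + c).
have t0 : 0 < t by rewrite divr_gt0.
have t1 : t <= 1 by rewrite ler_pdivrMr// mul1r lerDr.
have := @squared_distance_le_pos (t ^+ 2) i.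
rewrite exprn_gt0//= expr_le1 ?(ltW t0)// t1 => /(_ isT) h.
have {}h : c <= K * t.
  rewrite -[t in X in _ <= X](ger0_norm (ltW t0)) -sqrtr_sqr; apply: h.
  by apply: le_trans W0 _; rewrite lee_fin sqr_ge0.
move: h; rewrite /t mulrA ler_pdivlMr//; nra.
Qed.

Lemma L2dist_le_diam i : (L2dist rho S (T i) (T' i) <= D%:E)%E.
Proof.
rewrite (L2distE rho mS (bdist i)).
rewrite lee_fin -[leRHS]ger0_norm// -sqrtr_sqr ler_wsqrtr//.
have -> : D ^+ 2 = Int (fun=> D ^+ 2) by rewrite Rintegral_cst// [X in fine X]rhoS mulr1.
apply: le_Rintegral => //.
- exact/bmeas_integrable/bdist.
- exact/bmeas_integrable/bmeas_cst.
move=> x Sx; rewrite ler_sqr ?nnegrE ?enorm_ge0//.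
by apply: diam_le; right; [exact: TY|exact: TY'].
Qed.

Lemma L2dist_stability :
  (\sum_(i < N) (lam i)%:E * L2dist rho S (T i) (T' i) <=
   (N%:R * Num.sqrt K + D + 1)%:E * (\sum_(i < N) (lam i)%:E * W1 (mu i) (mu' i))
            `^ (4%:R^-1))%E.
Proof.
set W := (\sum_(i < N) (lam i)%:E * W1 (mu i) (mu' i))%E.
set C := N%:R * Num.sqrt K + D + 1.
have NK0 : 0 <= N%:R * Num.sqrt K by rewrite mulr_ge0// sqrtr_ge0.
have C1 : 1 <= C by rewrite /C; have := D0; lra.
have W0 : (0 <= W)%E.
  apply: sume_ge0 => i _; apply: mule_ge0; first by rewrite lee_fin ltW.
  apply: le_ereal_inf_tmp => _ [pi _ <-].
  by apply: integral_ge0 => z _; rewrite lee_fin enorm_ge0.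
have pow4 w : 0 <= w -> w `^ (4%:R^-1) = Num.sqrt (Num.sqrt w).
  move=> w0; rewrite -!powR12_sqrt ?powR_ge0// -powRrM; congr (_ `^ _).
  by field.
(* When [W] exceeds [1], the diameter is a sufficient bound. *)
have [W1|W1] := leP W 1%E; last first.
  apply: (@le_trans _ _ D%:E).
    apply: (@le_trans _ _ (\sum_(i < N) (lam i * D)%:E)%E).
      by apply: lee_sum => i _; rewrite EFinM lee_wpmul2l ?L2dist_le_diam// lee_fin ltW.
    rewrite sumEFin lee_fin -mulr_suml ler_piMl//.
    by rewrite -l1 big_ord_recl lerDr ltW.
  apply: (@le_trans _ _ C%:E); first by rewrite lee_fin /C; lra.
  rewrite -[leLHS]mule1 lee_wpmul2l ?lee_fin ?(le_trans _ C1)//.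
  move: W0 W1; case: W => [w| |]//; last by rewrite poweRyr ?leey// invr_neq0// pnatr_eq0.
  rewrite !lee_fin !lte_fin => w0 w1; rewrite pow4//.
  by rewrite -[leLHS]sqrtr1 ler_wsqrtr// -[leLHS]sqrtr1 ler_wsqrtr// ltW.
have [w WE] : exists w, W = w%:E.
  exists (fine W); rewrite fineK// ge0_fin_numE//.
  by apply: le_lt_trans W1 _; exact: ltry.
rewrite WE in W0 W1 *; rewrite !lee_fin in W0 W1.
rewrite poweR_EFin pow4// -EFinM.
apply: (@le_trans _ _ (\sum_(i < N) (Num.sqrt K * Num.sqrt (Num.sqrt w))%:E)%E).
  apply: lee_sum => i _; rewrite (L2distE rho mS (bdist i)).
  rewrite -EFinM lee_fin -(sqrtrM _ K0).
  have -> : lam i = Num.sqrt (lam i ^+ 2) by rewrite sqrtr_sqr ger0_norm// ltW.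
  rewrite -sqrtrM ?sqr_ge0//.
  apply: ler_wsqrtr; apply: squared_distance_le; first by rewrite W0.
  by rewrite -/W WE.
rewrite sumEFin lee_fin sumr_const card_ord -[leLHS]mulr_natl mulrA ler_wpM2r ?sqrtr_ge0//.
by rewrite /C; have := D0; lra.
Qed.

End core.

End Assembly.

Theorem proposition4p2 (R : realType) (n N : nat) (hN : (3 <= N.+1)%N)
  (lambda1 D kappa tau M : R) (hkappa : 0 < kappa <= 1) (htau : 0 <= tau) :
  exists2 C : R, 0 < C &
  forall (lambda : 'I_N.+1 -> R) (S Y U : set 'rV[R]_n) (F : 'rV[R]_n -> R)
    (rho : probability 'rV[R]_n R)
    (mu mu' : 'I_N -> probability 'rV[R]_n R)
    (T T' : 'I_N -> 'rV[R]_n -> 'rV[R]_n),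
  (forall i, 0 < lambda i) -> \sum_i lambda i = 1 -> lambda ord0 = lambda1 ->
  compact S -> compact Y -> diam (S `|` Y) = D ->
  open U -> closure (conv_hull (S `|` Y)) `<=` U ->
  C2_on U F ->
  (forall x v, U x ->
    - tau * enorm v ^+ 2 <= quad_form (hessian F x) v
      <= (1 - kappa) * enorm v ^+ 2) ->
  rho S = 1%E -> rho `<< lebesgue_rV R n -> Linfty_norm rho = M%:E ->
  (forall i, mu i Y = 1%E) -> (forall i, mu' i Y = 1%E) ->
  optimal_maps (cost lambda F) S Y rho mu T ->
  optimal_maps (cost lambda F) S Y rho mu' T' ->
  (\sum_(i < N) (lambda (lift ord0 i))%:E * L2dist rho S (T i) (T' i) <=
   C%:E * (\sum_(i < N) (lambda (lift ord0 i))%:E * W1 (mu i) (mu' i))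
            `^ (4%:R^-1))%E.
Proof.
case: n => [|n].
  exists 1 => // lambda S Y U F rho mu mu' T T' *.
  rewrite big1 => [|i _]; last by rewrite L2dist0 mule0.
  by rewrite mule_ge0// poweR_ge0.
pose C := N%:R * Num.sqrt (stability_constant n lambda1 D kappa ((1 + tau) * D + 1) M) + D + 1.
exists (Num.max C 1); first by rewrite lt_max ltr01 orbT.
move=> lambda S Y U F rho mu mu' T T' l0 l1 ll cS cY dD oU HU C2F hessF rhoS dom rhoM muY muY' opt opt'.
have := L2dist_stability hkappa htau l0 l1 cS cY dD oU HU C2F hessF rhoS dom rhoM muY muY' opt opt'.
rewrite ll -/C => /le_trans; apply.
by apply: lee_wpmul2r; [exact: poweR_ge0|rewrite lee_fin le_max lexx].
Qed.
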